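(* Let $(B_n)_{n\ge1}$ be i.i.d. real random variables with common distribution $\mu$ such that $\mathrm{supp}(\mu)\cap(0,\infty)\neq\emptyset$, there is no $\kappa>0$ with $\mathrm{supp}(\mu)\subset\kappa\cdot\mathbb Z$, and $\mathrm{Pr}[B_1<0]>0$. Then the reflected random walk $X_0^x=x\ge0$, $X_n^x=|X_{n-1}^x-B_n|$ is (topologically) recurrent on $\mathsf L=\mathbb R^+=[0,\infty)$, if (a) $\mathsf E(B_1^-)<\mathsf E(B_1^+)$ and $\mathsf E\bigl(\sqrt{B_1^+}\bigr)<\infty$, or if (b) $0<\mathsf E(B_1^-)=\mathsf E(B_1^+)$ and $\mathsf E\Bigl(\sqrt{B_1^+}^{\,3}\Bigr)<\infty$.
   Context: $B_1^+=\max\{B_1,0\}$ and $B_1^-=\max\{-B_1,0\}$; in (a), $\mathsf E(B_1^+)=\infty$ is allowed. Topological recurrence on $\mathsf L$ means: for every open set $U\subset\mathbb R^+$ that intersects $\mathsf L$ and every $x\in\mathsf L$, $\mathrm{Pr}[X_n^x\in U\text{ infinitely often}]=1$. *)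

(* Defs.v *)
From mathcomp Require Export all_boot all_order all_algebra finmap.
From mathcomp Require Export all_classical all_reals all_analysis.

Set Implicit Arguments.
Unset Strict Implicit.
Unset Printing Implicit Defensive.

Export Order.TTheory GRing.Theory Num.Theory.
Export numFieldNormedType.Exports.

Local Open Scope classical_set_scope.
Local Open Scope ring_scope.

Definition mutually_independent {d d'} {T : measurableType d}
    {T' : measurableType d'} {R : realType} (P : probability T R)
    {I : choiceType} (X : I -> {RV P >-> T'}) : Prop :=
  forall (J : {fset I}) (A : I -> set T'), (forall i, measurable (A i)) ->
    P (\bigcap_(i in [set` J]) (X i @^-1` A i)) =
    (\prod_(i <- J) P (X i @^-1` A i))%E.

Definition measure_support {R : realType} (mu : probability R R) : set R :=
  [set x | forall V : set R, open V -> V x -> (0 < mu V)%E].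

(* Increments are indexed from 0: [B n] is the increment B_{n+1}. *)
Definition iid_with_law {d} {T : measurableType d} {R : realType}
    {P : probability T R} (B : nat -> {RV P >-> R})
    (mu : probability R R) : Prop :=
  mutually_independent B /\
  forall (n : nat) (A : set R), measurable A -> distribution P (B n) A = mu A.

Fixpoint reflected_walk {T : Type} {R : realType} (B : nat -> T -> R)
    (x : R) (n : nat) (w : T) : R :=
  if n is m.+1 then `| reflected_walk B x m w - B m w | else x.

Definition nonneg_reals (R : realType) : set R := [set x : R | 0 <= x].
Arguments nonneg_reals R : clear implicits.

(* The open subsets of the space [0, oo) are the traces on it of the
   open subsets [V] of R; [X x] is the process started at [x]. *)
Definition topologically_recurrent {d} {T : measurableType d} {R : realType}
    (P : probability T R) (X : R -> nat -> T -> R) (L : set R) : Prop :=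
  forall V : set R, open V ->
  let U := V `&` nonneg_reals R in
  U `&` L !=set0 -> forall x : R, L x ->
  P (lim_sup_set (fun n => X x n @^-1` U)) = 1%E.

(* Main.v *)
From HB Require Import structures.
Require Import Defs.
From mathcomp Require Import measurable_realfun ring lra.

(* Let [Y] be the walk with steps [-B_n] started at [0] and killed when it first
   becomes negative, [eta] the law of its overshoot below [0] with tail
   [H x = eta ]x, oo[], and [green g] the expectation of the sum of [g Y_n] while
   [Y] is alive.  The measure [nu g], the integral over [x > 0] of
   [H x * green (g (x + .))], is excessive for the reflected walk, by Fubini and
   the invariance of Lebesgue measure.  It may be infinite, but its flux [rho]
   through the reflections has mass [\int H^2].  If [kappa t] bounds
   [green 1_[0, t[], then [H x <= E[kappa B; B > x]], and since
   [min(b, b') <= sqrt b * sqrt b'] we get [\int H^2 <= (E[kappa B * sqrt B^+])^2].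
   Under positive drift [kappa] is constant; under zero drift time reversal makes
   it linear: this is where the exponents 1/2 and 3/2 come from.  Overshooting is
   certain, so finiteness of the flux forces the probability of tending to
   infinity to vanish.  Two walks with the same increments never move apart, hence
   from every starting point a bounded set is visited infinitely often.  The
   closed semigroup generated by the support is the whole line, and a conditional
   Borel-Cantelli argument carries the visits to every open set. *)

Set Implicit Arguments.
Unset Strict Implicit.
Unset Printing Implicit Defensive.

Local Open Scope classical_set_scope.
Local Open Scope ring_scope.

(** * The past of the increments *)

(** The obstacle is that [nu] may have infinite mass: theorems on finite invariant measures do not
    apply to it, and nothing may be subtracted. The substitute is the chain of positions just after
    a reflection. Iterating [nu (stay g) + rho g <= nu g] bounds the sum over [j] of
    [rho (stay^j g)] by [nu g]. For [g = jump f] the bound is [rho f] by definition, so the finite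
    [rho] is excessive for that chain. Take for [f] the probability of staying above [K] from time
    [k] on. By induction on [k], certain overshooting making the remainder [rho (stay^N 1)] small,
    its flux is at most the flux landing above [K], up to an arbitrarily small error and for every
    [k]. This bound tends to 0 as [K] grows, whereas a positive probability of escape, carried by
    the contraction to all starting points of a bounded set, would keep the flux above a positive
    constant. *)

Section filtration.
Local Open Scope ereal_scope.
Context d (T : measurableType d) (R : realType) (P : probability T R).
Implicit Types (B : nat -> {RV P >-> R}) (mu : probability R R).

(** Cylinders are closed under intersection, as the uniqueness of measures in [past_independent]
    requires. *)
Definition past_cylinders B (n : nat) : set (set T) :=
  [set E | exists2 A : nat -> set R, forall i, measurable (A i) &
    E = \bigcap_(i in `I_n) (B i @^-1` A i)].

(** The ascription replaces the sigma-algebra of [T] by the one generated by the first [n]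
    increments. *)
Definition adapted B n d' (S : measurableType d') (Z : T -> S) :=
  measurable_fun [set: g_sigma_algebraType (past_cylinders B n)]
    (Z : g_sigma_algebraType (past_cylinders B n) -> S).

Lemma past_cylinders_measurable B n : past_cylinders B n `<=` measurable.
Proof.
move=> _ [A mA ->]; apply: bigcap_measurableType => i _.
by rewrite -[X in measurable X]setTI; exact: (measurable_funPT (B i)).
Qed.

Lemma sub_past B n m : (n <= m)%N ->
  <<s past_cylinders B n>> `<=` <<s past_cylinders B m>>.
Proof.
move=> nm; apply: smallest_sub; first exact: smallest_sigma_algebra.
move=> _ [A mA ->]; apply: sub_sigma_algebra.
exists (fun i => if (i < n)%N then A i else setT) => [i|].
  by case: ifPn.
apply/seteqP; split=> w /= H i im.
  by case: ifPn => // /H.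
by move: (H i (leq_trans im nm)); rewrite im.
Qed.

Lemma past_measurable B n : <<s past_cylinders B n>> `<=` measurable.
Proof.
apply: smallest_sub; first exact: sigma_algebra_measurable.
exact: past_cylinders_measurable.
Qed.

Lemma adapted_measurable B n d' (S : measurableType d') (Z : T -> S) :
  adapted B n Z -> measurable_fun setT Z.
Proof.
move=> aZ _ A mA; apply: (@past_measurable B n); exact: aZ.
Qed.

Lemma adapted_le B n m d' (S : measurableType d') (Z : T -> S) : (n <= m)%N ->
  adapted B n Z -> adapted B m Z.
Proof. by move=> nm aZ _ A mA; apply: (sub_past nm); exact: aZ. Qed.

Lemma adapted_increment B i n : (i < n)%N -> adapted B n (B i).
Proof.
move=> ilt _ A mA; apply: sub_sigma_algebra.
exists (fun j => if j == i then A else setT) => [j|]; first by case: ifPn.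
apply/seteqP; split=> w /=.
  by move=> [_ Aw] j _; case: ifPn => // /eqP ->.
by move=> /(_ i ilt); rewrite eqxx.
Qed.

(** As functions of [E], both sides are finite measures. They agree on cylinders by independence,
    hence on the generated sigma-algebra. *)
Lemma past_independent B mu n (E : set T) (A : set R) : iid_with_law B mu ->
  <<s past_cylinders B n>> E -> measurable A ->
  P (E `&` B n @^-1` A) = P E * mu A.
Proof.
move=> [indB lawB] pE mA.
have mBA : measurable (B n @^-1` A).
  by rewrite -[X in measurable X]setTI; exact: (measurable_funPT (B n)).
have [r muAr] : exists r : {nonneg R}, mu A = r%:num%:E.
  have := fin_num_measure mu A mA; rewrite fin_numE => _.
  have h : (0 <= fine (mu A))%R by exact: fine_ge0.
  by exists (NngNum h); rewrite /= fineK// fin_num_measure.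
pose m1 := mrestr P mBA; pose m2 := mscale r P.
suff : m1 E = m2 E by rewrite /m1 /m2 /mrestr /mscale /= muleC muAr.
apply: (g_sigma_algebra_measure_unique (past_cylinders B n)
  (@past_cylinders_measurable B n) (fun=> setT)) => //.
- move=> _; exists (fun=> setT) => //.
  by apply/seteqP; split.
- by apply/seteqP; split => // w _; exists 0%N.
- move=> _ _ [A1 mA1 ->] [A2 mA2 ->].
  exists (fun i => A1 i `&` A2 i) => [i|]; first exact: measurableI.
  by rewrite -bigcapI.
- move=> _ [C mC ->].
  pose C' i := if i == n then A else C i.
  have mC' i : measurable (C' i) by rewrite /C'; case: ifPn.
  have mem m i : (i \in [fset x | x in iota 0 m]%fset) = (i < m)%N.
    by rewrite !inE/= mem_iota/= add0n.
  have toset m : [set` [fset x | x in iota 0 m]%fset] = `I_m.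
    by apply/seteqP; split=> i /=; rewrite mem.
  have := indB [fset x | x in iota 0 n.+1]%fset C' mC'.
  have := indB [fset x | x in iota 0 n]%fset C mC.
  rewrite !toset => HC; rewrite [X in _ -> X](_ : _ =
    (P (\bigcap_(i in `I_n) (B i @^-1` C i) `&` B n @^-1` A) =
     r%:num%:E * P (\bigcap_(i in `I_n) (B i @^-1` C i))))// HC; rewrite (_ : \bigcap_(i in `I_n.+1) _ =
    \bigcap_(i in `I_n) (B i @^-1` C i) `&` B n @^-1` A); last first.
    apply/seteqP; split=> w /=.
      move=> H; split=> [i /= im|].
        by have := H i (ltnW im); rewrite /C' (ltn_eqF im).
      by have := H n (ltnSn n); rewrite /C' eqxx.
    move=> [H Aw] i; rewrite /= ltnS leq_eqVlt /C' => /predU1P[->|im].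
      by rewrite eqxx.
    by rewrite (ltn_eqF im); exact: H.
  move=> ->.
  rewrite (_ : [fset x | x in iota 0 n.+1]%fset = (n |` [fset x | x in iota 0 n])%fset); last first.
    by apply/fsetP => i; rewrite mem in_fset1U mem ltnS leq_eqVlt.
  rewrite big_fsetU1/= ?mem ?ltnn//.
  congr (_ * _).
    by rewrite /C' eqxx -muAr -(lawB n).
  apply: eq_big_seq => i; rewrite mem => im.
  by rewrite /C' (ltn_eqF im).
- move=> k; apply: (@le_lt_trans _ _ 1); last exact: ltry.
  by apply: probability_le1; exact: measurableI.
Qed.

(** The Markov property in integrated form, which takes the place of conditional expectations
    throughout: the joint law of [Z] and [B n] is a product, by [past_independent] on rectangles,
    and Tonelli applies. *)
Lemma adapted_increment_integral B mu n d' (S : measurableType d') (Z : T -> S)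
    (f : S * R -> \bar R) : iid_with_law B mu ->
  adapted B n Z -> measurable_fun setT f -> (forall p, 0 <= f p) ->
  \int[P]_w f (Z w, B n w) = \int[P]_w \int[mu]_b f (Z w, b).
Proof.
move=> iid aZ mf f0.
have mZ := adapted_measurable aZ.
pose Z' : {mfun T >-> S} := HB.pack Z (isMeasurableFun.Build _ _ _ _ _ mZ).
have mp : measurable_fun setT (fun w => (Z w, B n w)).
  exact: measurable_fun_pair.
pose p : {mfun T >-> (S * R)%type} :=
  HB.pack (fun w => (Z w, B n w)) (isMeasurableFun.Build _ _ _ _ _ mp).
transitivity (\int[distribution P p]_y f y).
  by rewrite ge0_integral_distribution.
transitivity (\int[distribution P Z' \x mu]_y f y).
  apply: eq_measure_integral => A mA _; apply/esym.
  apply: product_measure_unique => // A1 A2 mA1 mA2.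
  rewrite /distribution /pushforward/= -(past_independent (n := n) iid _ mA2)//.
  by rewrite -[X in <<s _ >> X]setTI; exact: aZ.
rewrite fubini_tonelli1// ge0_integral_distribution//.
  exact: measurable_fun_fubini_tonelli_F.
by move=> y; apply: integral_ge0.
Qed.

End filtration.

(** * One-step operators *)

Section operators.
Local Open Scope ereal_scope.
Context (R : realType) (mu : probability R R).
Implicit Types (f g : R -> \bar R).

Definition nonneg_measurable d (T : measurableType d) (f : T -> \bar R) :=
  measurable_fun setT f /\ forall t, 0 <= f t.

(** Functions are defined on all of R but stand for functions on [[0, oo[]. The two truncations
    split [reflect_op] according to whether the step crosses 0; [on_neg] evaluates at the reflected
    point. *)
Definition on_nonneg g (y : R) : \bar R := if (0 <= y)%R then g y else 0.
Definition on_neg g (y : R) : \bar R := if (y < 0)%R then g (- y)%R else 0.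

Definition increment_op f x := \int[mu]_b f (x - b)%R.
Definition reflect_op g := increment_op (fun z => g `|z|%R).
Definition stay_op g := increment_op (on_nonneg g).
Definition jump_op g := increment_op (on_neg g).

Lemma nonneg_measurable_cst d (T : measurableType d) (c : \bar R) : 0 <= c ->
  nonneg_measurable (cst c : T -> \bar R).
Proof. by move=> c0; split => // x; exact: measurable_cst. Qed.

Lemma nonneg_measurable_comp d (T : measurableType d) d' (T' : measurableType d')
    (f : T -> \bar R) (h : T' -> T) :
  nonneg_measurable f -> measurable_fun setT h -> nonneg_measurable (f \o h).
Proof.
by move=> [mf f0] mh; split => [|x]; [exact: measurableT_comp|exact: f0].
Qed.

Lemma nonneg_measurable_if d (T : measurableType d) (c : T -> bool)
    (f g : T -> \bar R) : measurable_fun setT c ->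
  nonneg_measurable f -> nonneg_measurable g ->
  nonneg_measurable (fun x => if c x then f x else g x).
Proof.
move=> mc [mf f0] [mg g0]; split; first exact: measurable_fun_ifT.
by move=> x; case: ifP.
Qed.

Lemma nonneg_measurableD d (T : measurableType d) (f g : T -> \bar R) :
  nonneg_measurable f -> nonneg_measurable g -> nonneg_measurable (f \+ g).
Proof.
move=> [mf f0] [mg g0]; split; first exact: emeasurable_funD.
by move=> x; rewrite adde_ge0.
Qed.

Lemma nonneg_measurableM d (T : measurableType d) (f g : T -> \bar R) :
  nonneg_measurable f -> nonneg_measurable g -> nonneg_measurable (f \* g).
Proof.
move=> [mf f0] [mg g0]; split; first exact: emeasurable_funM.
by move=> x; rewrite mule_ge0.
Qed.

Lemma nonneg_measurable_on_nonneg g :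
  nonneg_measurable g -> nonneg_measurable (on_nonneg g).
Proof.
move=> ng; apply: nonneg_measurable_if => //.
exact: measurable_fun_ler.
Qed.

Lemma nonneg_measurable_on_neg g :
  nonneg_measurable g -> nonneg_measurable (on_neg g).
Proof.
move=> ng; apply: nonneg_measurable_if.
- exact: measurable_fun_ltr.
- exact: (nonneg_measurable_comp ng).
- exact: nonneg_measurable_cst.
Qed.

Lemma nonneg_measurable_norm g :
  nonneg_measurable g -> nonneg_measurable (fun z : R => g `|z|%R).
Proof.
by move=> ng; apply: (nonneg_measurable_comp ng); exact: normr_measurable.
Qed.

Lemma nonneg_measurable_sub f :
  nonneg_measurable f ->
  nonneg_measurable (fun p : R * R => f (p.1 - p.2)%R).
Proof.
by move=> nf; apply: (nonneg_measurable_comp nf); exact: measurable_funB.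
Qed.

Lemma nonneg_measurable_increment_op f :
  nonneg_measurable f -> nonneg_measurable (increment_op f).
Proof.
move=> nf; split.
  apply: (measurable_fun_fubini_tonelli_F (fun p : R * R => f (p.1 - p.2)%R)).
    by case: (nonneg_measurable_sub nf).
  by case: (nonneg_measurable_sub nf).
by move=> x; apply: integral_ge0 => b _; case: nf.
Qed.

Lemma nonneg_measurable_section f x :
  nonneg_measurable f -> nonneg_measurable (fun b : R => f (x - b)%R).
Proof.
by move=> nf; apply: (nonneg_measurable_comp nf); exact: measurable_funB.
Qed.

Lemma increment_opD f g x : nonneg_measurable f -> nonneg_measurable g ->
  increment_op (f \+ g) x = increment_op f x + increment_op g x.
Proof.
move=> /(nonneg_measurable_section x)[mf f0].
move=> /(nonneg_measurable_section x)[mg g0].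
by rewrite /increment_op ge0_integralD.
Qed.

Lemma le_increment_op f g x : nonneg_measurable f -> nonneg_measurable g ->
  (forall z, f z <= g z) -> increment_op f x <= increment_op g x.
Proof.
move=> /(nonneg_measurable_section x)[mf f0].
move=> /(nonneg_measurable_section x)[mg g0] fg.
by apply: ge0_le_integral.
Qed.

Lemma increment_opZ (c : \bar R) f x : 0 <= c -> nonneg_measurable f ->
  increment_op (fun z => c * f z) x = c * increment_op f x.
Proof.
move=> c0 /(nonneg_measurable_section x)[mf f0].
by rewrite /increment_op ge0_integralZl.
Qed.

Lemma reflect_opE g x : nonneg_measurable g ->
  reflect_op g x = stay_op g x + jump_op g x.
Proof.
move=> ng; rewrite /reflect_op -increment_opD; last 2 first.
- exact: nonneg_measurable_on_nonneg.
- exact: nonneg_measurable_on_neg.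
congr (increment_op _ x); apply/funext => z; rewrite /on_nonneg /on_neg/=.
by have [z0|z0] := leP 0%R z; rewrite ?adde0 ?add0e ?(ger0_norm z0) ?(ltr0_norm z0).
Qed.

Lemma nonneg_measurable_reflect_op g :
  nonneg_measurable g -> nonneg_measurable (reflect_op g).
Proof.
by move=> ng; apply: nonneg_measurable_increment_op; exact: nonneg_measurable_norm.
Qed.

Lemma nonneg_measurable_stay_op g :
  nonneg_measurable g -> nonneg_measurable (stay_op g).
Proof.
move=> ng; apply: nonneg_measurable_increment_op.
exact: nonneg_measurable_on_nonneg.
Qed.

Lemma nonneg_measurable_jump_op g :
  nonneg_measurable g -> nonneg_measurable (jump_op g).
Proof.
move=> ng; apply: nonneg_measurable_increment_op.
exact: nonneg_measurable_on_neg.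
Qed.

Lemma nonneg_measurable_iter n (op : (R -> \bar R) -> R -> \bar R) g :
  (forall h, nonneg_measurable h -> nonneg_measurable (op h)) ->
  nonneg_measurable g -> nonneg_measurable (iter n op g).
Proof. by move=> opP ng; elim: n => //= n IH; exact: opP. Qed.

Lemma le_stay_op f g x : nonneg_measurable f -> nonneg_measurable g ->
  (forall z, (0 <= z)%R -> f z <= g z) -> stay_op f x <= stay_op g x.
Proof.
move=> nf ng fg; apply: le_increment_op.
- exact: nonneg_measurable_on_nonneg.
- exact: nonneg_measurable_on_nonneg.
- by move=> z; rewrite /on_nonneg; case: ifP => // /fg.
Qed.

Lemma le_jump_op f g x : nonneg_measurable f -> nonneg_measurable g ->
  (forall z, (0 <= z)%R -> f z <= g z) -> jump_op f x <= jump_op g x.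
Proof.
move=> nf ng fg; apply: le_increment_op.
- exact: nonneg_measurable_on_neg.
- exact: nonneg_measurable_on_neg.
- by move=> z; rewrite /on_neg; case: ifP => // z0; apply: fg; rewrite oppr_ge0 ltW.
Qed.

Lemma le_reflect_op f g x : nonneg_measurable f -> nonneg_measurable g ->
  (forall z, (0 <= z)%R -> f z <= g z) -> reflect_op f x <= reflect_op g x.
Proof.
move=> nf ng fg; apply: le_increment_op.
- exact: nonneg_measurable_norm.
- exact: nonneg_measurable_norm.
- by move=> z; exact: fg.
Qed.

Lemma stay_opD f g x : nonneg_measurable f -> nonneg_measurable g ->
  stay_op (f \+ g) x = stay_op f x + stay_op g x.
Proof.
move=> nf ng; rewrite /stay_op -increment_opD; last 2 first.
- exact: nonneg_measurable_on_nonneg.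
- exact: nonneg_measurable_on_nonneg.
congr (increment_op _ x); apply/funext => z; rewrite /on_nonneg/=.
by case: ifP => //; rewrite adde0.
Qed.

Lemma stay_op1_le1 x : stay_op (cst 1) x <= 1.
Proof.
apply: (@le_trans _ _ (increment_op (cst 1) x)); last first.
  by rewrite /increment_op integral_cst// mul1e probability_le1.
apply: le_increment_op => //.
- by apply/nonneg_measurable_on_nonneg/nonneg_measurable_cst; rewrite lee01.
- by move=> z; rewrite /on_nonneg; case: ifP => // _; rewrite lee01.
Qed.

End operators.

(** The walk is frozen at its first negative value, so [0 <= Y n] alone expresses survival up to
    time [n]. *)
Fixpoint killed_walk {T : Type} {R : realType} (B : nat -> T -> R) (x : R)
    (n : nat) (w : T) : R :=
  if n is m.+1 then
    let y := killed_walk B x m w in if 0 <= y then y - B m w else y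
  else x.

(** * The iterated operators as expectations over the two walks *)

Section walks.
Local Open Scope ereal_scope.
Context d (T : measurableType d) (R : realType) (P : probability T R).
Context (B : nat -> {RV P >-> R}) (mu : probability R R).
Hypothesis iid : iid_with_law B mu.
Local Notation X := (reflected_walk (fun n w => B n w)).
Local Notation Y := (killed_walk (fun n w => B n w)).

Lemma adapted_reflected_walk x n : adapted B n (X x n).
Proof.
elim: n => [|n IH]; first exact: measurable_cst.
apply: measurableT_comp; first exact: normr_measurable.
apply: measurable_funB; first exact: (adapted_le (leqnSn n)).
exact: adapted_increment.
Qed.

Lemma adapted_killed_walk x n : adapted B n (Y x n).
Proof.
elim: n => [|n IH]; first exact: measurable_cst.
have {}IH := adapted_le (leqnSn n) IH.
apply: measurable_fun_ifT => //.
  by apply: measurable_fun_ler => //; exact: measurable_cst.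
by apply: measurable_funB => //; exact: adapted_increment.
Qed.

Lemma expectation_reflected_walk x n (h : R -> \bar R) : nonneg_measurable h ->
  \int[P]_w h (X x n w) = iter n (reflect_op mu) h x.
Proof.
elim: n h => [|n IH] h nh /=.
  by rewrite integral_cst//= probability_setT mule1.
have nR := nonneg_measurable_reflect_op mu nh.
rewrite -iterS iterSr -IH// .
have [mF F0] := nonneg_measurable_sub (nonneg_measurable_norm nh).
by rewrite (adapted_increment_integral iid (@adapted_reflected_walk x n) mF F0).
Qed.

Lemma expectation_killed_walk x n (h : R -> \bar R) : nonneg_measurable h ->
  (0 <= x)%R ->
  \int[P]_w on_nonneg h (Y x n w) = iter n (stay_op mu) h x.
Proof.
move=> nh x0; elim: n h nh => [|n IH] h nh /=.
  by rewrite integral_cst//= probability_setT mule1 /on_nonneg x0.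
rewrite -iterS iterSr -IH//; last exact: nonneg_measurable_stay_op.
have [mF F0] : nonneg_measurable (fun p : R * R =>
    if (0 <= p.1)%R then on_nonneg h (p.1 - p.2)%R else 0).
  apply: nonneg_measurable_if; first exact: measurable_fun_ler.
    exact: nonneg_measurable_sub (nonneg_measurable_on_nonneg nh).
  exact: nonneg_measurable_cst.
transitivity (\int[P]_w \int[mu]_b
    if (0 <= Y x n w)%R then on_nonneg h (Y x n w - b)%R else 0).
  rewrite -(adapted_increment_integral iid (@adapted_killed_walk x n) mF F0)/=.
  apply: eq_integral => w _; case: ifPn => // /negbTE Yn.
  by rewrite /on_nonneg Yn.
apply: eq_integral => w _; rewrite [RHS]/on_nonneg.
by case: ifPn => // Yn; rewrite integral0.
Qed.

Lemma probability_stay_above x k n (K : R) (h : R -> \bar R) :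
  nonneg_measurable h ->
  \int[P]_w (if \big[andb/true]_(j < n) (K < X x (k + j) w)%R
                 then h (X x (k + n) w) else 0) =
  iter k (reflect_op mu)
    (iter n (fun g y => if (K < y)%R then reflect_op mu g y else 0) h) x.
Proof.
elim: n h => [|n IH] h nh.
  rewrite addn0 -expectation_reflected_walk//.
  by apply: eq_integral => w _; rewrite big_ord0.
rewrite iterSr -IH; last first.
  apply: nonneg_measurable_if; first exact: measurable_fun_ltr.
    exact: nonneg_measurable_reflect_op.
  exact: nonneg_measurable_cst.
(* This condition depends on the whole past, not on the current position, so it is carried along as
   a boolean coordinate of the adapted state. *)
pose alive m w := \big[andb/true]_(j < m) (K < X x (k + j) w)%R.
have ma m : adapted B (k + m) (alive m).
  elim: m => [|m IHm].
    rewrite (_ : alive 0%N = cst true); first exact: measurable_cst.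
    by apply/funext => w; rewrite /alive big_ord0.
  rewrite (_ : alive m.+1 = fun w => alive m w && (K < X x (k + m) w)%R); last first.
    by apply/funext => w; rewrite /alive big_ord_recr.
  rewrite addnS; apply: (adapted_le (leqnSn _)); apply: measurable_and => //.
  by apply: measurable_fun_ltr => //; exact: adapted_reflected_walk.
pose F (p : (bool * R) * R) : \bar R :=
  if p.1.1 && (K < p.1.2)%R then h `|p.1.2 - p.2|%R else 0.
have [mF F0] : nonneg_measurable F.
  apply: nonneg_measurable_if.
  - apply: measurable_and.
      exact: (measurableT_comp measurable_fst measurable_fst).
    apply: measurable_fun_ltr => //.
    exact: (measurableT_comp measurable_snd measurable_fst).
  - apply: (nonneg_measurable_comp nh).
    apply: measurableT_comp; first exact: normr_measurable.
    apply: measurable_funB => //.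
    exact: (measurableT_comp measurable_snd measurable_fst).
  - exact: nonneg_measurable_cst.
have aZ : adapted B (k + n) (fun w => (alive n w, X x (k + n) w)).
  by apply: measurable_fun_pair; [exact: ma|exact: adapted_reflected_walk].
transitivity (\int[P]_w F ((alive n w, X x (k + n) w), B (k + n)%N w)).
  by apply: eq_integral => w _; rewrite big_ord_recr addnS.
rewrite (adapted_increment_integral iid aZ mF F0).
apply: eq_integral => w _; rewrite /F/= -/(alive n w).
by case: (alive n w); case: (_ < _)%R => //=; rewrite integral0.
Qed.

End walks.

(** * The overshoot measure is excessive for reflection *)

Section lebesgue.
Local Open Scope ereal_scope.
Context (R : realType).
Local Notation leb := (@lebesgue_measure R).
Implicit Types (f g : R -> \bar R).

Lemma integral_lebesgue_shift f (a : R) : nonneg_measurable f ->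
  \int[leb]_x f (x + a)%R = \int[leb]_x f x.
Proof.
move=> [mf f0].
have mphi : measurable_fun setT
    ((fun x : R => x + a)%R : measurableTypeR R -> measurableTypeR R).
  exact: (@measurable_funD _ R R).
pose phi : {mfun measurableTypeR R >-> measurableTypeR R} :=
  HB.pack (fun x : R => x + a)%R (isMeasurableFun.Build _ _ _ _ _ mphi).
transitivity (\int[pushforward leb phi]_x f x).
  by rewrite ge0_integral_pushforward.
apply: (eq_measure_integral leb) => A mA _; apply/esym.
apply: lebesgue_measure_unique => // _ [[b c] _ <-]/=.
rewrite /pushforward (_ : _ @^-1` _ = `](b - a)%R, (c - a)%R]%classic).
  rewrite !lebesgue_measure_itv/= !lte_fin ltrD2r; case: ifP => // _.
  by rewrite !EFinN -!EFinD; congr (_ %:E); ring.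
by apply/seteqP; split=> x /=; rewrite !in_itv/= ltrBlDr lerBrDr.
Qed.

Lemma integral_lebesgue_opp f : nonneg_measurable f ->
  \int[leb]_x f (- x)%R = \int[leb]_x f x.
Proof.
move=> [mf f0].
have mphi : measurable_fun setT
    ((fun x : R => - x)%R : measurableTypeR R -> measurableTypeR R).
  exact: (@oppr_measurable R).
pose phi : {mfun measurableTypeR R >-> measurableTypeR R} :=
  HB.pack (fun x : R => - x)%R (isMeasurableFun.Build _ _ _ _ _ mphi).
transitivity (\int[pushforward leb phi]_x f x).
  by rewrite ge0_integral_pushforward.
apply: (eq_measure_integral leb) => A mA _; apply/esym.
apply: lebesgue_measure_unique => // _ [[b c] _ <-]/=.
rewrite /pushforward (_ : _ @^-1` _ = `[(- c)%R, (- b)%R[%classic).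
  rewrite !lebesgue_measure_itv/= !lte_fin ltrN2; case: ifP => // _.
  by rewrite !EFinN -!EFinD; congr (_ %:E); ring.
by apply/seteqP; split=> x /=; rewrite !in_itv/= => /andP[H1 H2]; apply/andP; split; lra.
Qed.

Lemma integral_lebesgue_reverse f (a : R) : nonneg_measurable f ->
  \int[leb]_x f (a - x)%R = \int[leb]_x f x.
Proof.
move=> nf; rewrite -[RHS]integral_lebesgue_opp//.
have nfN : nonneg_measurable (fun x : R => f (- x)%R).
  exact: (nonneg_measurable_comp nf).
rewrite -[RHS](integral_lebesgue_shift (- a)%R nfN).
by apply: eq_integral => x _; rewrite opprD opprK addrC.
Qed.

Lemma integral_half_line (f : R -> \bar R) : nonneg_measurable f ->
  \int[leb]_x (if (0 <= x)%R then f x else 0) =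
  \int[leb]_x (if (0 < x)%R then f x else 0).
Proof.
move=> [mf f0].
transitivity (\int[leb]_(x in `[0%R, +oo[) f x).
  rewrite [RHS]integral_mkcond; apply: eq_integral => x _.
  by rewrite /patch mem_setE in_itv/= andbT.
rewrite -integral_itv_obnd_cbnd; last exact: measurable_funTS.
rewrite integral_mkcond; apply: eq_integral => x _.
by rewrite /patch mem_setE in_itv/= andbT.
Qed.

Section overshoot_invariance.
Variable eta : {finite_measure set R -> \bar R}.
Hypothesis eta_le1 : eta setT <= 1.
Local Notation tail x := (eta `]x, +oo[%classic).

Lemma tailE x : tail x = \int[eta]_h (if (x < h)%R then 1 else 0).
Proof.
rewrite -[LHS]mul1e -integral_cst// integral_mkcond; apply: eq_integral => h _.
by rewrite /patch mem_setE in_itv/= andbT.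
Qed.

Let nonneg1 d (S : measurableType d) : nonneg_measurable (cst 1 : S -> \bar R).
Proof. by apply: nonneg_measurable_cst; rewrite lee01. Qed.

Lemma nonneg_measurable_tail : nonneg_measurable (fun x : R => tail x).
Proof.
rewrite (_ : (fun _ => _) = fun x => \int[eta]_h (if (x < h)%R then 1 else 0)); last first.
  by apply/funext => x; exact: tailE.
have nF : nonneg_measurable (fun p : R * R => if (p.1 < p.2)%R then 1 else 0 : \bar R).
  by apply: nonneg_measurable_if; [exact: measurable_fun_ltr|exact: nonneg1|exact: nonneg_measurable_cst].
split; first by apply: (measurable_fun_fubini_tonelli_F (fun p : R * R => if (p.1 < p.2)%R then 1 else 0 : \bar R)); case: nF.
by move=> x; apply: integral_ge0 => h _; case: ifP.
Qed.

(** Both terms are double integrals over [eta]. Once the variables of the second are exchanged, they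
    live on [k > h - z] and on [0 < k < h - z], both with [h > z]. These sets being disjoint, the
    integral in [k] is at most [eta setT <= 1], and the mass of [h > z] remains. *)
Lemma overshoot_kernel_le z : (0 <= z)%R ->
  \int[eta]_h (if (0 < h)%R then (if (z < h)%R then tail (h - z)%R else 0) + tail (z + h)%R else 0)
  <= tail z.
Proof.
move=> z0.
pose A (p : R * R) : \bar R := if [&& (0 < p.1)%R, (z < p.1)%R & (p.1 - z < p.2)%R] then 1 else 0.
pose C (p : R * R) : \bar R := if (0 < p.1)%R && (z + p.1 < p.2)%R then 1 else 0.
have nA : nonneg_measurable A.
  apply: nonneg_measurable_if; [|exact: nonneg1|exact: nonneg_measurable_cst].
  apply: measurable_and; first exact: measurable_fun_ltr.
  apply: measurable_and; first exact: measurable_fun_ltr.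
  by apply: measurable_fun_ltr => //; exact: measurable_funB.
have nC : nonneg_measurable C.
  apply: nonneg_measurable_if; [|exact: nonneg1|exact: nonneg_measurable_cst].
  apply: measurable_and; first exact: measurable_fun_ltr.
  by apply: measurable_fun_ltr => //; exact: measurable_funD.
have [mA A0] := nA; have [mC C0] := nC.
have nA1 h : nonneg_measurable (fun k => A (h, k)) by apply: (nonneg_measurable_comp nA).
have nC1 h : nonneg_measurable (fun k => C (h, k)) by apply: (nonneg_measurable_comp nC).
have nC2 h : nonneg_measurable (fun k => C (k, h)) by apply: (nonneg_measurable_comp nC).
have mIA : measurable_fun setT (fun h => \int[eta]_k A (h, k)).
  exact: (measurable_fun_fubini_tonelli_F A).
have mIC : measurable_fun setT (fun h => \int[eta]_k C (h, k)).
  exact: (measurable_fun_fubini_tonelli_F C).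
have mIC2 : measurable_fun setT (fun h => \int[eta]_k C (k, h)).
  exact: (measurable_fun_fubini_tonelli_G C).
rewrite (eq_integral (fun h => \int[eta]_k A (h, k) + \int[eta]_k C (h, k))); last first.
  move=> h _; rewrite /A /C/=; case: ifPn => h0 /=; last by rewrite integral0 adde0.
  rewrite !tailE; congr (_ + _).
  by case: ifPn => zh //=; rewrite integral0.
rewrite ge0_integralD//; [|by move=> h _; exact: integral_ge0..].
rewrite [X in _ + X](fubini_tonelli C)//.
rewrite -ge0_integralD//; [|by move=> h _; exact: integral_ge0..].
rewrite tailE; apply: ge0_le_integral => //.
- by move=> h _; apply: adde_ge0; apply: integral_ge0 => k _; [exact: A0|exact: C0].
- exact: emeasurable_funD.
- by apply: measurable_fun_ifT => //; exact: measurable_fun_ltr.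
move=> h _; have [mA1 _] := nA1 h; have [mC2 _] := nC2 h.
rewrite -ge0_integralD//.
apply: (@le_trans _ _ (\int[eta]_k (if (z < h)%R then 1 else 0))); last first.
  rewrite integral_cst//; case: ifP => _; last by rewrite mul0e.
  by rewrite mul1e.
apply: ge0_le_integral => //.
- by move=> k _; apply: adde_ge0; [exact: A0|exact: C0].
- by apply: emeasurable_funD; [case: (nA1 h)|case: (nC2 h)].
move=> k _; rewrite /A /C/=.
have [zh|hz] := ltP z h; last first.
  rewrite andbF/= add0e; case: ifP => // /andP[k0 zk].
  by exfalso; lra.
case: ifPn => [/andP[_ hzk]|_]; last by rewrite add0e; case: ifP.
by rewrite ifF ?adde0//; apply/negP => /andP[k0 zk]; lra.
Qed.

Let fubini_leb (H : R * R -> \bar R) : nonneg_measurable H ->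
  \int[leb]_x \int[eta]_h H (x, h) = \int[eta]_h \int[leb]_x H (x, h).
Proof.
move=> [mH H0].
exact: (@fubini_tonelli _ _ (measurableTypeR R) R R leb eta H mH H0).
Qed.

Let measurable_leb (H : R * R -> \bar R) : nonneg_measurable H ->
  measurable_fun setT (fun h : R => \int[leb]_x H (x, h)).
Proof.
move=> [mH H0].
exact: (@measurable_fun_fubini_tonelli_G _ _ (measurableTypeR R) R R leb H mH H0).
Qed.

(** A point [z] is reached from [h - z], if [z < h], and from [z + h]. Both substitutions preserve
    Lebesgue measure, so the mass arriving at [z] is governed by the kernel of
    [overshoot_kernel_le]. *)
Lemma tail_reflection_excessive (g : R -> \bar R) : nonneg_measurable g ->
  \int[leb]_x (if (0 < x)%R then
    tail x * \int[eta]_h (if (0 < h)%R then g `|x - h|%R else 0) else 0) <=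
  \int[leb]_x (if (0 < x)%R then tail x * g x else 0).
Proof.
move=> ng.
have nt := nonneg_measurable_tail.
have [mg g0] := ng; have [mt t0] := nt.
pose F (p : R * R) : \bar R :=
  if (0 < p.1)%R && (0 < p.2)%R then tail p.1 * g `|p.1 - p.2|%R else 0.
pose G (p : R * R) : \bar R := if (0 <= p.1)%R && (0 < p.2)%R then g p.1 *
  ((if (p.1 < p.2)%R then tail (p.2 - p.1)%R else 0) + tail (p.1 + p.2)%R) else 0.
have nF : nonneg_measurable F.
  apply: nonneg_measurable_if.
  - by apply: measurable_and; exact: measurable_fun_ltr.
  - apply: nonneg_measurableM; first exact: (nonneg_measurable_comp nt).
    exact: nonneg_measurable_sub (nonneg_measurable_norm ng).
  - exact: nonneg_measurable_cst.
have nG : nonneg_measurable G.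
  apply: nonneg_measurable_if.
  - apply: measurable_and; last exact: measurable_fun_ltr.
    exact: measurable_fun_ler.
  - apply: nonneg_measurableM; first exact: (nonneg_measurable_comp ng).
    apply: nonneg_measurableD.
      apply: nonneg_measurable_if; first exact: measurable_fun_ltr.
        by apply: (nonneg_measurable_comp nt); exact: measurable_funB.
      exact: nonneg_measurable_cst.
    by apply: (nonneg_measurable_comp nt); exact: measurable_funD.
  - exact: nonneg_measurable_cst.
have [mF F0] := nF; have [mG G0] := nG.
have nF1 h : nonneg_measurable (fun x => F (x, h)) by apply: (nonneg_measurable_comp nF).
have nG1 h : nonneg_measurable (fun x => G (x, h)) by apply: (nonneg_measurable_comp nG).
apply: (@le_trans _ _ (\int[leb]_x \int[eta]_h F (x, h))).
  rewrite le_eqVlt; apply/orP; left; apply/eqP/eq_integral => x _.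
  rewrite /F/=; case: ifPn => x0 /=; last by rewrite integral0.
  have nx : nonneg_measurable (fun h : R => if (0 < h)%R then g `|x - h|%R else 0).
    apply: nonneg_measurable_if; first exact: measurable_fun_ltr.
      exact: nonneg_measurable_section (nonneg_measurable_norm ng).
    exact: nonneg_measurable_cst.
  rewrite -ge0_integralZl//; last 2 first.
  - by case: nx.
  - by case: nx.
  by apply: eq_integral => h _; case: ifP; rewrite ?mule0.
rewrite fubini_leb//.
apply: (@le_trans _ _ (\int[eta]_h \int[leb]_x G (x, h))).
  apply: ge0_le_integral => //.
  - by move=> h _; exact: integral_ge0.
  - exact: measurable_leb.
  - exact: measurable_leb.
  move=> h _.
  have [h0|h0] := ltP 0%R h; last first.
    rewrite (eq_integral (cst 0)) ?integral0 ?integral_ge0//.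
    by move=> x _; rewrite /F/= (ltNge 0%R h) h0 andbF.
  (* [F1] collects the starting points below [h], whose step is reflected, and [F2] those from [h]
     on. *)
  pose F1 (x : R) := if (0 < x)%R && (x < h)%R then tail x * g (h - x)%R else 0.
  pose F2 (x : R) := if (h <= x)%R then tail x * g (x - h)%R else 0.
  have nF1' : nonneg_measurable F1.
    apply: nonneg_measurable_if.
    - by apply: measurable_and; exact: measurable_fun_ltr.
    - apply: nonneg_measurableM => //.
      exact: nonneg_measurable_section.
    - exact: nonneg_measurable_cst.
  have nF2 : nonneg_measurable F2.
    apply: nonneg_measurable_if.
    - exact: measurable_fun_ler.
    - apply: nonneg_measurableM => //.
      by apply: (nonneg_measurable_comp ng); exact: measurable_funB.
    - exact: nonneg_measurable_cst.
  have nF1r : nonneg_measurable (fun x : R => F1 (h - x)%R) by exact: nonneg_measurable_section.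
  have nF2s : nonneg_measurable (fun x : R => F2 (x + h)%R).
    by apply: (nonneg_measurable_comp nF2); exact: measurable_funD.
  have -> : \int[leb]_x F (x, h) = \int[leb]_x (F1 x + F2 x).
    apply: eq_integral => x _; rewrite /F /F1 /F2/= h0 andbT.
    have [x0|x0] := ltP 0%R x; last by rewrite leNgt (le_lt_trans x0 h0) adde0.
    have [xh|hx] := ltP x h => /=.
      by rewrite adde0 distrC gtr0_norm ?subr_gt0.
    by rewrite add0e ger0_norm ?subr_ge0.
  have [mF1 F10] := nF1'; have [mF2 F20] := nF2.
  rewrite ge0_integralD//.
  rewrite -(integral_lebesgue_reverse h nF1') -(integral_lebesgue_shift h nF2).
  have [mF1r F1r0] := nF1r; have [mF2s F2s0] := nF2s.
  rewrite -ge0_integralD//.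
  apply: ge0_le_integral => //.
  - by move=> x _; apply: adde_ge0; [case: nF1r|case: nF2s].
  - by apply: emeasurable_funD; [case: nF1r|case: nF2s].
  - by case: (nG1 h).
  move=> z _; rewrite /F1 /F2 /G/= h0 andbT.
  rewrite subr_gt0 gtrBl lerDr opprB addrCA subrr addr0 addrK.
  have [z0|z0] := leP 0%R z; last by rewrite (ltNge 0%R z) (ltW z0) andbF adde0.
  rewrite ge0_muleDr//; last by case: ifP.
  apply: leeD; last by rewrite muleC.
  have [zh|hz] := ltP z h => /=; last by rewrite mule0.
  by rewrite muleC; case: ifP => // _; rewrite mule_ge0.
rewrite -fubini_leb//.
(* The landing point 0, reached from [x = h], has been included so far; it is Lebesgue-null. *)
apply: (@le_trans _ _ (\int[leb]_x (if (0 <= x)%R then tail x * g x else 0))); last first.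
  by rewrite integral_half_line//; exact: nonneg_measurableM.
apply: ge0_le_integral => //.
- by move=> x _; exact: integral_ge0.
- exact: (measurable_fun_fubini_tonelli_F G).
- by apply: measurable_fun_ifT; [exact: measurable_fun_ler|exact: emeasurable_funM|exact: measurable_cst].
move=> z _; rewrite /G/=; case: ifPn => z0 /=; last by rewrite integral0.
rewrite muleC; apply: (@le_trans _ _ (g z * \int[eta]_h (if (0 < h)%R then
    (if (z < h)%R then tail (h - z)%R else 0) + tail (z + h)%R else 0))).
  rewrite -ge0_integralZl//.
  - rewrite le_eqVlt; apply/orP; left; apply/eqP/eq_integral => h _.
    by case: ifP; rewrite ?mule0.
  - apply: measurable_fun_ifT; first exact: measurable_fun_ltr.
      apply: emeasurable_funD.
        apply: measurable_fun_ifT; first exact: measurable_fun_ltr.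
          by apply: (measurableT_comp mt); exact: measurable_funB.
        exact: measurable_cst.
      by apply: (measurableT_comp mt); exact: measurable_funD.
    exact: measurable_cst.
  - by move=> h _; case: ifP => // _; rewrite adde_ge0//; case: ifP.
by apply: lee_wpmul2l => //; exact: overshoot_kernel_le.
Qed.

End overshoot_invariance.

End lebesgue.

(** * Potential of the walk before its first overshoot *)

Section nonneg_series.
Local Open Scope ereal_scope.

Lemma nneseries_le (R : realType) (u : nat -> \bar R) (c : \bar R) :
  (forall n, 0 <= u n) -> (forall n, \sum_(k < n) u k <= c) ->
  \sum_(n <oo) u n <= c.
Proof.
move=> u0 uc; apply: lime_le; first exact: is_cvg_nneseries.
by apply: nearW => n; rewrite big_mkord.
Qed.

Lemma nneseries_recS (R : realType) (u : nat -> \bar R) :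
  (forall n, 0 <= u n) ->
  \sum_(n <oo) u n = u 0%N + \sum_(n <oo) u n.+1.
Proof.
move=> u0; rewrite nneseries_recl//; congr (_ + _).
rewrite -nneseries_addn//.
by apply: eq_eseriesr => n _; rewrite addn1.
Qed.

Lemma integral_mrestr d (T : measurableType d) (R : realType)
    (m : {measure set T -> \bar R}) (D : set T) (mD : measurable D)
    (f : T -> \bar R) : nonneg_measurable f ->
  \int[mrestr m mD]_x f x = \int[m]_(x in D) f x.
Proof.
move=> [mf f0].
have mDC : measurable (~` D) by exact: measurableC.
rewrite -(setUv D) ge0_integral_setU//; last 2 first.
- by rewrite setUv.
- exact/disj_setPCl.
rewrite [X in _ + X](_ : _ = 0) ?adde0.
  apply: (eq_measure_integral m) => A mA AD.
  by rewrite /= /mrestr setIidl.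
apply: null_set_integral => //.
- exact: measurable_funTS.
- by rewrite /= /mrestr setICl measure0.
Qed.

End nonneg_series.

(** * The Green functional and the law of the overshoot *)

Section green.
Local Open Scope ereal_scope.
Context d (T : measurableType d) (R : realType) (P : probability T R).
Context (B : nat -> {RV P >-> R}) (mu : probability R R).
Hypothesis iid : iid_with_law B mu.
Local Notation Y := (killed_walk (fun n w => B n w) 0%R).
Local Notation leb := (@lebesgue_measure R).
Implicit Types f g : R -> \bar R.
Local Notation stay_iter n g := (iter n (stay_op mu) g).

Definition green (g : R -> \bar R) := \sum_(n <oo) stay_iter n g 0%R.

Lemma nonneg_measurable_stay_iter n g : nonneg_measurable g ->
  nonneg_measurable (stay_iter n g).
Proof. exact/nonneg_measurable_iter/nonneg_measurable_stay_op. Qed.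

Lemma stay_iter_ge0 n g x : nonneg_measurable g -> 0 <= stay_iter n g x.
Proof. by move=> /(nonneg_measurable_stay_iter n)[]. Qed.

Lemma le_stay_iter n f g : nonneg_measurable f -> nonneg_measurable g ->
  (forall z, (0 <= z)%R -> f z <= g z) ->
  forall z, (0 <= z)%R -> stay_iter n f z <= stay_iter n g z.
Proof.
move=> nf ng fg; elim: n => //= n IH z z0.
by apply: le_stay_op => //; exact: nonneg_measurable_stay_iter.
Qed.

Lemma stay_iterD n f g x : nonneg_measurable f -> nonneg_measurable g ->
  stay_iter n (f \+ g) x = stay_iter n f x + stay_iter n g x.
Proof.
move=> nf ng; elim: n x => //= n IH x.
rewrite -stay_opD; [|exact: nonneg_measurable_stay_iter..].
by congr (stay_op mu _ _); apply/funext => y; rewrite IH.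
Qed.

Lemma green_ge0 g : nonneg_measurable g -> 0 <= green g.
Proof. by move=> ng; apply: nneseries_ge0 => n _ _; exact: stay_iter_ge0. Qed.

Lemma le_green f g : nonneg_measurable f -> nonneg_measurable g ->
  (forall z, (0 <= z)%R -> f z <= g z) -> green f <= green g.
Proof.
move=> nf ng fg; apply: lee_nneseries => [n _ _|n _]; first exact: stay_iter_ge0.
exact: le_stay_iter.
Qed.

Lemma greenD f g : nonneg_measurable f -> nonneg_measurable g ->
  green (f \+ g) = green f + green g.
Proof.
move=> nf ng; rewrite -nneseriesD; [|by move=> *; exact: stay_iter_ge0..].
by apply: eq_eseriesr => n _; rewrite stay_iterD.
Qed.

Lemma stay_iterZ n (c : R) g x : (0 <= c)%R -> nonneg_measurable g ->
  stay_iter n (fun y => c%:E * g y) x = c%:E * stay_iter n g x.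
Proof.
move=> c0 ng; elim: n x => //= n IH x.
rewrite /stay_op -increment_opZ//; last first.
  exact/nonneg_measurable_on_nonneg/nonneg_measurable_stay_iter.
congr (increment_op _ _ _); apply/funext => z; rewrite /on_nonneg.
by case: ifP => // _; rewrite ?IH ?mule0.
Qed.

Lemma greenZ (c : R) g : (0 <= c)%R -> nonneg_measurable g ->
  green (fun y => c%:E * g y) = c%:E * green g.
Proof.
move=> c0 ng; rewrite -nneseriesZl; last by move=> n _; exact: stay_iter_ge0.
by apply: eq_eseriesr => n _; rewrite stay_iterZ.
Qed.

Lemma green_rec g : nonneg_measurable g -> green g = g 0%R + green (stay_op mu g).
Proof.
move=> ng; rewrite /green nneseries_recS; last by move=> n; exact: stay_iter_ge0.
by congr (_ + _); apply: eq_eseriesr => n _; rewrite -iterSr.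
Qed.

Lemma green_expectation g : nonneg_measurable g ->
  green g = \sum_(n <oo) \int[P]_w on_nonneg g (Y n w).
Proof.
by move=> ng; apply: eq_eseriesr => n _; rewrite (expectation_killed_walk iid).
Qed.

Let measurable_Y n : measurable_fun setT (Y n).
Proof. exact: (adapted_measurable (@adapted_killed_walk _ _ _ _ B 0%R n)). Qed.

Let nonneg_measurable_walk d' (S : measurableType d') (H : S * R -> \bar R) n :
  nonneg_measurable H ->
  nonneg_measurable (fun p : S * T => on_nonneg (fun y => H (p.1, y)) (Y n p.2)).
Proof.
move=> nH; apply: nonneg_measurable_if.
- apply: measurable_fun_ler; first exact: measurable_cst.
  exact: measurableT_comp.
- apply: (nonneg_measurable_comp nH); apply: measurable_fun_pair => //.
  exact: measurableT_comp.
- exact: nonneg_measurable_cst.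
Qed.

(** Written as expectations over [T], the terms of the series are integrals of a jointly measurable
    function, so Tonelli gives measurability in the parameter. *)
Lemma nonneg_measurable_green d' (S : measurableType d') (H : S * R -> \bar R) :
  nonneg_measurable H -> nonneg_measurable (fun s => green (fun y => H (s, y))).
Proof.
move=> nH; split; last first.
  by move=> s; apply: green_ge0; apply: (nonneg_measurable_comp nH).
rewrite (_ : (fun _ => _) = fun s =>
    \sum_(n <oo) \int[P]_w on_nonneg (fun y => H (s, y)) (Y n w)); last first.
  apply/funext => s; rewrite green_expectation//.
  by apply: (nonneg_measurable_comp nH).
apply: ge0_emeasurable_sum => [n s _ _|n _].
  by apply: integral_ge0 => w _; rewrite /on_nonneg; case: ifP => // _; case: nH.
have [mW W0] := nonneg_measurable_walk n nH.
exact: (measurable_fun_fubini_tonelli_F _ mW W0).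
Qed.

Lemma green_integral d' (S : measurableType d') (m : {sigma_finite_measure set S -> \bar R})
    (H : S * R -> \bar R) : nonneg_measurable H ->
  green (fun y => \int[m]_s H (s, y)) = \int[m]_s green (fun y => H (s, y)).
Proof.
move=> nH; have [mH H0] := nH.
have nI : nonneg_measurable (fun y : R => \int[m]_s H (s, y)).
  split; first exact: measurable_fun_fubini_tonelli_G.
  by move=> y; exact: integral_ge0.
rewrite green_expectation//.
rewrite (eq_integral (fun s => \sum_(n <oo) \int[P]_w on_nonneg (fun y => H (s, y)) (Y n w))); last first.
  move=> s _; rewrite green_expectation//.
  by apply: (nonneg_measurable_comp nH).
have W0 n s w : 0 <= on_nonneg (fun y => H (s, y)) (Y n w).
  by rewrite /on_nonneg; case: ifP.
rewrite integral_nneseries//; last 2 first.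
- move=> n; have [mW _] := nonneg_measurable_walk n nH.
  exact: (measurable_fun_fubini_tonelli_F _ mW).
- by move=> n s _; exact: integral_ge0.
apply: eq_eseriesr => n _; have [mW _] := nonneg_measurable_walk n nH.
rewrite (fubini_tonelli (fun p : S * T => on_nonneg (fun y => H (p.1, y)) (Y n p.2)))//.
apply: eq_integral => w _; rewrite /on_nonneg.
by case: ifP => // _; rewrite integral0.
Qed.

(** From [stay 1 + jump 1 = 1]. Summed over [n], it says that the mass that has overshot and the
    mass still alive add up to 1. *)
Lemma stay_jump_telescope n x : stay_iter n (cst 1) x =
  stay_iter n.+1 (cst 1) x + stay_iter n (jump_op mu (cst 1)) x.
Proof.
have n1 : nonneg_measurable (cst 1 : R -> \bar R).
  by apply: nonneg_measurable_cst; rewrite lee01.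
rewrite iterSr -stay_iterD; last 2 first.
- exact: nonneg_measurable_stay_op.
- exact: nonneg_measurable_jump_op.
congr (iter n _ _ _); apply/funext => y /=; rewrite -reflect_opE//.
by rewrite /reflect_op /increment_op integral_cst//= mul1e probability_setT.
Qed.

(** [eta] is the sum over [n] of the law of [B n - Y n] on the event that the walk crosses 0 at step
    [n]. The telescoping identity bounds its mass by 1. *)
Lemma overshoot_measure : exists eta : {finite_measure set R -> \bar R},
  eta setT <= 1 /\ forall g, nonneg_measurable g ->
    \int[eta]_h (if (0 < h)%R then g h else 0) = green (jump_op mu g).
Proof.
have n1 : nonneg_measurable (cst 1 : R -> \bar R).
  by apply: nonneg_measurable_cst; rewrite lee01.
pose D n := [set w | ((0 <= Y n w) && (Y n w < B n w))%R].
have mD n : measurable (D n).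
  have mc : measurable_fun setT (fun w => (0 <= Y n w) && (Y n w < B n w))%R.
    by apply: measurable_and; [exact: measurable_fun_ler|exact: measurable_fun_ltr].
  by rewrite -[D n]setTI; exact: (mc measurableT [set true]).
have mphi n : measurable_fun setT (fun w => B n w - Y n w)%R.
  exact: measurable_funB.
pose m n : {measure set R -> \bar R} :=
  measure_function_pushforward__canonical__measure_function_Measure
    (mrestr P (mD n)) (mphi n).
have mE n g : nonneg_measurable g ->
    \int[m n]_h (if (0 < h)%R then g h else 0) = stay_iter n (jump_op mu g) 0%R.
  move=> ng; have nI : nonneg_measurable (fun h : R => if (0 < h)%R then g h else 0).
    by apply: nonneg_measurable_if => //; exact: measurable_fun_ltr.
  have [mI I0] := nI.
  rewrite ge0_integral_pushforward// integral_mrestr//; last first.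
    exact: (nonneg_measurable_comp nI).
  have nF : nonneg_measurable (fun p : R * R =>
      if (0 <= p.1)%R then on_neg g (p.1 - p.2)%R else 0).
    apply: nonneg_measurable_if; first exact: measurable_fun_ler.
      exact: nonneg_measurable_sub (nonneg_measurable_on_neg ng).
    exact: nonneg_measurable_cst.
  have [mF F0] := nF.
  rewrite -(expectation_killed_walk iid)//; last exact: nonneg_measurable_jump_op.
  transitivity (\int[P]_w \int[mu]_b
      if (0 <= Y n w)%R then on_neg g (Y n w - b)%R else 0).
    rewrite -(adapted_increment_integral iid (@adapted_killed_walk _ _ _ _ B 0%R n) mF F0).
    rewrite integral_mkcond; apply: eq_integral => w _.
    rewrite /patch /on_neg/= subr_gt0 subr_lt0 opprB.
    have -> : (w \in D n) = ((0 <= Y n w) && (Y n w < B n w))%R.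
      by apply/idP/idP => [/set_mem|/mem_set].
    by case: (0 <= _)%R => //=; case: ifP => // ->.
  apply: eq_integral => w _; rewrite [RHS]/on_nonneg.
  by case: ifP => // _; rewrite integral0.
have m0 n : m n `]-oo, 0%R]%classic = 0.
  rewrite /m /= /pushforward /mrestr/= (_ : _ `&` _ = set0) ?measure0//.
  apply/seteqP; split => w //=; rewrite in_itv/= => -[H /andP[_]].
  by rewrite -subr_gt0 ltNge H.
pose eta := mseries m 0.
have etaT : eta setT <= 1.
  rewrite /eta /mseries; apply: nneseries_le => // n.
  have -> : \sum_(k < n) m k setT = \sum_(k < n) stay_iter k (jump_op mu (cst 1)) 0%R.
    apply: eq_bigr => k _; rewrite -mE//.
    have mT : m k setT = m k (~` `]-oo, 0%R]%classic) + m k `]-oo, 0%R]%classic.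
      rewrite -(setvU `]-oo, 0%R]%classic) measureU//; first exact: measurableC.
      by rewrite setICl.
    rewrite mT m0 adde0 -[LHS]mul1e -integral_cst//; last exact: measurableC.
    rewrite integral_mkcond; apply: eq_integral => h _.
    by rewrite /patch setCitvl mem_setE in_itv/= andbT.
  suff : \sum_(k < n) stay_iter k (jump_op mu (cst 1)) 0%R + stay_iter n (cst 1) 0%R = 1.
    by move=> h; rewrite -[leRHS]h leeDl// stay_iter_ge0.
  elim: n => [|n IH]; first by rewrite big_ord0 add0e.
  by rewrite big_ord_recr/= -addeA [X in _ + X]addeC -stay_jump_telescope.
have fin_eta : fin_num_fun eta.
  move=> A mA; rewrite ge0_fin_numE// (@le_lt_trans _ _ (eta setT))//.
    by apply: le_measure => //; rewrite inE.
  by rewrite (le_lt_trans etaT)// ltry.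
pose eta' : {finite_measure set R -> \bar R} :=
  HB.pack eta (Measure_isFinite.Build _ _ _ eta fin_eta).
exists eta'; split => // g ng.
rewrite /eta' /eta /= ge0_integral_measure_series//.
- by apply: eq_eseriesr => n _; exact: mE.
- by move=> h _; case: ifP => // _; case: ng.
- apply: measurable_fun_ifT => //; first exact: measurable_fun_ltr.
  by case: ng.
Qed.

End green.

(** * An excessive measure for the reflected walk *)

Section excessive.
Local Open Scope ereal_scope.
Context d (T : measurableType d) (R : realType) (P : probability T R).
Context (B : nat -> {RV P >-> R}) (mu : probability R R).
Hypothesis iid : iid_with_law B mu.
Local Notation leb := (@lebesgue_measure R).
Variable eta : {finite_measure set R -> \bar R}.
Hypothesis eta_le1 : eta setT <= 1.
Hypothesis etaE : forall g : R -> \bar R, nonneg_measurable g ->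
  \int[eta]_h (if (0 < h)%R then g h else 0) = green mu (jump_op mu g).
Local Notation tail x := (eta `]x, +oo[%classic).
Local Notation stay := (stay_op mu).
Local Notation jump := (jump_op mu).
Implicit Types f g : R -> \bar R.

Definition nu g := \int[leb]_x
  (if (0 < x)%R then tail x * green mu (fun y => g (x + y)%R) else 0).

(* The part of the flow of [nu] that goes through a reflection. *)
Definition rho g := nu (jump g).

Let nonneg_shift g (x : R) : nonneg_measurable g ->
  nonneg_measurable (fun y : R => g (x + y)%R).
Proof. by move=> ng; apply: (nonneg_measurable_comp ng); exact: measurable_funD. Qed.

Let nonneg_green_shift g : nonneg_measurable g ->
  nonneg_measurable (fun x : R => green mu (fun y => g (x + y)%R)).
Proof.
move=> ng; apply: (nonneg_measurable_green iid (H := fun p : R * R => g (p.1 + p.2)%R)).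
by apply: (nonneg_measurable_comp ng); exact: measurable_funD.
Qed.

Let nonneg_half (f g : R -> \bar R) : nonneg_measurable f -> nonneg_measurable g ->
  nonneg_measurable (fun x : R => if (0 < x)%R then f x * g x else 0).
Proof.
move=> nf ng; apply: nonneg_measurable_if; first exact: measurable_fun_ltr.
  exact: nonneg_measurableM.
exact: nonneg_measurable_cst.
Qed.

Let nt : nonneg_measurable (fun x : R => tail x).
Proof. exact: nonneg_measurable_tail. Qed.

Let le_half (f g : R -> \bar R) : nonneg_measurable f -> nonneg_measurable g ->
  (forall x : R, (0 < x)%R -> f x <= g x) ->
  \int[leb]_x (if (0 < x)%R then tail x * f x else 0) <=
  \int[leb]_x (if (0 < x)%R then tail x * g x else 0).
Proof.
move=> nf ng fg; have [mF F0] := nonneg_half nt nf.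
have [mG G0] := nonneg_half nt ng.
apply: ge0_le_integral => // x _.
by case: ifPn => // x0; rewrite lee_wpmul2l// fg.
Qed.

Let eq_half (f g : R -> \bar R) : (forall x : R, (0 < x)%R -> f x = g x) ->
  \int[leb]_x (if (0 < x)%R then tail x * f x else 0) =
  \int[leb]_x (if (0 < x)%R then tail x * g x else 0).
Proof. by move=> fg; apply: eq_integral => x _; case: ifPn => // x0; rewrite fg. Qed.

Let halfD (f g : R -> \bar R) : nonneg_measurable f -> nonneg_measurable g ->
  \int[leb]_x (if (0 < x)%R then tail x * (f x + g x) else 0) =
  \int[leb]_x (if (0 < x)%R then tail x * f x else 0) +
  \int[leb]_x (if (0 < x)%R then tail x * g x else 0).
Proof.
move=> nf ng; have [mF F0] := nonneg_half nt nf.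
have [mG G0] := nonneg_half nt ng.
rewrite -ge0_integralD//; apply: eq_integral => x _.
case: ifPn => _; last by rewrite adde0.
by rewrite ge0_muleDr//; [case: nf|case: ng].
Qed.

Lemma nu_ge0 g : nonneg_measurable g -> 0 <= nu g.
Proof.
move=> ng; apply: integral_ge0 => x _; case: ifP => // _.
by rewrite mule_ge0//; case: (nonneg_green_shift ng).
Qed.

Lemma le_nu f g : nonneg_measurable f -> nonneg_measurable g ->
  (forall z, (0 <= z)%R -> f z <= g z) -> nu f <= nu g.
Proof.
move=> nf ng fg; apply: le_half => [||x x0]; [exact: nonneg_green_shift..|].
apply: le_green => [||y y0]; [exact: nonneg_shift..|].
by apply: fg; rewrite addr_ge0// ltW.
Qed.

Lemma nuD f g : nonneg_measurable f -> nonneg_measurable g ->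
  nu (f \+ g) = nu f + nu g.
Proof.
move=> nf ng; rewrite /nu -halfD; [|exact: nonneg_green_shift..].
by apply: eq_half => x _; rewrite -greenD//; exact: nonneg_shift.
Qed.

Lemma jump_opD f g : nonneg_measurable f -> nonneg_measurable g ->
  jump (f \+ g) = jump f \+ jump g.
Proof.
move=> nf ng; apply/funext => x; rewrite /jump_op /= -increment_opD; last 2 first.
- exact: nonneg_measurable_on_neg.
- exact: nonneg_measurable_on_neg.
congr (increment_op _ _ _); apply/funext => z; rewrite /on_neg/=.
by case: ifP => //; rewrite adde0.
Qed.

Lemma rho_ge0 g : nonneg_measurable g -> 0 <= rho g.
Proof. by move=> ng; apply: nu_ge0; exact: nonneg_measurable_jump_op. Qed.

Lemma le_rho f g : nonneg_measurable f -> nonneg_measurable g ->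
  (forall z, (0 <= z)%R -> f z <= g z) -> rho f <= rho g.
Proof.
move=> nf ng fg; apply: le_nu => [||z z0]; [exact: nonneg_measurable_jump_op..|].
exact: le_jump_op.
Qed.

Lemma rhoD f g : nonneg_measurable f -> nonneg_measurable g ->
  rho (f \+ g) = rho f + rho g.
Proof.
by move=> nf ng; rewrite /rho jump_opD// nuD//; exact: nonneg_measurable_jump_op.
Qed.

(** A step from [x + Y] crosses 0 exactly when [Y] itself overshoots by some [h > x]; the reflected
    position is then [h - x]. *)
Let green_shift_jump g (x : R) : (0 < x)%R -> nonneg_measurable g ->
  green mu (fun y => jump g (x + y)%R) = \int[eta]_h (if (x < h)%R then g (h - x)%R else 0).
Proof.
move=> x0 ng.
have nI : nonneg_measurable (fun h : R => if (x < h)%R then g (h - x)%R else 0).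
  apply: nonneg_measurable_if; first exact: measurable_fun_ltr.
    by apply: (nonneg_measurable_comp ng); exact: measurable_funB.
  exact: nonneg_measurable_cst.
transitivity (\int[eta]_h (if (0 < h)%R then (if (x < h)%R then g (h - x)%R else 0) else 0)); last first.
  apply: eq_integral => h _; case: ifPn => //; rewrite -leNgt => h0.
  by rewrite ltNge (le_trans h0 (ltW x0)).
rewrite etaE//; congr (green mu _); apply/funext => y.
apply: eq_integral => b _; rewrite /on_neg !opprB.
have -> : (b - (x + y) = b - y - x)%R by ring.
have [yb|by_] := ltP (y - b)%R 0%R.
  by have -> : (x + y - b < 0)%R = (x < b - y)%R by apply/idP/idP; lra.
by rewrite ifF//; apply/negP; lra.
Qed.

Lemma rhoE g : nonneg_measurable g ->
  rho g = \int[leb]_x (if (0 < x)%R then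
    tail x * \int[eta]_h (if (x < h)%R then g (h - x)%R else 0) else 0).
Proof. by move=> ng; apply: eq_half => x x0; exact: green_shift_jump. Qed.

(** Seen from [x], a step from [x + Y] either keeps [Y] alive or makes it overshoot by [h] and leads
    to [|x - h|]. The first possibility is the Green sum without its term at time 0, so it remains
    to compare [g |x - h|] with [g x], which is [tail_reflection_excessive]. *)
Lemma nu_excessive g : nonneg_measurable g -> nu (stay g) + rho g <= nu g.
Proof.
move=> ng.
have nstay : nonneg_measurable (fun x : R => green mu (stay (fun y => g (x + y)%R))).
  apply: (nonneg_measurable_green iid
    (H := fun p : R * R => stay (fun y => g (p.1 + y)%R) p.2)).
  pose H (q : (R * R) * R) := on_nonneg (fun y => g (q.1.1 + y)%R) (q.1.2 - q.2)%R.
  have mB : measurable_fun setT (fun q : (R * R) * R => q.1.2 - q.2)%R.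
    apply: measurable_funB => //.
    exact: (measurableT_comp measurable_snd measurable_fst).
  have [mH H0] : nonneg_measurable H.
    apply: nonneg_measurable_if; first exact: measurable_fun_ler.
      apply: (nonneg_measurable_comp ng); apply: measurable_funD => //.
      exact: (measurableT_comp measurable_fst measurable_fst).
    exact: nonneg_measurable_cst.
  split; first exact: (measurable_fun_fubini_tonelli_F H).
  by move=> p; apply: integral_ge0 => b _; exact: (H0 (p, b)).
have nrefl : nonneg_measurable (fun x : R => \int[eta]_h (if (0 < h)%R then g `|x - h|%R else 0)).
  pose H (p : R * R) := if (0 < p.2)%R then g `|p.1 - p.2|%R else 0.
  have [mH H0] : nonneg_measurable H.
    apply: nonneg_measurable_if; first exact: measurable_fun_ltr.
      exact: nonneg_measurable_sub (nonneg_measurable_norm ng).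
    exact: nonneg_measurable_cst.
  split; first exact: (measurable_fun_fubini_tonelli_F H).
  by move=> p; apply: integral_ge0 => b _; exact: (H0 (p, b)).
rewrite -nuD; last 2 first.
- exact: nonneg_measurable_stay_op.
- exact: nonneg_measurable_jump_op.
have -> : nu (stay g \+ jump g) =
    \int[leb]_x (if (0 < x)%R then tail x * (green mu (stay (fun y => g (x + y)%R)) +
      \int[eta]_h (if (0 < h)%R then g `|x - h|%R else 0)) else 0).
  apply: eq_half => x x0.
  have nx : nonneg_measurable (fun h : R => g `|x - h|%R).
    exact: nonneg_measurable_section (nonneg_measurable_norm ng).
  have ns := nonneg_shift x ng.
  rewrite etaE// -greenD; last 2 first.
  - exact: nonneg_measurable_stay_op.
  - exact: nonneg_measurable_jump_op.
  congr (green mu _); apply/funext => y /=; rewrite -reflect_opE//.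
  rewrite /reflect_op /stay_op /jump_op -increment_opD; last 2 first.
  - exact: nonneg_measurable_on_nonneg.
  - exact: nonneg_measurable_on_neg.
  apply: eq_integral => b _; rewrite /on_nonneg /on_neg/= opprB.
  have [yb|yb] := leP 0%R (y - b)%R.
    by rewrite adde0 ger0_norm -?addrA// addr_ge0// ltW.
  by rewrite add0e opprB addrA.
have -> : nu g = \int[leb]_x (if (0 < x)%R then
    tail x * (green mu (stay (fun y => g (x + y)%R)) + g x) else 0).
  apply: eq_half => x x0; rewrite green_rec; last exact: nonneg_shift.
  by rewrite addr0 addeC.
rewrite [leLHS]halfD// [leRHS]halfD//.
(* The common part stays on both sides, as it may be infinite. *)
by apply: leeD2l; exact: tail_reflection_excessive.
Qed.

Lemma nuZ (c : R) g : (0 <= c)%R -> nonneg_measurable g ->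
  nu (fun x => c%:E * g x) = c%:E * nu g.
Proof.
move=> c0 ng; have [mG G0] := nonneg_half nt (nonneg_green_shift ng).
transitivity (\int[leb]_x (c%:E * (if (0 < x)%R then
    tail x * green mu (fun y => g (x + y)%R) else 0))).
  apply: eq_integral => x _; case: ifPn => _; last by rewrite mule0.
  have -> : green mu (fun y => c%:E * g (x + y)%R) =
      c%:E * green mu (fun y => g (x + y)%R).
    by apply: (greenZ mu c0); exact: nonneg_shift.
  by rewrite muleCA.
by rewrite ge0_integralZl.
Qed.

Lemma rhoZ (c : R) g : (0 <= c)%R -> nonneg_measurable g ->
  rho (fun x => c%:E * g x) = c%:E * rho g.
Proof.
move=> c0 ng.
have <- := nuZ c0 (nonneg_measurable_jump_op mu ng).
congr (nu _); apply/funext => x.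
have <- := increment_opZ mu x (c := c%:E) c0 (nonneg_measurable_on_neg ng).
congr (increment_op _ _ _); apply/funext => z; rewrite /on_neg.
by case: ifP => //; rewrite mule0.
Qed.

(** The remainder [nu (stay^N g)] is carried on the left during the induction, since it could not be
    subtracted afterwards. *)
Lemma sum_rho_stay_iter N g : nonneg_measurable g ->
  \sum_(j < N) rho (iter j stay g) <= nu g.
Proof.
move=> ng; suff : \sum_(j < N) rho (iter j stay g) + nu (iter N stay g) <= nu g.
  apply: le_trans; rewrite leeDl// nu_ge0//.
  exact: nonneg_measurable_stay_iter.
elim: N => [|N IH]; first by rewrite big_ord0 add0e.
apply: le_trans IH; rewrite big_ord_recr/= -addeA leeD2l// addeC.
by apply: nu_excessive; exact: nonneg_measurable_stay_iter.
Qed.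

End excessive.

(** * Probabilities of staying high *)

Section escape.
Local Open Scope ereal_scope.
Context (R : realType) (mu : probability R R).
Local Notation stay := (stay_op mu).
Local Notation jump := (jump_op mu).
Local Notation reflect := (reflect_op mu).
Implicit Types f g : R -> \bar R.

Definition above_op (K : R) g (y : R) := if (K < y)%R then reflect g y else 0.

(* The probability that [K < X_j] for [k <= j < k + n], see
   [probability_stay_above]. *)
Definition escape K k n := iter k reflect (iter n (above_op K) (cst 1)).

Let nonneg1 : nonneg_measurable (cst 1 : R -> \bar R).
Proof. by apply: nonneg_measurable_cst; rewrite lee01. Qed.

Lemma nonneg_measurable_above_op K g : nonneg_measurable g ->
  nonneg_measurable (above_op K g).
Proof.
move=> ng; apply: nonneg_measurable_if; first exact: measurable_fun_ltr.
  exact: nonneg_measurable_reflect_op.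
exact: nonneg_measurable_cst.
Qed.

Let nonneg_above_iter K n : nonneg_measurable (iter n (above_op K) (cst 1)).
Proof. by apply: nonneg_measurable_iter => // *; exact: nonneg_measurable_above_op. Qed.

Lemma nonneg_measurable_escape K k n : nonneg_measurable (escape K k n).
Proof.
by apply: nonneg_measurable_iter => // *; exact: nonneg_measurable_reflect_op.
Qed.

Lemma le_reflect_iter k f g : nonneg_measurable f -> nonneg_measurable g ->
  (forall z, (0 <= z)%R -> f z <= g z) ->
  forall z, (0 <= z)%R -> iter k reflect f z <= iter k reflect g z.
Proof.
move=> nf ng fg; elim: k => //= k IH z z0; apply: le_reflect_op => //;
  by apply: nonneg_measurable_iter => // *; exact: nonneg_measurable_reflect_op.
Qed.

Lemma reflect_op_cst1 x : reflect (cst 1) x = 1.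
Proof. by rewrite /reflect_op /increment_op integral_cst//= mul1e probability_setT. Qed.

Lemma le_above_op K f g z : nonneg_measurable f -> nonneg_measurable g ->
  (forall z, (0 <= z)%R -> f z <= g z) -> above_op K f z <= above_op K g z.
Proof. by move=> nf ng fg; rewrite /above_op; case: ifP => // _; exact: le_reflect_op. Qed.

Let above_iter_decr K n z : (0 <= z)%R ->
  iter n.+1 (above_op K) (cst 1) z <= iter n (above_op K) (cst 1) z.
Proof.
elim: n z => [|n IH] z z0.
  by rewrite /= /above_op; case: ifP => _; rewrite ?reflect_op_cst1// lee01.
by rewrite !iterS; apply: le_above_op => //; exact: (nonneg_above_iter K n.+1).
Qed.

Lemma escape_nonincreasing K k n m z : (n <= m)%N -> (0 <= z)%R ->
  escape K k m z <= escape K k n z.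
Proof.
move=> /subnK <-; elim: (m - n)%N => // j IH z0; apply: le_trans (IH z0).
by apply: le_reflect_iter => // y y0; rewrite addSn; exact: above_iter_decr.
Qed.

Lemma escape_le1 K k n z : (0 <= z)%R -> escape K k n z <= 1.
Proof.
move=> z0; apply: (le_trans (escape_nonincreasing K k (leq0n n) z0)).
rewrite /escape/=; have -> : iter k reflect (cst 1) z = 1 => //.
elim: k z {z0} => //= k IH z; rewrite (_ : iter k reflect (cst 1) = cst 1) ?reflect_op_cst1//.
exact/funext.
Qed.

(** The first step uses up one of the [k.+1] free steps. If it is not reflected, dropping the
    constraint at time [k] turns the window [k <= j < k + n.+1] into [k.+1 <= j < k.+1 + n], so that
    [k.+1] reappears. *)
Lemma escape_rec K k n z : (0 <= z)%R ->
  escape K k.+1 n.+1 z <= stay (escape K k.+1 n) z + jump (escape K k n.+1) z.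
Proof.
move=> z0; rewrite [leLHS]/escape iterS reflect_opE; last exact: (nonneg_measurable_escape K k n.+1).
apply: leeD => //; apply: le_stay_op; [exact: (nonneg_measurable_escape K k n.+1)|exact: nonneg_measurable_escape|].
move=> y y0.
have -> : escape K k.+1 n = iter k reflect (reflect (iter n (above_op K) (cst 1))).
  by rewrite /escape iterSr.
apply: le_reflect_iter => //.
- exact: nonneg_measurable_reflect_op.
- move=> x x0; rewrite -[leLHS]/(if (K < x)%R then reflect (iter n (above_op K) (cst 1)) x else 0).
  case: ifP => // _.
  by case: (nonneg_measurable_reflect_op mu (nonneg_above_iter K n)).
Qed.

(** The recursion unrolled along the steps before the first reflection: the term [j] stands for a
    reflection after [j] steps, the remainder for none during [N] steps. *)
Lemma stay_iter_bound (f_ : nat -> R -> \bar R) g : (forall m, nonneg_measurable (f_ m)) ->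
  nonneg_measurable g ->
  (forall m z, (0 <= z)%R -> f_ m.+1 z <= stay (f_ m) z + g z) ->
  forall N m z, (0 <= z)%R ->
  f_ (m + N)%N z <= iter N stay (f_ m) z + \sum_(j < N) iter j stay g z.
Proof.
move=> nf ng fg; elim=> [|N IH] m z z0; first by rewrite addn0 big_ord0 adde0.
rewrite addnS -addSn; apply: (le_trans (IH _ _ z0)).
rewrite big_ord_recr/= [X in _ <= _ + X]addeC addeA; apply: leeD => //.
have -> : stay (iter N stay (f_ m)) = iter N stay (stay (f_ m)).
  by rewrite -iterS iterSr.
have ns := nonneg_measurable_stay_op mu (nf m).
rewrite -stay_iterD//; apply: le_stay_iter => //; first exact: nonneg_measurableD.
by move=> y; exact: fg.
Qed.

Lemma nonneg_measurable_stay_sum N g : nonneg_measurable g ->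
  nonneg_measurable (fun z => \sum_(j < N) iter j stay g z).
Proof.
move=> ng; elim: N => [|N IH].
  rewrite (_ : (fun _ => _) = cst 0); first exact: nonneg_measurable_cst.
  by apply/funext => z; rewrite big_ord0.
rewrite (_ : (fun _ => _) = (fun z => \sum_(j < N) iter j stay g z) \+ iter N stay g).
  by apply: nonneg_measurableD => //; exact: nonneg_measurable_stay_iter.
by apply/funext => z; rewrite big_ord_recr.
Qed.

(** Walks with common increments keep their order, so the higher one survives at least as long. *)
Lemma stay_iter1_nondecreasing N (x y : R) : (x <= y)%R ->
  iter N stay (cst 1) x <= iter N stay (cst 1) y.
Proof.
elim: N x y => //= N IH x y xy.
have nS := nonneg_measurable_on_nonneg (nonneg_measurable_stay_iter mu N nonneg1).
have [mx x0] := nonneg_measurable_section x nS.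
have [my y0] := nonneg_measurable_section y nS.
apply: ge0_le_integral => // b _; rewrite /on_nonneg.
case: ifPn => xb; last by case: ifP => // _; exact: stay_iter_ge0.
by rewrite (le_trans xb) ?lerD2r//; apply: IH; rewrite lerD2r.
Qed.

End escape.

(** * Flux of the escape probabilities *)

Section escape_rho.
Local Open Scope ereal_scope.
Context d (T : measurableType d) (R : realType) (P : probability T R).
Context (B : nat -> {RV P >-> R}) (mu : probability R R).
Hypothesis iid : iid_with_law B mu.
Variable eta : {finite_measure set R -> \bar R}.
Hypothesis eta_le1 : eta setT <= 1.
Hypothesis etaE : forall g : R -> \bar R, nonneg_measurable g ->
  \int[eta]_h (if (0 < h)%R then g h else 0) = green mu (jump_op mu g).
Local Notation stay := (stay_op mu).
Local Notation jump := (jump_op mu).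
Local Notation rho := (rho mu eta).
Local Notation above K := (fun z : R => if (K < z)%R then 1 else 0 : \bar R).

Hypothesis rho1 : rho (cst 1) < +oo.
Hypothesis stay0 : forall (L e : R), (0 <= L)%R -> (0 < e)%R ->
  exists N, iter N stay (cst 1) L <= e%:E.
Hypothesis rho_above : forall e : R, (0 < e)%R ->
  exists2 L : R, (0 <= L)%R & rho (above L) <= e%:E.

Let nonneg1 : nonneg_measurable (cst 1 : R -> \bar R).
Proof. by apply: nonneg_measurable_cst; rewrite lee01. Qed.

Let nonneg_above (K : R) : nonneg_measurable (above K).
Proof.
apply: nonneg_measurable_if => //; first exact: measurable_fun_ltr.
Qed.

Let half_gt0 (e : R) : (0 < e)%R -> (0 < e / 2)%R.
Proof. by move=> e0; rewrite divr_gt0. Qed.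

(** Above [L] the flux is small and survival has probability at most 1. Below [L] survival is at
    most its value at [L], which is made small, and the flux is finite. *)
Lemma rho_stay_small (e : R) : (0 < e)%R ->
  exists N, rho (iter N stay (cst 1)) <= e%:E.
Proof.
move=> e0.
have [L L0 hL] := rho_above (half_gt0 e0).
pose r := fine (rho (cst 1)).
have rho1E : rho (cst 1) = r%:E.
  by rewrite fineK// ge0_fin_numE// (rho_ge0 iid).
have r0 : (0 <= r)%R by rewrite -lee_fin -rho1E (rho_ge0 iid).
have r1 : (0 < r + 1)%R by rewrite ltr_wpDl.
(* Chosen so that its product with [r] is at most [e / 2]; the [+ 1] covers [r = 0]. *)
have /(stay0 L0)[N hN] : (0 < e / (2 * (r + 1)))%R by rewrite divr_gt0// mulr_gt0.
set c := (e / (2 * (r + 1)))%R in hN.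
have c0 : (0 <= c)%R by rewrite divr_ge0 ?ltW ?mulr_gt0.
exists N; apply: (@le_trans _ _ (rho ((fun x => c%:E * cst 1 x) \+ above L))).
  have nc : nonneg_measurable (fun x : R => c%:E * cst 1 x : \bar R).
    by apply: nonneg_measurable_cst; rewrite lee_fin mulr1.
  apply: (le_rho iid).
  - exact: nonneg_measurable_stay_iter.
  - exact: nonneg_measurableD.
  - move=> z z0 /=; rewrite mule1; have [Lz|zL] := ltP L z.
      apply: (@le_trans _ _ 1); last by rewrite leeDr// lee_fin.
      elim: N {hN} z z0 {Lz} => //= N IH z z0.
      apply: le_trans (stay_op1_le1 mu z); apply: le_stay_op => //.
      exact: nonneg_measurable_stay_iter.
    by rewrite adde0; apply: le_trans hN; exact: stay_iter1_nondecreasing.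
rewrite (rhoD iid)//; last first.
  by apply: nonneg_measurable_cst; rewrite lee_fin mulr1.
rewrite (rhoZ iid)// rho1E (_ : e%:E = (e / 2)%:E + (e / 2)%:E); last first.
  by rewrite -EFinD -splitr.
apply: leeD => //; rewrite -EFinM lee_fin /c.
have -> : (e / (2 * (r + 1)) * r = e / 2 * (r / (r + 1)))%R.
  by field; rewrite gt_eqF.
by rewrite ler_piMr ?divr_ge0 ?ltW// ltr_pdivrMr// mul1r ltrDl.
Qed.

(** Induction on [k]. [stay_iter_bound] decomposes the escape at the next reflection, after which at
    most [k] free steps remain; [sum_rho_stay_iter] with [g = jump (escape mu K k n)] bounds the sum
    by the flux of [escape mu K k n], and [N] steps without reflection cost [e / 2]. *)
Lemma rho_escape_small (K : R) k (e : R) : (0 < e)%R ->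
  exists n, rho (escape mu K k n) <= rho (above K) + e%:E.
Proof.
elim: k e => [|k IH] e e0.
  exists 1%N; apply: (@le_trans _ _ (rho (above K))); last first.
    by rewrite leeDl// lee_fin ltW.
  apply: (le_rho iid) => //; first exact: nonneg_measurable_escape.
  by move=> z _; rewrite /escape/= /above_op; case: ifP => // _; rewrite reflect_op_cst1.
have [n hn] := IH _ (half_gt0 e0).
have [N hN] := rho_stay_small (half_gt0 e0).
have nj : nonneg_measurable (jump (escape mu K k n)).
  by apply: nonneg_measurable_jump_op; exact: nonneg_measurable_escape.
have ns := nonneg_measurable_stay_sum mu N nj.
have nN : nonneg_measurable (iter N stay (cst 1)) by exact: nonneg_measurable_stay_iter.
exists (n + N)%N.
apply: (@le_trans _ _ (rho (iter N stay (cst 1) \+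
    (fun z => \sum_(j < N) iter j stay (jump (escape mu K k n)) z)))).
  apply: (le_rho iid).
  - exact: nonneg_measurable_escape.
  - exact: nonneg_measurableD.
  move=> z z0 /=; have := @stay_iter_bound _ mu (fun m => escape mu K k.+1 (n + m))
    (jump (escape mu K k n)) _ nj _ N 0%N z z0.
  rewrite add0n addn0 => /(_ (fun m => nonneg_measurable_escape mu K k.+1 (n + m))) H.
  apply: le_trans (H _) _ => [m y y0|].
    rewrite addnS; apply: (le_trans (escape_rec mu K k (n + m) y0)).
    apply: leeD => //; apply: le_jump_op; [exact: nonneg_measurable_escape..|].
    by move=> x x0; apply: escape_nonincreasing => //; rewrite -addnS leq_addr.
  apply: leeD => //; apply: le_stay_iter => //; first exact: nonneg_measurable_escape.
  by move=> y y0; exact: escape_le1.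
have sumE : rho (fun z => \sum_(j < N) iter j stay (jump (escape mu K k n)) z) =
    \sum_(j < N) rho (iter j stay (jump (escape mu K k n))).
  elim: {hN nN ns} N => [|M IHM].
    rewrite big_ord0 (_ : (fun _ => _) = (fun x => 0%:E * cst 1 x)); last first.
      by apply/funext => z; rewrite big_ord0 mul0e.
    have -> := rhoZ iid eta (lexx 0%R) nonneg1.
    by rewrite mul0e.
  rewrite big_ord_recr/= -IHM.
  have <- := rhoD iid eta (nonneg_measurable_stay_sum mu M nj)
    (nonneg_measurable_stay_iter mu M nj).
  by congr (rho _); apply/funext => z; rewrite big_ord_recr.
have sum_le : rho (fun z => \sum_(j < N) iter j stay (jump (escape mu K k n)) z) <=
    rho (above K) + (e / 2)%:E.
  by apply: le_trans hn; rewrite sumE; exact: (sum_rho_stay_iter iid eta_le1 etaE N nj).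
have -> := rhoD iid eta nN ns.
have -> : e%:E = (e / 2)%:E + (e / 2)%:E by rewrite -EFinD -splitr.
by rewrite [leRHS]addeA [leLHS]addeC; exact: leeD sum_le hN.
Qed.

End escape_rho.

(** * Finiteness of the flux *)

Section flux.
Local Open Scope ereal_scope.
Context d (T : measurableType d) (R : realType) (P : probability T R).
Context (B : nat -> {RV P >-> R}) (mu : probability R R).
Hypothesis iid : iid_with_law B mu.
Local Notation leb := (@lebesgue_measure R).
Variable eta : {finite_measure set R -> \bar R}.
Hypothesis etaE : forall g : R -> \bar R, nonneg_measurable g ->
  \int[eta]_h (if (0 < h)%R then g h else 0) = green mu (jump_op mu g).
Local Notation tail x := (eta `]x, +oo[%classic).
Local Notation rho := (rho mu eta).
Local Notation above K := (fun z : R => if (K < z)%R then 1 else 0 : \bar R).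

Let nonneg1 d' (S : measurableType d') : nonneg_measurable (cst 1 : S -> \bar R).
Proof. by apply: nonneg_measurable_cst; rewrite lee01. Qed.

Let nonneg0 d' (S : measurableType d') : nonneg_measurable (cst 0 : S -> \bar R).
Proof. exact: nonneg_measurable_cst. Qed.

Lemma overshoot_tailE (x : R) : (0 <= x)%R ->
  tail x = green mu (fun y => \int[mu]_b (if (x + y < b)%R then 1 else 0)).
Proof.
move=> x0; rewrite tailE.
have nx : nonneg_measurable (above x).
  by apply: nonneg_measurable_if; [exact: measurable_fun_ltr|exact: nonneg1|exact: nonneg0].
transitivity (\int[eta]_h (if (0 < h)%R then above x h else 0)).
  apply: eq_integral => h _; case: (ltP 0%R h) => // h0.
  by rewrite ltNge (le_trans h0 x0).
rewrite etaE//; congr (green mu _); apply/funext => y.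
apply: eq_integral => b _; rewrite /on_neg opprB.
have [yb|yb] := ltP (y - b)%R 0%R.
  by have -> : (x < b - y)%R = (x + y < b)%R by apply/idP/idP; lra.
by rewrite ifF//; apply/negP; lra.
Qed.

Lemma tail_above_rho (K : R) : (0 <= K)%R ->
  rho (above K) = \int[leb]_x (if (0 < x)%R then tail x * tail (x + K)%R else 0).
Proof.
move=> K0.
have nK : nonneg_measurable (above K).
  by apply: nonneg_measurable_if; [exact: measurable_fun_ltr|exact: nonneg1|exact: nonneg0].
rewrite rhoE//; apply: eq_integral => x _; case: ifPn => // x0.
congr (_ * _); rewrite tailE; apply: eq_integral => h _.
rewrite ltrBrDr addrC; case: ltP => //= xh.
by case: ltP => // xKh; exfalso; lra.
Qed.

Lemma tail_rho1 :
  rho (cst 1) = \int[leb]_x (if (0 < x)%R then tail x * tail x else 0).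
Proof.
rewrite rhoE//; apply: eq_integral => x _; case: ifPn => // x0.
by congr (_ * _); rewrite tailE.
Qed.

Let mt : nonneg_measurable (fun x : R => tail x).
Proof. exact: nonneg_measurable_tail. Qed.

Let tail_le (x y : R) : (x <= y)%R -> tail y <= tail x.
Proof.
move=> xy; apply: le_measure; rewrite ?inE//.
by move=> z /=; rewrite !in_itv/= !andbT; exact: le_lt_trans.
Qed.

(** Dominated convergence: [tail x * tail (x + n)] tends to 0, [eta] being finite, and is dominated
    by the integrable [tail x * tail x]. *)
Lemma rho_above_small (e : R) : rho (cst 1) < +oo -> (0 < e)%R ->
  exists2 L : R, (0 <= L)%R & rho (above L) <= e%:E.
Proof.
rewrite tail_rho1 => fin e0.
pose f n x := if (0 < x)%R then tail x * tail (x + n%:R)%R else 0.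
pose g x := if (0 < x)%R then tail x * tail x else 0.
have nf n : nonneg_measurable (f n : measurableTypeR R -> \bar R).
  apply: (@nonneg_measurable_if R _ R).
  - exact: measurable_fun_ltr.
  - apply: nonneg_measurableM => //.
    by apply: (nonneg_measurable_comp mt); exact: measurable_funD.
  - exact: nonneg0.
have ng : nonneg_measurable (g : measurableTypeR R -> \bar R).
  apply: (@nonneg_measurable_if R _ R); first exact: measurable_fun_ltr.
    exact: nonneg_measurableM.
  exact: nonneg0.
have tfin x : tail x \is a fin_num by exact: fin_num_measure.
have f0 x : f ^~ x @ \oo --> cst 0 x.
  rewrite /f; have [x0|x0] := ltP 0%R x; last exact: cvg_cst.
  rewrite (_ : cst 0 x = tail x * 0); last by rewrite mule0.
  apply: cvgeZl => //.
  have : eta \o (fun n => `](x + n%:R)%R, +oo[%classic) @ \oo -->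
      eta (\bigcap_n `](x + n%:R)%R, +oo[%classic).
    apply: nonincreasing_cvg_mu => //.
    - by rewrite -ge0_fin_numE// tfin.
    - exact: bigcapT_measurable.
    - move=> n m nm; apply/subsetPset => z /=; rewrite !in_itv/= !andbT.
      by apply: le_lt_trans; rewrite lerD2l ler_nat.
  rewrite (_ : \bigcap_n _ = set0) ?measure0//.
  apply/seteqP; split => // z /= /(_ (Num.truncn (z - x)).+1 I).
  rewrite /= in_itv/= andbT => H.
  have := truncnS_gt (z - x); lra.
have [_ _ cf] : [/\ leb.-integrable setT (cst 0),
    [sequence \int[leb]_x `|f n x - cst 0 x| ]_n @ \oo --> 0 &
    [sequence \int[leb]_x f n x]_n @ \oo --> \int[leb]_x cst 0 x].
  apply: (@dominated_convergence _ _ _ leb setT measurableT f (cst 0) g) => //.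
  - by move=> n; case: (nf n).
  - by apply: aeW => x _; exact: f0.
  - apply/integrableP; split; first by case: ng.
    apply: le_lt_trans fin; rewrite le_eqVlt; apply/orP; left; apply/eqP.
    by apply: eq_integral => x _; rewrite gee0_abs//; case: ng.
  - apply: aeW => x n _; rewrite gee0_abs; last by case: (nf n).
    rewrite /f /g; case: ifP => // _; apply: lee_wpmul2l => //.
    by apply: tail_le; rewrite lerDl.
rewrite integral0 in cf.
have : nbhs (0 : \bar R) [set u | u < e%:E].
  by apply: open_ereal_lt'; rewrite lte_fin.
move=> /cf[n _ /(_ n (leqnn n)) /= /ltW hn].
by exists n%:R%R => //; rewrite tail_above_rho.
Qed.

Variable kappa : R -> R.
Hypothesis mkappa : measurable_fun setT kappa.
Hypothesis kappa_ge0 : forall t, (0 <= kappa t)%R.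
Hypothesis kappa_nondecreasing : forall s t, (s <= t)%R -> (kappa s <= kappa t)%R.
Hypothesis green_kappa : forall t, (0 < t)%R ->
  green mu (fun y => if (y < t)%R then 1 else 0) <= (kappa t)%:E.

Let J (x : R) := \int[mu]_b (if (x < b)%R then (kappa b)%:E else 0).

Let nkappa : nonneg_measurable (fun b : R => (kappa b)%:E).
Proof. by split => [|t]; [exact/measurable_EFinP|rewrite lee_fin]. Qed.

Let nJ2 : nonneg_measurable (fun p : R * R => if (p.1 < p.2)%R then (kappa p.2)%:E else 0).
Proof.
apply: nonneg_measurable_if; first exact: measurable_fun_ltr.
  exact: (nonneg_measurable_comp nkappa).
exact: nonneg0.
Qed.

Let nJ1 x : nonneg_measurable (fun b : R => if (x < b)%R then (kappa b)%:E else 0).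
Proof.
by apply: nonneg_measurable_if => //; exact: measurable_fun_ltr.
Qed.

Let nJ : nonneg_measurable J.
Proof.
have [m2 ge2] := nJ2; split; first exact: (measurable_fun_fubini_tonelli_F _ m2 ge2).
by move=> x; apply: integral_ge0 => b _; exact: (ge2 (x, b)).
Qed.

(** An increment [b] overshoots by more than [x] only from a position below [b - x]. That set has
    potential at most [kappa (b - x) <= kappa b], and misses [[0, oo[] if [b <= x]. The integral
    over [b] is exchanged with the Green sum. *)
Lemma overshoot_tail_le (x : R) : (0 <= x)%R -> tail x <= J x.
Proof.
move=> x0; rewrite overshoot_tailE//.
pose H (p : R * R) : \bar R := if (x + p.2 < p.1)%R then 1 else 0.
have nH : nonneg_measurable H.
  apply: nonneg_measurable_if; [|exact: nonneg1|exact: nonneg0].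
  by apply: measurable_fun_ltr => //; exact: measurable_funD.
have -> := green_integral iid mu nH.
have [mG G0] := nonneg_measurable_green iid nH.
have [mj j0] := nJ1 x.
apply: ge0_le_integral => // b _.
have nHb : nonneg_measurable (fun y : R => H (b, y)) by apply: (nonneg_measurable_comp nH).
case: ifPn => [xb|]; last first.
  rewrite -leNgt => bx; rewrite /green eseries0// => n _ _.
  have e0 : nonneg_measurable (cst 0 : R -> \bar R) by exact: nonneg0.
  apply/le_anti/andP; split; last exact: stay_iter_ge0.
  have z0 : iter n (stay_op mu) (cst 0) = cst 0.
    elim: n => //= n ->; apply/funext => y.
    rewrite /stay_op /increment_op; apply: integral0_eq => z _.
    by rewrite /on_nonneg; case: ifP.
  rewrite -[leRHS]/(cst 0 (0%R : R)) -z0; apply: le_stay_iter => // y y0.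
  by rewrite /H/= ifF//; apply/negP; lra.
apply: (@le_trans _ _ (kappa (b - x))%:E).
  rewrite (_ : (fun y => H (b, y)) = (fun y => if (y < b - x)%R then 1 else 0)); last first.
    by apply/funext => y; rewrite /H/= ltrBrDl.
  by apply: green_kappa; rewrite subr_gt0.
by rewrite lee_fin kappa_nondecreasing// lerBlDr lerDl.
Qed.

Let sqrt_min (b c : R) :
  \int[leb]_x (if [&& (0 < x)%R, (x < b)%R & (x < c)%R] then 1 else 0) <=
  (Num.sqrt b * Num.sqrt c)%:E.
Proof.
have -> : \int[leb]_x (if [&& (0 < x)%R, (x < b)%R & (x < c)%R] then 1 else 0) =
    leb `]0%R, Num.min b c[%classic.
  rewrite -[RHS]mul1e -integral_cst// [RHS]integral_mkcond; apply: eq_integral => x _.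
  by rewrite /patch mem_setE in_itv/= lt_min.
rewrite lebesgue_measure_itv/= lte_fin; case: ifPn => [m0|_]; last first.
  by rewrite lee_fin mulr_ge0// sqrtr_ge0.
rewrite -EFinD subr0 lee_fin.
have /andP[b0 c0] : (0 < b)%R && (0 < c)%R by rewrite -lt_min.
have -> : Num.min b c = Num.sqrt (Num.min b c ^+ 2) by rewrite sqrtr_sqr gtr0_norm.
rewrite -(sqrtrM _ (ltW b0)) ler_wsqrtr//.
by rewrite expr2 ler_pM ?(ltW m0)// ge_min lexx ?orbT.
Qed.

Lemma rho1_finite : \int[mu]_b (kappa b * Num.sqrt b)%:E < +oo ->
  rho (cst 1) < +oo.
Proof.
set M := \int[mu]_b _ => Mfin; rewrite tail_rho1.
have nks : nonneg_measurable (fun b : R => (kappa b * Num.sqrt b)%:E).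
  split; last by move=> b; rewrite lee_fin mulr_ge0// sqrtr_ge0.
  apply/measurable_EFinP; apply: measurable_funM => //.
  apply: continuous_measurable_fun; exact: sqrt_continuous.
have M0 : 0 <= M by apply: integral_ge0 => b _; case: nks.
have [mJ J0] := nJ; have [mT T0] := mt.
apply: (@le_lt_trans _ _ (M * M)); last first.
  by rewrite lte_mul_pinfty// ge0_fin_numE.
(* The factors of [J x * J x] are expanded one after the other: [H] is integrated over [b], then
   [H' b] over [c], each integral being exchanged with the one in [x]. *)
pose H (p : R * R) : \bar R :=
  if (0 < p.1)%R && (p.1 < p.2)%R then (kappa p.2)%:E * J p.1 else 0.
have nH : nonneg_measurable H.
  apply: nonneg_measurable_if; first by apply: measurable_and; exact: measurable_fun_ltr.
    by apply: nonneg_measurableM; [exact: (nonneg_measurable_comp nkappa)|exact: (nonneg_measurable_comp nJ)].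
  exact: nonneg0.
pose H' (b : R) (p : R * R) : \bar R :=
  (kappa p.2)%:E * (if [&& (0 < p.1)%R, (p.1 < b)%R & (p.1 < p.2)%R] then 1 else 0).
have nH' b : nonneg_measurable (H' b).
  apply: nonneg_measurableM; first exact: (nonneg_measurable_comp nkappa).
  apply: nonneg_measurable_if; [|exact: nonneg1|exact: nonneg0].
  apply: measurable_and; first exact: measurable_fun_ltr.
  by apply: measurable_and; exact: measurable_fun_ltr.
have fub (G : R * R -> \bar R) : nonneg_measurable G ->
    \int[leb]_x \int[mu]_b G (x, b) = \int[mu]_b \int[leb]_x G (x, b).
  move=> [mG G0].
  exact: (@fubini_tonelli _ _ (measurableTypeR R) R R leb mu G mG G0).
have mleb (G : R * R -> \bar R) : nonneg_measurable G ->
    nonneg_measurable (fun b : R => \int[leb]_x G (x, b)).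
  move=> [mG G0]; split; last by move=> b; exact: integral_ge0.
  exact: (@measurable_fun_fubini_tonelli_G _ _ (measurableTypeR R) R R leb G mG G0).
apply: (@le_trans _ _ (\int[leb]_x \int[mu]_b H (x, b))).
  have nL : nonneg_measurable (fun x : R => if (0 < x)%R then tail x * tail x else 0).
    apply: nonneg_measurable_if; first exact: measurable_fun_ltr.
      exact: nonneg_measurableM.
    exact: nonneg0.
  have [mL L0] := nL.
  have [mR' R0] : nonneg_measurable (fun x : R => \int[mu]_b H (x, b)).
    have [mH H0] := nH; split; first exact: measurable_fun_fubini_tonelli_F.
    by move=> x; exact: integral_ge0.
  apply: ge0_le_integral => // x _; case: ifPn => // x0.
  apply: (@le_trans _ _ (J x * J x)).
    by apply: lee_pmul => //; apply: overshoot_tail_le; exact: ltW.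
  rewrite [X in X * _]/J -ge0_integralZr//.
  - rewrite le_eqVlt; apply/orP; left; apply/eqP/eq_integral => b _.
    by rewrite /H/= x0/=; case: ifP => // _; rewrite mul0e.
  - by case: (nJ1 x).
  - by move=> b _; case: (nJ1 x).
have -> := fub _ nH.
apply: (@le_trans _ _ (\int[mu]_b ((kappa b * Num.sqrt b)%:E * M))); last first.
  rewrite ge0_integralZr//; first by case: nks.
  by move=> b _; case: nks.
have [mL L0] := mleb _ nH.
have [mK K0] := nks.
apply: ge0_le_integral => //.
  by apply: emeasurable_funM.
move=> b _.
rewrite EFinM -muleA.
have -> : \int[leb]_x H (x, b) =
    (kappa b)%:E * \int[leb]_x \int[mu]_c H' b (x, c).
  have [mHb H0] : nonneg_measurable (fun x : R => \int[mu]_c H' b (x, c)).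
    have [mH H0] := nH' b; split; first exact: measurable_fun_fubini_tonelli_F.
    by move=> x; exact: integral_ge0.
  rewrite -ge0_integralZl//; last by rewrite lee_fin.
  apply: eq_integral => x _; rewrite /H /H'/=.
  case: ifPn => [/andP[x0 xb]|xb].
    rewrite x0 xb/=; congr (_ * _); apply: eq_integral => c _.
    by case: ifP; rewrite ?mule1 ?mule0.
  rewrite integral0_eq ?mule0// => c _; rewrite ifF ?mule0//.
  by apply/negP => /and3P[x0 xb' _]; move: xb; rewrite x0 xb'.
apply: lee_wpmul2l; first by rewrite lee_fin.
have -> := fub _ (nH' b).
apply: (@le_trans _ _ (\int[mu]_c ((Num.sqrt b)%:E * (kappa c * Num.sqrt c)%:E))); last first.
  by rewrite ge0_integralZl// lee_fin sqrtr_ge0.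
have [mL' L0'] := mleb _ (nH' b).
apply: ge0_le_integral => //; first exact: measurable_funeM.
move=> c _.
have -> : \int[leb]_x H' b (x, c) = (kappa c)%:E *
    \int[leb]_x (if [&& (0 < x)%R, (x < b)%R & (x < c)%R] then 1 else 0).
  rewrite -ge0_integralZl//.
  - apply: (measurable_fun_ifT (T1 := measurableTypeR R)) => //.
    apply: (@measurable_and _ R); first exact: measurable_fun_ltr.
    by apply: measurable_and; exact: measurable_fun_ltr.
  - by move=> x _; case: ifP.
  - by rewrite lee_fin.
rewrite -EFinM mulrCA EFinM; apply: lee_wpmul2l; first by rewrite lee_fin.
exact: sqrt_min.
Qed.

End flux.

(** * Positive drift *)

Section positive_drift.
Local Open Scope ereal_scope.
Context (R : realType) (mu : probability R R).
Local Notation stay := (stay_op mu).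
Hypothesis drift : \int[mu]_b (Num.max (- b) 0)%:E < \int[mu]_b (Num.max b 0)%:E.

Let nonneg1 : nonneg_measurable (cst 1 : R -> \bar R).
Proof. by apply: nonneg_measurable_cst; rewrite lee01. Qed.

Let npart : nonneg_measurable (fun b : R => (Num.max (- b) 0)%:E).
Proof.
split; last by move=> b; rewrite lee_fin le_max lexx orbT.
by apply/measurable_EFinP; apply: measurable_maxr.
Qed.

Let ntrunc (M : R) : (0 <= M)%R ->
  nonneg_measurable (fun b : R => (Num.min (Num.max b 0) M)%:E).
Proof.
move=> M0; split; last by move=> b; rewrite lee_fin le_min le_max lexx orbT.
by apply/measurable_EFinP; apply: measurable_minr => //; apply: measurable_maxr.
Qed.

(** [E B^+] may be infinite; by monotone convergence, some truncation from above makes the drift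
    finite and keeps it positive. *)
Lemma truncated_drift : exists2 M : R, (0 < M)%R &
  \int[mu]_b (Num.max (- b) 0)%:E < \int[mu]_b (Num.min (Num.max b 0) M)%:E.
Proof.
pose g n (b : R) := (Num.min (Num.max b 0) n%:R)%:E.
have limg b : limn (g ^~ b) = (Num.max b 0)%:E.
  apply/cvg_lim => //; apply: cvg_near_cst.
  exists (Num.truncn (Num.max b 0%R)).+1 => // n /= bn.
  congr (_%:E); apply/min_idPl; apply: le_trans (ltW (truncnS_gt _)) _.
  by rewrite ler_nat.
have : (fun n => \int[mu]_b g n b) @ \oo --> \int[mu]_b (Num.max b 0)%:E.
  under [X in _ --> X]eq_integral do rewrite -limg.
  apply: cvg_monotone_convergence => //.
  - by move=> n; case: (@ntrunc n%:R).
  - by move=> n b _; rewrite /g lee_fin le_min le_max lexx orbT/=.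
  - move=> b _ n m nm; rewrite lee_fin le_min ge_min lexx/=.
    by rewrite ge_min ler_nat nm orbT.
move=> /(_ _ (open_ereal_gt' drift))[n _ /= hn].
exists n.+1%:R; first exact: ltr0n.
exact: (hn n.+1 (leqnSn n)).
Qed.

(* [y + M] is a Lyapunov function, [M] being the truncation level of
   [truncated_drift]. *)
Lemma drift_stay_sum : exists M m : R, [/\ (0 < M)%R, (0 < m)%R &
  forall n x, (0 <= x)%R ->
    \sum_(k < n) iter k stay (cst 1) x <= ((x + M) / m)%:E].
Proof.
have [M M0 hM] := truncated_drift.
have [mn n0] := npart; have [mt t0] := ntrunc (ltW M0).
set a := \int[mu]_b (Num.min (Num.max b 0) M)%:E in hM.
set c := \int[mu]_b (Num.max (- b) 0)%:E in hM.
have aM : a <= M%:E.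
  apply: (@le_trans _ _ (\int[mu]_b M%:E)).
    apply: ge0_le_integral => // b _.
    by rewrite lee_fin ge_min lexx orbT.
  by rewrite integral_cst//= probability_setT mule1.
have afin : a \is a fin_num.
  by rewrite ge0_fin_numE ?(le_lt_trans aM) ?ltry// integral_ge0.
have cfin : c \is a fin_num.
  by rewrite ge0_fin_numE ?integral_ge0// (lt_le_trans hM)// leey.
pose m := (fine a - fine c)%R.
have m0 : (0 < m)%R by rewrite subr_gt0 fine_lt.
have amE : a = m%:E + c by rewrite /m EFinB !fineK// subeK.
exists M, m; split => // n x x0.
pose h (y : R) := (`|y| + M)%:E.
have nh : nonneg_measurable h.
  split; last by move=> y; rewrite lee_fin addr_ge0// ltW.
  by apply/measurable_EFinP; apply: measurable_funD => //; exact: normr_measurable.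
have nm : nonneg_measurable (fun y : R => m%:E * cst 1 y).
  by apply: nonneg_measurable_cst; rewrite lee_fin mulr1 ltW.
have hdec y : (0 <= y)%R -> stay h y + m%:E * cst 1 y <= h y.
  (* Since [a = m + c], adding [c] to both sides reduces the claim to an inequality between
     integrands. *)
  move=> y0; rewrite -(leeD2rE _ _ cfin) mule1 -addeA -amE.
  have nS := nonneg_measurable_section y (nonneg_measurable_on_nonneg nh).
  have [mS S0] := nS.
  rewrite /stay_op /increment_op /a -ge0_integralD//.
  have -> : h y + c = \int[mu]_b (h y + (Num.max (- b) 0)%:E).
    rewrite ge0_integralD//; last by move=> b _; case: nh.
    by rewrite integral_cst//= probability_setT mule1.
  apply: ge0_le_integral => //.
  - by move=> b _; rewrite adde_ge0.
  - exact: emeasurable_funD.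
  - by apply: emeasurable_funD.
  move=> b _; rewrite /on_nonneg /h.
  case: ifPn => yb; rewrite ?(ger0_norm yb) (ger0_norm y0) -?EFinD ?add0e lee_fin.
  - have [b0|b0] := leP 0%R b.
      have bN : (- b <= 0)%R by rewrite oppr_le0.
      rewrite (elimT max_idPr bN).
      have : (Num.min b M <= b)%R by rewrite ge_min lexx.
      by lra.
    have bN : (0 <= - b)%R by rewrite oppr_ge0 ltW.
    rewrite (elimT max_idPl bN).
    have : (Num.min 0 M <= 0)%R by rewrite ge_min lexx.
    by lra.
  (* Here the step kills the walk and [h] drops to 0: its summand [M] pays for the truncated
     increment. *)
  - have : (Num.min (Num.max b 0) M <= M)%R by rewrite ge_min lexx orbT.
    have : (0 <= Num.max (- b) 0)%R by rewrite le_max lexx orbT.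
    by lra.
suff H : m%:E * (\sum_(k < n) iter k stay (cst 1) x) + iter n stay h x <= h x.
  rewrite EFinM muleC lee_pdivlMl// -[in leRHS](ger0_norm x0).
  by apply: le_trans H; rewrite leeDl// stay_iter_ge0.
elim: n => [|n IH]; first by rewrite big_ord0 mule0 add0e.
apply: le_trans IH; rewrite big_ord_recr/= ge0_muleDr//; last 2 first.
- by apply: sume_ge0 => i _; exact: stay_iter_ge0.
- exact: stay_iter_ge0.
rewrite -addeA leeD2l//.
rewrite -(stay_iterZ mu n x (ltW m0))// addeC -iterS iterSr -stay_iterD//; last first.
  exact: nonneg_measurable_stay_op.
apply: le_stay_iter => //; apply: nonneg_measurableD => //.
exact: nonneg_measurable_stay_op.
Qed.

Lemma drift_stay0 (L e : R) : (0 <= L)%R -> (0 < e)%R ->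
  exists N, iter N stay (cst 1) L <= e%:E.
Proof.
move=> L0 e0; have [M [m [M0 m0 H]]] := drift_stay_sum.
apply: contrapT => /forallNP hN.
pose C := ((L + M) / m)%R; pose n := (Num.truncn (C / e)).+1.
have := H n L L0; rewrite leNgt => /negP; apply.
apply: (@lt_le_trans _ _ (\sum_(k < n) e%:E)).
  rewrite sumEFin lte_fin sumr_const card_ord -[ltRHS]mulr_natr [ltRHS]mulrC.
  by rewrite -ltr_pdivrMr//; exact: truncnS_gt.
apply: lee_sum => k _; apply: ltW; rewrite ltNge; apply/negP; exact: hN.
Qed.

Lemma drift_green : exists2 C : R, (0 <= C)%R & green mu (cst 1) <= C%:E.
Proof.
have [M [m [M0 m0 H]]] := drift_stay_sum.
exists (M / m)%R; first by rewrite divr_ge0// ltW.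
apply: nneseries_le => n; first exact: stay_iter_ge0.
by rewrite -[M]add0r; exact: H.
Qed.

End positive_drift.

(** * Zero drift: linear growth of the potential *)

Section reversal.
Local Open Scope ereal_scope.
Context d (T : measurableType d) (R : realType) (P : probability T R).
Context (B : nat -> {RV P >-> R}) (mu : probability R R).
Hypothesis iid : iid_with_law B mu.

Lemma iid_reindex (s : nat -> nat) : involutive s ->
  iid_with_law (fun i => B (s i)) mu.
Proof.
move: iid => [indB lawB] ss; split => [J A mA|n A mA]; last exact: lawB.
have si : injective s by exact: inv_inj.
have := indB [fset s i | i in J]%fset (A \o s) (fun i => mA (s i)).
rewrite big_imfset/=; last by move=> i j _ _ /si.
rewrite (_ : \bigcap_(i in [set` [fset s i | i in J]%fset]) _ =
    \bigcap_(i in [set` J]) (B (s i) @^-1` A i)).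
  by move=> ->; apply: eq_bigr => i _; rewrite ss.
apply/seteqP; split => w /= H i /=.
  by move=> iJ; have := H (s i); rewrite ss; apply; apply/imfsetP; exists i.
by move=> /imfsetP[j /= jJ ->]; rewrite ss; exact: H.
Qed.

Definition partial_sum n w : R := (\sum_(i < n) B i w)%R.
Local Notation S := partial_sum.
Fixpoint running_min n w : R :=
  if n is m.+1 then Num.min (running_min m w) (S n w) else 0%R.

Let S_rec n w : S n.+1 w = (S n w + B n w)%R.
Proof. by rewrite /partial_sum big_ord_recr. Qed.

Lemma adapted_sum n : adapted B n (S n).
Proof.
elim: n => [|n IH].
  rewrite (_ : S 0 = cst 0%R); first exact: measurable_cst.
  by apply/funext => w; rewrite /partial_sum big_ord0.
rewrite (_ : S n.+1 = fun w => (S n w + B n w)%R); last exact/funext/S_rec.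
by apply: measurable_funD; [exact: (adapted_le (leqnSn n))|exact: adapted_increment].
Qed.

Lemma adapted_running_min n : adapted B n (running_min n).
Proof.
elim: n => [|n IH]; first exact: measurable_cst.
by apply: measurable_minr; [exact: (adapted_le (leqnSn n))|exact: (adapted_sum (n := n.+1))].
Qed.

Lemma running_min_le n m w : (m <= n)%N -> (running_min n w <= S m w)%R.
Proof.
elim: n => [|n IH]; first by rewrite leqn0 => /eqP ->; rewrite /partial_sum big_ord0.
rewrite leq_eqVlt => /predU1P[->|mn]; first by rewrite /= ge_min lexx orbT.
by rewrite /= ge_min IH.
Qed.

Lemma le_running_min n w (c : R) : (forall m, (m <= n)%N -> (c <= S m w)%R) ->
  (c <= running_min n w)%R.
Proof.
elim: n => [|n IH] H; first by have := H 0%N (leqnn _); rewrite /partial_sum big_ord0.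
by rewrite /= le_min IH ?H// => m mn; apply: H; rewrite (leq_trans mn).
Qed.

Definition record n (t : R) w := (S n w <= running_min n w)%R && (- t < S n w)%R.

(* Reversing the first [n] increments turns the event that the walk has not
   yet jumped above its starting point into the event that [n] is a (weak)
   descending ladder epoch. *)
Lemma stay_iter_record n (t : R) : (0 < t)%R ->
  iter n (stay_op mu) (fun y => if (y < t)%R then 1 else 0) 0%R <=
  \int[P]_w (if record n t w then 1 else 0).
Proof.
move=> t0; pose s i := if (i < n)%N then (n.-1 - i)%N else i.
have ss : involutive s.
  move=> i; rewrite /s; have [im|im] := ltnP i n; last by rewrite ltnNge im.
  rewrite ifT; last by case: (n) im => // k _; rewrite ltnS leq_subr.
  by rewrite subKn//; case: (n) im.
have nt : nonneg_measurable (fun y : R => if (y < t)%R then 1 else 0 : \bar R).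
  apply: nonneg_measurable_if; first exact: measurable_fun_ltr.
    by apply: nonneg_measurable_cst; rewrite lee01.
  exact: nonneg_measurable_cst.
rewrite -(expectation_killed_walk (iid_reindex ss))//.
set Y := killed_walk (fun n w => B (s n) w) 0%R.
have YS k w : (0 <= Y k w)%R -> forall j, (j <= k)%N ->
    (0 <= - \sum_(i < j) B (s i) w)%R /\ Y k w = (- \sum_(i < k) B (s i) w)%R.
  elim: k => [|k IH].
    by move=> _ j; rewrite leqn0 => /eqP ->; rewrite !big_ord0 oppr0 lexx.
  have -> : Y k.+1 w = (if 0 <= Y k w then Y k w - B (s k) w else Y k w)%R by [].
  have [Yk|/lt_geF Yk] := leP 0%R (Y k w); last by rewrite Yk.
  move=> Yk1 j.
  have YE : (Y k w - B (s k) w)%R = (- \sum_(i < k.+1) B (s i) w)%R.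
    by have [_ ->] := IH Yk 0%N (leq0n k); rewrite big_ord_recr/= opprD.
  rewrite leq_eqVlt => /predU1P[->|jk]; first by rewrite -YE.
  by split => //; have [] := IH Yk j jk.
(* The sum of the first [j] reversed increments is [S n - S (n - j)]; that all of these are
   nonpositive says that [S n] is a minimum up to time [n]. *)
have rev j w : (j <= n)%N ->
    (\sum_(i < j) B (s i) w)%R = (S n w - S (n - j) w)%R.
  elim: j => [|j IH] jn; first by rewrite big_ord0 subn0 subrr.
  rewrite big_ord_recr/= IH ?(ltnW jn)// /s jn.
  have -> : (n - j = (n - j.+1).+1)%N by rewrite subnSK.
  have -> : (n.-1 - j = n - j.+1)%N by case: (n) jn => // k; rewrite subSS.
  by rewrite S_rec; ring.
have mY : measurable_fun setT (Y n).
  exact: (adapted_measurable (@adapted_killed_walk _ _ _ _ (fun i => B (s i)) 0%R n)).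
have [mf f0] := nonneg_measurable_comp (nonneg_measurable_on_nonneg nt) mY.
apply: ge0_le_integral => //; first by move=> w _; exact: f0.
  apply: measurable_fun_ifT => //; apply: measurable_and.
    apply: measurable_fun_ler; first exact: (adapted_measurable (@adapted_sum n)).
    exact: (adapted_measurable (@adapted_running_min n)).
  by apply: measurable_fun_ltr => //; exact: (adapted_measurable (@adapted_sum n)).
move=> w _; rewrite /on_nonneg; case: ifPn => [Yn|_]; last by case: ifP.
case: ifPn => [Ynt|_]; last by case: ifP.
have YnE : Y n w = (- S n w)%R.
  have [_ ->] := YS n w Yn 0%N (leq0n n).
  by rewrite rev// subnn {2}/partial_sum big_ord0 subr0.
rewrite ifT// /record ltrNl -YnE Ynt andbT.
apply: le_running_min => m mn.
have [+ _] := YS n w Yn (n - m)%N (leq_subr _ _).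
by rewrite rev ?leq_subr// subKn// oppr_ge0 subr_le0.
Qed.

(* A record followed by an increment below [- e] lowers the running minimum by
   [e], and records above [- t] stop once the minimum is below [- t]. *)
Lemma record_count_le N (t e : R) w : (0 < t)%R -> (0 < e)%R ->
  (e * \sum_(n < N) (record n t w && (B n w < - e)%R)%:R <=
   Num.min (- running_min N w) (t + e))%R.
Proof.
move=> t0 e0; elim: N => [|N IH].
  by rewrite big_ord0 mulr0 /= oppr0 le_min lexx addr_ge0// ltW.
rewrite big_ord_recr/= mulrDr; move: IH; rewrite !le_min => /andP[IH1 IH2].
case: (boolP (record N t w && _)) => [/andP[/andP[H1 H2] H3]|_] /=; last first.
  rewrite mulr0 addr0 IH2 andbT (le_trans IH1)//.
  by rewrite lerN2 ge_min lexx.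
have := running_min_le w (leqnn N); have := S_rec N w.
rewrite /partial_sum => SE mS.
apply/andP; split; last by lra.
rewrite lerNr ge_min; apply/orP; right.
by move: H1 H2; rewrite /partial_sum SE; lra.
Qed.

(** Being a record at time [n] is independent of [B n]. So [p] times the expected number of records
    is the expected number of records followed by an increment below [- e], and [record_count_le]
    bounds the latter by [(t + e) / e] on every path. *)
Lemma green_linear (e : R) : (0 < e)%R -> 0 < mu `]-oo, (- e)%R[%classic ->
  forall t : R, (0 < t)%R ->
  green mu (fun y => if (y < t)%R then 1 else 0) <=
  ((t / e + 1) / fine (mu `]-oo, (- e)%R[%classic))%:E.
Proof.
move=> e0 p0 t t0; set p := mu _ in p0 *.
have pE : p = (fine p)%:E by rewrite fineK// fin_num_measure.
have fp0 : (0 < fine p)%R by rewrite -lte_fin -pE.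
have nt : nonneg_measurable (fun y : R => if (y < t)%R then 1 else 0 : \bar R).
  apply: nonneg_measurable_if; first exact: measurable_fun_ltr.
    by apply: nonneg_measurable_cst; rewrite lee01.
  exact: nonneg_measurable_cst.
apply: nneseries_le => [n|N]; first exact: stay_iter_ge0.
apply: (@le_trans _ _ (\sum_(n < N) \int[P]_w (if record n t w then 1 else 0))).
  by apply: lee_sum => n _; exact: stay_iter_record.
rewrite EFinM muleC lee_pdivlMl// -pE.
have ar n : adapted B n (record n t).
  apply: measurable_and.
    by apply: measurable_fun_ler; [exact: adapted_sum|exact: adapted_running_min].
  by apply: measurable_fun_ltr; [exact: measurable_cst|exact: adapted_sum].
have mr n := adapted_measurable (ar n).
have mB n : measurable_fun setT (fun w => (B n w < - e)%R).
  by apply: measurable_fun_ltr.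
have pr n : p * \int[P]_w (if record n t w then 1 else 0) =
    \int[P]_w (if record n t w && (B n w < - e)%R then 1 else 0).
  pose F (q : bool * R) : \bar R := if q.1 && (q.2 < - e)%R then 1 else 0.
  have [mF F0] : nonneg_measurable F.
    apply: nonneg_measurable_if.
    - by apply: measurable_and => //; exact: measurable_fun_ltr.
    - by apply: nonneg_measurable_cst; rewrite lee01.
    - exact: nonneg_measurable_cst.
  rewrite (adapted_increment_integral iid (ar n) mF F0).
  have mif : measurable_fun setT (fun w => if record n t w then 1 else 0 : \bar R).
    exact: measurable_fun_ifT.
  rewrite -ge0_integralZl//; last 2 first.
  - by move=> w _; case: ifP.
  - exact: ltW.
  apply: eq_integral => w _; rewrite /F/=; case: (record n t w) => /=; last first.
    by rewrite mule0 integral0.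
  rewrite mule1 -[LHS]mul1e /p -integral_cst// integral_mkcond.
  by apply: eq_integral => b _; rewrite /patch mem_setE in_itv/=.
rewrite ge0_sume_distrr; last by move=> n _; apply: integral_ge0 => w _; case: ifP.
under eq_bigr do rewrite pr.
rewrite -ge0_integral_sum//; last 2 first.
- by move=> n; apply: measurable_fun_ifT => //; apply: measurable_and.
- by move=> n w _; case: ifP.
apply: (@le_trans _ _ (\int[P]_w (t / e + 1)%:E)); last first.
  by rewrite integral_cst//= probability_setT mule1.
apply: ge0_le_integral => //.
- by move=> w _; apply: sume_ge0 => n _; case: ifP.
- by apply: emeasurable_sum => n; apply: measurable_fun_ifT => //; apply: measurable_and.
move=> w _.
rewrite (eq_bigr (fun n : 'I_N => ((record n t w && (B n w < - e)%R)%:R)%:E)); last first.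
  by move=> n _; case: ifP.
rewrite sumEFin lee_fin.
have := record_count_le N w t0 e0; rewrite le_min => /andP[_ H].
have -> : (t / e + 1 = (t + e) / e)%R by field; rewrite gt_eqF.
by rewrite ler_pdivlMr// mulrC.
Qed.

End reversal.

(** * Zero drift: overshooting is certain *)

Section zero_drift.
Local Open Scope ereal_scope.
Context (R : realType) (mu : probability R R).
Local Notation stay := (stay_op mu).
Local Notation leb := (@lebesgue_measure R).
Local Notation beta := (\int[mu]_b (Num.max b 0)%:E).
Hypothesis beta_gt0 : 0 < beta.
Hypothesis beta_fin : beta < +oo.
Hypothesis zero_mean : \int[mu]_b (Num.max (- b) 0)%:E = beta.

Let nonneg1 : nonneg_measurable (cst 1 : R -> \bar R).
Proof. by apply: nonneg_measurable_cst; rewrite lee01. Qed.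

(** The probability that the walk from [x] never crosses 0. It is nondecreasing in [x] and harmonic
    for the killed walk; the section shows that it vanishes. *)
Definition stay_forever (x : R) := limn (fun n => iter n stay (cst 1) x).
Local Notation r := stay_forever.
Local Notation rr := (on_nonneg stay_forever).

Let stay1_decr n x : iter n.+1 stay (cst 1) x <= iter n stay (cst 1) x.
Proof.
elim: n x => [|n IH] x; first exact: stay_op1_le1.
apply: le_stay_op => [||z z0]; [exact: (nonneg_measurable_stay_iter _ n.+1)|exact: nonneg_measurable_stay_iter|exact: IH].
Qed.

Let stay1_le1 n x : iter n stay (cst 1) x <= 1.
Proof. by elim: n => //= n IH; apply: le_trans IH; exact: stay1_decr. Qed.

Let stay_cvg x : (fun n => iter n stay (cst 1) x) @ \oo --> r x.
Proof.
apply: ereal_nonincreasing_is_cvgn; apply/nonincreasing_seqP => n.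
exact: stay1_decr.
Qed.

Let r_ge0 x : 0 <= r x.
Proof.
apply: lime_ge; first exact/cvgP/stay_cvg.
by apply: nearW => n; exact: stay_iter_ge0.
Qed.

Let r_le1 x : r x <= 1.
Proof.
apply: lime_le; first exact/cvgP/stay_cvg.
by apply: nearW => n; exact: stay1_le1.
Qed.

Let r_nondecreasing (x y : R) : (x <= y)%R -> r x <= r y.
Proof.
move=> xy; apply: lee_lim; [exact/cvgP/stay_cvg..|].
by apply: nearW => n; exact: stay_iter1_nondecreasing.
Qed.

Let nr : nonneg_measurable r.
Proof.
split; last exact: r_ge0.
apply: (emeasurable_fun_cvg (fun n => iter n stay (cst 1))) => [n|x _].
  by case: (nonneg_measurable_stay_iter mu n nonneg1).
exact: stay_cvg.
Qed.

Let nrr : nonneg_measurable rr. Proof. exact: nonneg_measurable_on_nonneg. Qed.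

Let rr_le1 x : rr x <= 1.
Proof. by rewrite /on_nonneg; case: ifP. Qed.

Let rr_nondecreasing (x y : R) : (x <= y)%R -> rr x <= rr y.
Proof.
move=> xy; rewrite /on_nonneg; case: ifPn => x0; last by case: ifP.
by rewrite (le_trans x0 xy) r_nondecreasing.
Qed.

Let r_harmonic x : r x = \int[mu]_b rr (x - b)%R.
Proof.
have nS n := nonneg_measurable_section x
  (nonneg_measurable_on_nonneg (nonneg_measurable_stay_iter mu n nonneg1)).
have [_ _ cf] : [/\ mu.-integrable setT (fun b => rr (x - b)%R),
    [sequence \int[mu]_b `|on_nonneg (iter n stay (cst 1)) (x - b)%R - rr (x - b)%R| ]_n @ \oo --> 0 &
    [sequence \int[mu]_b on_nonneg (iter n stay (cst 1)) (x - b)%R ]_n @ \oo --> \int[mu]_b rr (x - b)%R].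
  apply: (@dominated_convergence _ _ _ mu setT measurableT
    (fun n b => on_nonneg (iter n stay (cst 1)) (x - b)%R) (fun b => rr (x - b)%R) (cst 1)).
  - by move=> n; case: (nS n).
  - by case: (nonneg_measurable_section x nrr).
  - apply: aeW => b _; rewrite /on_nonneg; have [_|_] := leP 0%R (x - b)%R.
      exact: stay_cvg.
    exact: cvg_cst.
  - apply/integrableP; split; first exact: measurable_cst.
    under eq_integral do rewrite abse1.
    by rewrite integral_cst//= probability_setT mule1 ltry.
  - apply: aeW => b n _; rewrite gee0_abs; last by case: (nS n).
    by rewrite /on_nonneg; case: ifP.
have c2 : (fun n => iter n.+1 stay (cst 1) x) @ \oo --> r x.
  by rewrite (cvg_shiftS (fun n => iter n stay (cst 1) x)).
exact: (cvg_unique _ c2 cf).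
Qed.

Let integral_itv_cst (a b : R) (k : \bar R) : (a <= b)%R -> 0 <= k ->
  \int[leb]_z (if (a <= z)%R && (z < b)%R then k else 0) = k * (b - a)%:E.
Proof.
move=> ab k0; transitivity (\int[leb]_(z in `[a, b[) k).
  rewrite [RHS]integral_mkcond; apply: eq_integral => z _.
  by rewrite /patch mem_setE in_itv/=.
rewrite integral_cst//= lebesgue_measure_itv/= lte_fin -EFinD.
by case: ltP => // ba; have -> : b = a by [apply/le_anti; rewrite ba ab]; rewrite subrr.
Qed.

(** [J A b] is the integral of [rr (x - b)] over [[0, A[] after the substitution [x = z + b], so the
    window becomes [[- b, A - b[]. *)
Let Phi (A : R) : \bar R := \int[leb]_x (if (0 <= x)%R && (x < A)%R then rr x else 0).
Let J (A b : R) : \bar R := \int[leb]_z (if (0 <= z + b)%R && (z + b < A)%R then rr z else 0).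

Let nPhi (A b : R) : nonneg_measurable
  (fun z : R => if (0 <= z + b)%R && (z + b < A)%R then rr z else 0).
Proof.
apply: nonneg_measurable_if => //.
apply: measurable_and; first by apply: measurable_fun_ler => //; exact: measurable_funD.
by apply: measurable_fun_ltr => //; exact: measurable_funD.
Qed.

Let nitv (a b : R) (k : \bar R) : 0 <= k -> nonneg_measurable
  (fun z : R => if (a <= z)%R && (z < b)%R then k else 0).
Proof.
move=> k0; apply: nonneg_measurable_if.
- by apply: measurable_and; [exact: measurable_fun_ler|exact: measurable_fun_ltr].
- exact: nonneg_measurable_cst.
- exact: nonneg_measurable_cst.
Qed.

Let nPhi0 (A : R) : nonneg_measurable
  (fun z : R => if (0 <= z)%R && (z < A)%R then rr z else 0).
Proof.
apply: nonneg_measurable_if => //.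
by apply: measurable_and; [exact: measurable_fun_ler|exact: measurable_fun_ltr].
Qed.

Let le_leb (f g : R -> \bar R) : nonneg_measurable f -> nonneg_measurable g ->
  (forall x, f x <= g x) -> \int[leb]_x f x <= \int[leb]_x g x.
Proof. by move=> [mf f0] [mg g0] fg; exact: ge0_le_integral. Qed.

Let leb_D (f g : R -> \bar R) : nonneg_measurable f -> nonneg_measurable g ->
  \int[leb]_x (f \+ g) x = \int[leb]_x f x + \int[leb]_x g x.
Proof. by move=> [mf f0] [mg g0]; exact: ge0_integralD. Qed.

Let Phi_fin (A : R) : (0 <= A)%R -> Phi A \is a fin_num.
Proof.
move=> A0; rewrite ge0_fin_numE; last by apply: integral_ge0 => x _; case: (nPhi0 A).
apply: (@le_lt_trans _ _ (1 * (A - 0)%:E)); last by rewrite mul1e ltry.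
rewrite -integral_itv_cst//; apply: le_leb => [||x]; [exact: nPhi0|exact: nitv|].
by case: ifP.
Qed.

(** [[0, c[] and [[c, A + c[] fill the same interval as [[0, A[] and [[A, A + c[]; [rr] is at least
    [rr 0] on the first and at most [s] on the last. *)
Let J_neg (A c : R) (s : \bar R) : (0 <= A)%R -> (0 <= c)%R ->
  (forall x, rr x <= s) ->
  J A (- c) + rr 0%R * c%:E <= Phi A + s * c%:E.
Proof.
move=> A0 c0 rs; have s0 : 0 <= s by apply: le_trans (rs 0%R); case: nrr.
have -> : rr 0%R * c%:E = \int[leb]_z (if (0 <= z)%R && (z < c)%R then rr 0%R else 0).
  by rewrite integral_itv_cst ?subr0//; case: nrr.
have -> : s * c%:E = \int[leb]_z (if (A <= z)%R && (z < A + c)%R then s else 0).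
  by rewrite integral_itv_cst ?lerDl//; congr (_ * _%:E); ring.
have rr0 : 0 <= rr 0%R by case: nrr.
rewrite -leb_D; [|exact: nPhi|exact: nitv].
rewrite -leb_D; [|exact: nPhi0|exact: nitv].
apply: le_leb => [||z].
- by apply: nonneg_measurableD; [exact: nPhi|exact: nitv].
- by apply: nonneg_measurableD; [exact: nPhi0|exact: nitv].
rewrite subr_ge0 ltrBlDr /=.
have rz : 0 <= rr z by case: nrr.
have [z0|z0] := leP 0%R z; last first.
  rewrite (lt_geF (lt_le_trans z0 c0)) /= add0e.
  by rewrite (lt_geF (lt_le_trans z0 A0)) /= add0e.
have [cz|zc] := leP c z => /=.
  rewrite adde0; have [zA|Az] := ltP z A.
    by rewrite (lt_le_trans zA) ?lerDl//= adde0.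
  by case: ifP => _; rewrite add0e// rs.
rewrite add0e; have [zA|Az] := ltP z A.
  by rewrite adde0 rr_nondecreasing.
by rewrite ifT ?add0e// (lt_le_trans zc)// lerDr.
Qed.

(** The window moves down by [b]. It loses [[2A - b, 2A[], which lies above [A], whence the length
    [2A]; it gains nothing, as [rr] is 0 on negative points. *)
Let J_small (A b : R) : (0 <= b)%R -> (b <= A)%R ->
  J (A + A) b + rr A * b%:E <= Phi (A + A).
Proof.
move=> b0 bA.
have rrA : 0 <= rr A by case: nrr.
have -> : rr A * b%:E = \int[leb]_z (if (A + A - b <= z)%R && (z < A + A)%R then rr A else 0).
  by rewrite integral_itv_cst ?gerBl//; congr (_ * _%:E); ring.
rewrite -leb_D; [|exact: nPhi|exact: nitv].
apply: le_leb => [||z].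
- by apply: nonneg_measurableD; [exact: nPhi|exact: nitv].
- exact: nPhi0.
move=> /=; have rz : 0 <= rr z by case: nrr.
have [z0|z0] := leP 0%R z; last first.
  have -> : rr z = 0 by rewrite /on_nonneg lt_geF.
  have -> : (A + A - b <= z)%R = false by apply/negP; lra.
  by rewrite !if_same adde0 lexx.
rewrite (le_trans b0) ?lerDr//=.
have [H1|H1] := ltP (z + b)%R (A + A)%R.
  have -> : (A + A - b <= z)%R = false by apply/negP; lra.
  have -> : (z < A + A)%R by lra.
  by rewrite adde0 lexx.
have Az : (A + A - b <= z)%R by lra.
have Hz : rr A <= rr z by apply: rr_nondecreasing; lra.
by rewrite add0e Az; case: (z < A + A)%R; [exact: Hz|exact: lexx].
Qed.

Let J_large (A b : R) : (0 <= b)%R -> J A b <= Phi A.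
Proof.
move=> b0; apply: le_leb => [||z]; [exact: nPhi|exact: nPhi0|].
have rz : 0 <= rr z by case: nrr.
have [z0|z0] := leP 0%R z; last first.
  have -> : rr z = 0 by rewrite /on_nonneg lt_geF.
  by case: ifP.
case: ifPn => [/andP[_ H]|_]; last by case: ifP.
by rewrite ifT//; lra.
Qed.

Let PhiE (A : R) : Phi A = \int[mu]_b J A b.
Proof.
pose H (p : R * R) : \bar R := if (0 <= p.1)%R && (p.1 < A)%R then rr (p.1 - p.2)%R else 0.
have nH : nonneg_measurable H.
  apply: nonneg_measurable_if.
  - by apply: measurable_and; [exact: measurable_fun_ler|exact: measurable_fun_ltr].
  - exact: nonneg_measurable_sub.
  - exact: nonneg_measurable_cst.
transitivity (\int[leb]_x \int[mu]_b H (x, b)).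
  apply: eq_integral => x _; rewrite /H/=; case: ifPn => [/andP[x0 _]|_]; last by rewrite integral0.
  by rewrite /on_nonneg x0 r_harmonic.
have [mH H0] := nH.
rewrite (@fubini_tonelli _ _ (measurableTypeR R) R R leb mu H mH H0).
apply: eq_integral => b _.
have nHb : nonneg_measurable (fun x : R => H (x, b)) by apply: (nonneg_measurable_comp nH).
rewrite -(integral_lebesgue_shift b nHb).
by apply: eq_integral => x _; rewrite /H/= addrK.
Qed.

Let nJ (A : R) : nonneg_measurable (J A).
Proof.
pose H (p : R * R) : \bar R := if (0 <= p.1 + p.2)%R && (p.1 + p.2 < A)%R then rr p.1 else 0.
have [mH H0] : nonneg_measurable H.
  apply: nonneg_measurable_if.
  - apply: measurable_and; first by apply: measurable_fun_ler => //; exact: measurable_funD.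
    by apply: measurable_fun_ltr => //; exact: measurable_funD.
  - exact: (nonneg_measurable_comp nrr).
  - exact: nonneg_measurable_cst.
split; last by move=> b; apply: integral_ge0 => z _; exact: (H0 (z, b)).
exact: (@measurable_fun_fubini_tonelli_G _ _ (measurableTypeR R) R R leb H mH H0).
Qed.

Let truncated_mean (n : nat) : \bar R := \int[mu]_b (if (0 <= b)%R && (b <= n%:R)%R then b%:E else 0).

Let ntr n : nonneg_measurable (fun b : R => if (0 <= b)%R && (b <= n%:R)%R then b%:E else 0).
Proof.
split.
  apply: measurable_fun_ifT; [|exact/measurable_EFinP|exact: measurable_cst].
  by apply: measurable_and; exact: measurable_fun_ler.
by move=> b; case: ifP => // /andP[b0 _]; rewrite lee_fin.
Qed.

Let truncated_mean_cvg : truncated_mean @ \oo --> beta.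
Proof.
pose g n (b : R) : \bar R := if (0 <= b)%R && (b <= n%:R)%R then b%:E else 0.
have limg b : limn (g ^~ b) = (Num.max b 0)%:E.
  apply/cvg_lim => //; apply: cvg_near_cst.
  exists (Num.truncn b).+1 => // n /= bn; rewrite /g.
  have bn' : (b <= n%:R)%R by apply: le_trans (ltW (truncnS_gt _)) _; rewrite ler_nat.
  by rewrite bn' andbT; case: (leP 0%R b).
have -> : beta = \int[mu]_b limn (g ^~ b) by apply: eq_integral => b _; rewrite limg.
apply: cvg_monotone_convergence => //.
- by move=> n; case: (ntr n).
- by move=> n b _; case: (ntr n).
- move=> b _ n m nm; rewrite /g; case: ifPn => [/andP[b0 bn]|_].
    by rewrite b0 (le_trans bn) ?ler_nat.
  by case: (ntr m).
Qed.

Let nneg : nonneg_measurable (fun b : R => (Num.max (- b) 0)%:E).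
Proof.
split; last by move=> b; rewrite lee_fin le_max lexx orbT.
by apply/measurable_EFinP; apply: measurable_maxr.
Qed.

(* Integrate the identity [r x = E (rr (x - B))] over [0 <= x < 2 n]: only the
   boundary terms near [0] and near [2 n] survive. *)
Let balance n (s : \bar R) : (forall x, rr x <= s) -> s \is a fin_num ->
  rr 0%R * beta + rr n%:R * truncated_mean n <= s * beta.
Proof.
move=> rs sfin; pose A : R := n%:R.
have A0 : (0 <= A)%R by [].
have AA0 : (0 <= A + A)%R by rewrite addr_ge0.
have s0 : 0 <= s by apply: le_trans (rs 0%R); case: nrr.
have rr0 : 0 <= rr 0%R by case: nrr.
have rrA : 0 <= rr A by case: nrr.
(* [Phi] over a bounded window is finite, so adding it to both sides gives an equivalent
   inequality. *)
rewrite -(leeD2lE _ _ (Phi_fin AA0)).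
rewrite {1}PhiE -zero_mean.
have [mj j0] := nJ (A + A); have [mn n0] := nneg; have [mtr tr0] := ntr n.
have -> : s * \int[mu]_b (Num.max (- b) 0)%:E = \int[mu]_b (s * (Num.max (- b) 0)%:E).
  by rewrite ge0_integralZl.
have -> : rr 0%R * \int[mu]_b (Num.max (- b) 0)%:E = \int[mu]_b (rr 0%R * (Num.max (- b) 0)%:E).
  by rewrite ge0_integralZl.
have -> : rr n%:R * truncated_mean n =
    \int[mu]_b (rr A * (if (0 <= b)%R && (b <= A)%R then b%:E else 0)).
  by rewrite ge0_integralZl.
have m1 : measurable_fun setT (fun b : R => s * (Num.max (- b) 0)%:E).
  exact: measurable_funeM.
have m2 : measurable_fun setT (fun b : R => rr 0%R * (Num.max (- b) 0)%:E).
  exact: measurable_funeM.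
have m3 : measurable_fun setT
    (fun b : R => rr A * (if (0 <= b)%R && (b <= A)%R then b%:E else 0)).
  exact: measurable_funeM.
have p1 b : 0 <= s * (Num.max (- b) 0)%:E by rewrite mule_ge0.
have p2 b : 0 <= rr 0%R * (Num.max (- b) 0)%:E by rewrite mule_ge0.
have p3 b : 0 <= rr A * (if (0 <= b)%R && (b <= A)%R then b%:E else 0).
  by rewrite mule_ge0.
have p23 b : 0 <= rr 0%R * (Num.max (- b) 0)%:E +
    rr A * (if (0 <= b)%R && (b <= A)%R then b%:E else 0) by rewrite adde_ge0.
have m23 := emeasurable_funD m2 m3.
have pP : 0 <= Phi (A + A).
  by apply: integral_ge0 => x _; case: (nPhi0 (A + A)).
have <- := ge0_integralD mu measurableT (fun b _ => p2 b) m2 (fun b _ => p3 b) m3.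
have <- := ge0_integralD mu measurableT (fun b _ => j0 b) mj (fun b _ => p23 b) m23.
have -> : Phi (A + A) + \int[mu]_b (s * (Num.max (- b) 0)%:E) =
    \int[mu]_b (Phi (A + A) + s * (Num.max (- b) 0)%:E).
  by rewrite ge0_integralD// integral_cst//= probability_setT mule1.
apply: ge0_le_integral => //.
- by move=> b _; apply: adde_ge0.
- exact: emeasurable_funD.
- exact: emeasurable_funD.
move=> b _; have [b0|b0] := leP 0%R b; last first.
  have -> : Num.max (- b)%R 0%R = (- b)%R by apply/max_idPl; rewrite oppr_ge0 ltW.
  rewrite mule0 adde0 -{1}(opprK b); apply: J_neg => //.
  by rewrite oppr_ge0 ltW.
have -> : Num.max (- b)%R 0%R = 0%R by apply/max_idPr; rewrite oppr_le0.
rewrite !mule0 add0e adde0; case: ifPn => [/= bA|_]; first exact: J_small.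
by rewrite mule0 adde0; exact: J_large.
Qed.

(** Let [n] tend to infinity in [balance], with [s] the supremum of [rr]: what is left is
    [rr 0 * beta + s * beta <= s * beta], where [beta] is finite and positive. *)
Let rr0 : rr 0%R = 0.
Proof.
pose u n := rr (n%:R : R).
have uc : u @ \oo --> limn u.
  apply: ereal_nondecreasing_is_cvgn => n m nm.
  by apply: rr_nondecreasing; rewrite ler_nat.
set s := limn u in uc.
have u0 n : 0 <= u n by exact: (proj2 nrr).
have rs x : rr x <= s.
  apply: (@le_trans _ _ (u (Num.truncn x).+1)).
    by apply: rr_nondecreasing; rewrite ltW// truncnS_gt.
  apply: lime_ge; first exact/cvgP/uc.
  exists (Num.truncn x).+1 => // n /= xn.
  by apply: rr_nondecreasing; rewrite ler_nat.
have s1 : s <= 1.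
  by apply: lime_le; [exact/cvgP/uc|apply: nearW => n; exact: rr_le1].
have sfin : s \is a fin_num.
  by rewrite ge0_fin_numE ?(le_lt_trans s1) ?ltry// (le_trans (u0 0%N)) ?rs.
have bfin : beta \is a fin_num by rewrite ge0_fin_numE// ltW.
have rfin : rr 0%R \is a fin_num.
  by rewrite ge0_fin_numE ?(le_lt_trans (rr_le1 0%R)) ?ltry//; case: nrr.
have c : (fun n => rr 0%R * beta + u n * truncated_mean n) @ \oo --> rr 0%R * beta + s * beta.
  apply: cvgeD => //; last 2 first.
  - exact: cvg_cst.
  - apply: cvgeM => //; exact: mule_def_fin.
  by rewrite fin_num_adde_defr// fin_numM.
have : rr 0%R * beta + s * beta <= s * beta.
  rewrite -(cvg_lim _ c)//; apply: lime_le; first exact/cvgP/c.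
  by apply: nearW => n; exact: balance.
rewrite -[leRHS]add0e leeD2rE ?fin_numM// => H.
apply/eqP; rewrite eq_le; apply/andP; split; last by case: nrr.
by rewrite -(@lee_pmul2r _ beta)// mul0e.
Qed.

(** Vanishing at 0 propagates upwards by harmonicity: increments below [- eps] have positive
    probability, so [rr] vanishes at [n.+1 * eps] if it does at [n * eps]. Monotonicity covers the
    points between. *)
Lemma zero_drift_stay0 (eps : R) : (0 < eps)%R ->
  0 < mu `]-oo, (- eps)%R[%classic ->
  forall L e : R, (0 <= L)%R -> (0 < e)%R ->
  exists N, iter N stay (cst 1) L <= e%:E.
Proof.
move=> eps0 p0 L e L0 e0.
have step n : rr (n%:R * eps)%R = 0.
  elim: n => [|n IH]; first by rewrite mul0r rr0.
  apply/eqP; rewrite eq_le; apply/andP; split; last by case: nrr.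
  have ne0 : (0 <= n%:R * eps)%R by rewrite mulr_ge0// ltW.
  have [ms s0] := nonneg_measurable_section (n%:R * eps)%R nrr.
  have : \int[mu]_b rr (n%:R * eps - b)%R = 0.
    by rewrite -r_harmonic -IH /on_nonneg ne0.
  move=> H0; rewrite -(@lee_pmul2r _ (mu `]-oo, (- eps)%R[%classic))//; last first.
    by rewrite fin_num_measure.
  rewrite mul0e -H0 -integral_cst//.
  apply: (@le_trans _ _ (\int[mu]_(b in `]-oo, (- eps)%R[) rr (n%:R * eps - b)%R)).
    apply: ge0_le_integral => //.
    - by move=> b _; exact: (proj2 nrr).
    - exact: measurable_funTS.
    - move=> b /=; rewrite in_itv/= => be; apply: rr_nondecreasing.
      by rewrite -natr1 mulrDl mul1r; lra.
  by apply: ge0_subset_integral => //.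
have rL : r L = 0.
  apply/eqP; rewrite eq_le r_ge0 andbT.
  rewrite -(step (Num.truncn (L / eps)).+1).
  have -> : r L = rr L by rewrite /on_nonneg L0.
  apply: rr_nondecreasing; rewrite -ler_pdivrMr//.
  exact/ltW/truncnS_gt.
have : nbhs (r L) [set u | u < e%:E].
  by rewrite rL; apply: open_ereal_lt'; rewrite lte_fin.
move=> /(@stay_cvg L)[n _ /(_ n (leqnn n)) /= /ltW hn].
by exists n.
Qed.

End zero_drift.

(** * The walk does not tend to infinity *)

Lemma reflected_walk_contraction (T : Type) (R : realType) (B : nat -> T -> R)
    (x y : R) n w :
  (`|reflected_walk B x n w - reflected_walk B y n w| <= `|x - y|)%R.
Proof.
elim: n => //= n IH; apply: le_trans IH.
by apply: le_trans (ler_dist_dist _ _) _; rewrite opprB addrA subrK.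
Qed.

Lemma reflected_walk_ge0 (T : Type) (R : realType) (B : nat -> T -> R)
    (x : R) n w : (0 <= x)%R -> (0 <= reflected_walk B x n w)%R.
Proof. by case: n => //= n _; exact: normr_ge0. Qed.

Section non_transience.
Local Open Scope ereal_scope.
Context d (T : measurableType d) (R : realType) (P : probability T R).
Context (B : nat -> {RV P >-> R}) (mu : probability R R).
Hypothesis iid : iid_with_law B mu.
Local Notation X := (reflected_walk (fun n w => B n w)).
Variable eta : {finite_measure set R -> \bar R}.
Hypothesis eta_le1 : eta setT <= 1.
Hypothesis etaE : forall g : R -> \bar R, nonneg_measurable g ->
  \int[eta]_h (if (0 < h)%R then g h else 0) = green mu (jump_op mu g).
Local Notation stay := (stay_op mu).
Local Notation rho := (rho mu eta).
Local Notation above K := (fun z : R => if (K < z)%R then 1 else 0 : \bar R).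
Local Notation below L := (fun z : R => if (z <= L)%R then 1 else 0 : \bar R).
Local Notation leb := (@lebesgue_measure R).

Hypothesis rho1 : rho (cst 1) < +oo.
Hypothesis stay0 : forall (L e : R), (0 <= L)%R -> (0 < e)%R ->
  exists N, iter N stay (cst 1) L <= e%:E.
Variable p : R.
Hypothesis p0 : (0 < p)%R.
Hypothesis mu_p : 0 < mu `]p, +oo[%classic.

Let nonneg1 : nonneg_measurable (cst 1 : R -> \bar R).
Proof. by apply: nonneg_measurable_cst; rewrite lee01. Qed.

Let nonneg_above (K : R) : nonneg_measurable (above K).
Proof.
by apply: nonneg_measurable_if => //; exact: measurable_fun_ltr.
Qed.

Let nonneg_below (K : R) : nonneg_measurable (below K).
Proof.
by apply: nonneg_measurable_if => //; exact: measurable_fun_ler.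
Qed.

Definition transient_set : set T :=
  \bigcap_(M : nat) \bigcup_k \bigcap_(j in [set j | (k <= j)%N])
    [set w | (M%:R < X 0%R j w)%R].

Let measurable_X x n : measurable_fun setT (X x n).
Proof. exact: (adapted_measurable (@adapted_reflected_walk _ _ _ _ B x n)). Qed.

Let measurable_above x j (c : R) : measurable [set w | (c < X x j w)%R].
Proof.
have mf : measurable_fun setT (fun w => c < X x j w)%R by exact: measurable_fun_ltr.
by rewrite -[X in measurable X]setTI; exact: (mf measurableT [set true]).
Qed.

Lemma measurable_transient_set : measurable transient_set.
Proof.
apply: bigcap_measurableType => M _; apply: bigcup_measurable => k _.
by apply: bigcap_measurableType => j _; exact: measurable_above.
Qed.

Lemma escape_probability x (K : R) k n :
  P (\bigcap_(j in [set j | (k <= j)%N]) [set w | (K < X x j w)%R]) <=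
  escape mu K k n x.
Proof.
rewrite -[leRHS](probability_stay_above iid x k n K nonneg1).
have mE : measurable (\bigcap_(j in [set j | (k <= j)%N]) [set w | (K < X x j w)%R]).
  by apply: bigcap_measurableType => j _; exact: measurable_above.
rewrite -[leLHS]mul1e -integral_cst// integral_mkcond.
have mb m : measurable_fun setT (fun w => \big[andb/true]_(j < m) (K < X x (k + j) w)%R).
  elim: m => [|m IHm].
    rewrite (_ : (fun _ => _) = cst true); first exact: measurable_cst.
    by apply/funext => w; rewrite big_ord0.
  rewrite (_ : (fun _ => _) = fun w =>
    (\big[andb/true]_(j < m) (K < X x (k + j) w)%R) && (K < X x (k + m) w)%R); last first.
    by apply/funext => w; rewrite big_ord_recr.
  by apply: measurable_and => //; exact: measurable_fun_ltr.
apply: ge0_le_integral => //.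
- by move=> w _; rewrite /patch; case: ifP => _ //; rewrite lee01.
- by apply/(measurable_restrictT _ _).1 => //; exact: measurable_cst.
- exact: measurable_fun_ifT.
move=> w _; rewrite /patch; case: ifPn => [/set_mem wE|_]; last by case: ifP.
rewrite ifT//; elim: n => [|n IH]; first by rewrite big_ord0.
by rewrite big_ord_recr/= IH; apply: wE; rewrite /= leq_addr.
Qed.

(** The first step alone overshoots by more than [p / 2] with positive probability, so the tail is
    bounded below on []0, p / 2[]. *)
Lemma rho1_gt0 : 0 < rho (cst 1).
Proof.
rewrite (tail_rho1 etaE).
pose t := eta `](p / 2)%R, +oo[%classic.
have tp : 0 < t.
  apply: (@lt_le_trans _ _ (mu `]p, +oo[%classic)) => //.
  rewrite /t (overshoot_tailE etaE); last by rewrite divr_ge0// ltW.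
  have nh : nonneg_measurable (fun y : R => \int[mu]_b (if (p / 2 + y < b)%R then 1 else 0) : \bar R).
    have [mF F0] : nonneg_measurable (fun q : R * R => if (p / 2 + q.1 < q.2)%R then 1 else 0 : \bar R).
      apply: nonneg_measurable_if.
      - by apply: measurable_fun_ltr => //; exact: measurable_funD.
      - by apply: nonneg_measurable_cst; rewrite lee01.
      - exact: nonneg_measurable_cst.
    split; first exact: (measurable_fun_fubini_tonelli_F _ mF F0).
    by move=> y; apply: integral_ge0 => b _; case: ifP.
  rewrite green_rec//; apply: (@le_trans _ _ (\int[mu]_b (if (p / 2 + 0 < b)%R then 1 else 0))); last first.
    by rewrite leeDl// green_ge0//; exact: nonneg_measurable_stay_op.
  have -> : \int[mu]_b (if (p / 2 + 0 < b)%R then 1 else 0) = mu `](p / 2)%R, +oo[%classic.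
    rewrite -[RHS]mul1e -integral_cst// [RHS]integral_mkcond; apply: eq_integral => b _.
    by rewrite /patch mem_setE in_itv/= andbT addr0.
  apply: le_measure; rewrite ?inE//.
  by move=> z /=; rewrite !in_itv/= !andbT => zp; have := p0; lra.
have tfin : t \is a fin_num by exact: fin_num_measure.
have tt : 0 < t * t * (p / 2)%:E.
  by rewrite !mule_gt0// lte_fin divr_gt0.
apply: (lt_le_trans tt).
have -> : t * t * (p / 2)%:E = \int[leb]_(x in `]0%R, (p / 2)%R[) (t * t).
  rewrite integral_cst//= lebesgue_measure_itv/= lte_fin divr_gt0//.
  by rewrite -EFinD subr0.
rewrite integral_mkcond.
have nt := @nonneg_measurable_tail _ eta.
have [mt t0] := nt.
apply: ge0_le_integral => //.
- by move=> x _; rewrite /patch; case: ifP => // _; rewrite mule_ge0// ltW.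
- by apply/(measurable_restrictT _ _).1 => //; exact: measurable_cst.
- apply: (measurable_fun_ifT (T1 := measurableTypeR R)).
  + exact: (@measurable_fun_ltr _ R).
  + exact: (@emeasurable_funM _ R).
  + exact: measurable_cst.
move=> x _; rewrite /patch mem_setE in_itv/=.
case: ifPn => [/andP[x0 xp]|_]; last by case: ifP => // _; rewrite mule_ge0.
rewrite x0; have tx : t <= eta `]x, +oo[%classic.
  apply: le_measure; rewrite ?inE//.
  by move=> z /=; rewrite !in_itv/= !andbT; exact: lt_trans.
by apply: lee_pmul => //; exact: ltW.
Qed.

(** If the walk from 0 escaped with probability [c], then by contraction it would stay above [K]
    from some time on with probability at least [c / 2] from every point of [[0, L]], a set carrying
    half of the flux. So [rho (escape mu K k n)] would be at least [c * mtot / 4] for every [n]. *)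
Lemma transient_set_null : P transient_set = 0.
Proof.
have mE := measurable_transient_set.
apply/eqP; rewrite eq_le measure_ge0 andbT leNgt; apply/negP => E0.
have Efin : P transient_set \is a fin_num by exact: fin_num_measure.
pose c := fine (P transient_set).
have c0 : (0 < c)%R by rewrite -lte_fin fineK.
have rho_above e e0 := rho_above_small etaE (e := e) rho1 e0.
have [mtot mtot0] : exists2 m : R, (0 < m)%R & rho (cst 1) = m%:E.
  exists (fine (rho (cst 1))); last by rewrite fineK// ge0_fin_numE// ltW// rho1_gt0.
  by rewrite -lte_fin fineK ?rho1_gt0// ge0_fin_numE// ltW// rho1_gt0.
move=> rho1E.
have m20 : (0 < mtot / 2)%R by rewrite divr_gt0.
have [L L0 hL] := rho_above _ m20.
have below_ge : (mtot / 2)%:E <= rho (below L).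
  have H : rho (cst 1) = rho (below L) + rho (above L).
    have <- := rhoD iid eta (nonneg_below L) (nonneg_above L).
    congr (rho _); apply/funext => z /=.
    by have [zL|Lz] := leP z L; rewrite ?adde0 ?add0e.
  have : mtot%:E <= rho (below L) + (mtot / 2)%:E by rewrite -rho1E H leeD2l.
  by rewrite -leeBlDr// -EFinB; apply: le_trans; rewrite lee_fin; lra.
(* [2 * e] is half of the lower bound [c * mtot / 4]: one [e] for the flux above [K], one for the
   error of [rho_escape_small]. *)
pose e := (c * mtot / 16)%R.
have e0 : (0 < e)%R by rewrite divr_gt0// mulr_gt0.
have [K K0 hK] := rho_above _ e0.
(* A walk from [[0, L]] remains within [L] of the walk from 0, hence above [K] while the latter is
   above [M]. *)
pose M := (Num.truncn (K + L)).+1.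
pose Ek k := \bigcap_(j in [set j | (k <= j)%N]) [set w | (M%:R < X 0%R j w)%R].
have mEk k : measurable (Ek k).
  by apply: bigcap_measurableType => j _; exact: measurable_above.
have [k hk] : exists k, (c / 2)%:E < P (Ek k).
  have : P \o Ek @ \oo --> P (\bigcup_k Ek k).
    apply: nondecreasing_cvg_mu => //; first exact: bigcupT_measurable.
    move=> a b ab; apply/subsetPset => w Ew j /= bj.
    by apply: Ew; rewrite /= (leq_trans ab).
  have : (c / 2)%:E < P (\bigcup_k Ek k).
    apply: (@lt_le_trans _ _ (P transient_set)).
      by rewrite -(fineK Efin) lte_fin -/c; lra.
    apply: le_measure; rewrite ?inE//; first exact: bigcupT_measurable.
    by move=> w /(_ M I).
  move=> /open_ereal_gt' H /(_ _ H)[k _ /(_ k (leqnn k)) /= hk].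
  by exists k.
have [n hn] := rho_escape_small iid eta_le1 etaE rho1 stay0
  (fun e e0 => rho_above_small etaE (e := e) rho1 e0) K k e0.
have lower : (c / 2)%:E * rho (below L) <= rho (escape mu K k n).
  have c20 : (0 <= c / 2)%R by rewrite divr_ge0// ltW.
  have <- := rhoZ iid eta c20 (nonneg_below L).
  apply: (le_rho iid).
  - have nc : nonneg_measurable (cst (c / 2)%:E : R -> \bar R).
      by apply: nonneg_measurable_cst; rewrite lee_fin.
    exact: (nonneg_measurableM nc (nonneg_below L)).
  - exact: nonneg_measurable_escape.
  move=> z z0; case: ifPn => zL; last first.
    by rewrite mule0; case: (nonneg_measurable_escape mu K k n).
  rewrite mule1; apply: le_trans (escape_probability z K k n).
  apply: (le_trans (ltW hk)); apply: le_measure; rewrite ?inE//.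
    by apply: bigcap_measurableType => j _; exact: measurable_above.
  move=> w Ew j kj; have /= := Ew j kj.
  have := reflected_walk_contraction (fun n w => B n w) z 0%R j w.
  have := truncnS_gt (K + L)%R; rewrite -/M subr0 (ger0_norm z0) => H1 H2 H3.
  by move: H2; rewrite ler_norml => /andP[H2 _]; lra.
have : (c / 2 * (mtot / 2))%:E <= (e + e)%:E.
  rewrite EFinM EFinD.
  apply: (@le_trans _ _ ((c / 2)%:E * rho (below L))).
    have c2 : 0 <= (c / 2)%:E by rewrite lee_fin divr_ge0// ltW.
    exact: (lee_wpmul2l c2 below_ge).
  by apply: (le_trans lower); apply: (le_trans hn); exact: (leeD hK (lexx _)).
rewrite lee_fin /e => H.
have : (0 < c * mtot)%R by rewrite mulr_gt0.
by lra.
Qed.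

End non_transience.

(** * Visits *)

Definition infinitely_often (Q : nat -> Prop) :=
  forall m, exists2 n, (m <= n)%N & Q n.

Section visits.
Context d (T : measurableType d) (R : realType) (P : probability T R).
Context (B : nat -> {RV P >-> R}) (mu : probability R R).
Hypothesis iid : iid_with_law B mu.
Variable x : R.
Local Notation X := (reflected_walk (fun n w => B n w) x).

Section supermartingale.
Variables (V A : set R).
Hypotheses (mV : measurable V) (mA : measurable A) (A0 : (0 < mu A)%E).
Variable m : nat.
Local Notation t := (1 + fine (mu A)).

Let factor (k : nat) (y b : R) : R :=
  if (m <= k)%N && (y \in V) then if b \in A then 0 else t else 1.

(* A supermartingale multiplied by [1 + mu A > 1] at each visit to [V] after
   time [m], until one of them is followed by an increment in [A]; this sends it
   to [0]. *)
Fixpoint visit_weight n w : R :=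
  if n is k.+1 then visit_weight k w * factor k (X k w) (B k w) else 1.

Let A0' : 0 < fine (mu A).
Proof. by rewrite -lte_fin fineK// fin_num_measure. Qed.

Let t1 : 1 < t. Proof. by rewrite ltrDl. Qed.

Let factor_ge0 k y b : 0 <= factor k y b.
Proof.
rewrite /factor; case: ifP => // _; case: ifP => // _.
by rewrite ltW// (lt_trans ltr01).
Qed.

Let weight_ge0 n w : 0 <= visit_weight n w.
Proof. by elim: n => //= n IH; rewrite mulr_ge0. Qed.

Let measurable_mem (C : set R) : measurable C -> measurable_fun setT (fun z : R => z \in C).
Proof.
move=> mC; apply: (measurable_fun_bool true); rewrite setTI.
rewrite (_ : _ @^-1` _ = C)//; apply/seteqP; split => z /=.
  by move/set_mem.
by move/mem_set.
Qed.

Let measurable_factor k : measurable_fun setT (fun p : R * R => factor k p.1 p.2).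
Proof.
apply: measurable_fun_ifT; last exact: measurable_cst.
  apply: measurable_and; first exact: measurable_cst.
  exact: (measurableT_comp (measurable_mem mV)).
apply: measurable_fun_ifT; [|exact: measurable_cst..].
exact: (measurableT_comp (measurable_mem mA)).
Qed.

Lemma adapted_visit_weight n : adapted B n (visit_weight n).
Proof.
elim: n => [|n IH]; first exact: measurable_cst.
apply: measurable_funM; first exact: (adapted_le (leqnSn n)).
have aXB : adapted B n.+1 (fun w => (X n w, B n w)).
  apply: measurable_fun_pair.
    exact: (adapted_le (leqnSn n) (@adapted_reflected_walk _ _ _ _ B x n)).
  exact: adapted_increment.
exact: (measurableT_comp (measurable_factor n) aXB).
Qed.

(** At a visit the mean is [(1 + a) * (1 - a) = 1 - a ^ 2], where [a = mu A]. *)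
Let integral_factor k y : (\int[mu]_b (factor k y b)%:E <= 1)%E.
Proof.
rewrite /factor; case: (boolP ((m <= k)%N && (y \in V))) => _; last first.
  by rewrite integral_cst//= probability_setT mule1.
have -> : (\int[mu]_b (if b \in A then 0 else t)%:E = t%:E * mu (~` A))%E.
  rewrite -integral_cst//; last exact: measurableC.
  rewrite [RHS]integral_mkcond; apply: eq_integral => b _.
  by rewrite /patch in_setC; case: (b \in A).
rewrite probability_setC// -(fineK (fin_num_measure mu A mA)) -EFinB -EFinM lee_fin.
have : 0 <= fine (mu A) ^+ 2 by exact: sqr_ge0.
by rewrite expr2; lra.
Qed.

Lemma expectation_visit_weight n : (\int[P]_w (visit_weight n w)%:E <= 1)%E.
Proof.
elim: n => [|n IH]; first by have -> := integral_cst P measurableT 1%E; rewrite mul1e probability_le1.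
apply: le_trans IH.
have aZ : adapted B n (fun w => (visit_weight n w, X n w)).
  by apply: measurable_fun_pair; [exact: adapted_visit_weight|exact: adapted_reflected_walk].
pose F (q : (R * R) * R) := (`|q.1.1| * factor n q.1.2 q.2)%:E.
have mF : measurable_fun setT F.
  apply/measurable_EFinP; apply: measurable_funM.
    apply: measurableT_comp; first exact: normr_measurable.
    exact: (measurableT_comp measurable_fst measurable_fst).
  have mp : measurable_fun setT (fun q : (R * R) * R => (q.1.2, q.2)).
    by apply: measurable_fun_pair => //; exact: (measurableT_comp measurable_snd measurable_fst).
  exact: (measurableT_comp (measurable_factor n) mp).
have F0 q : (0 <= F q)%E by rewrite lee_fin mulr_ge0.
have -> : (\int[P]_w (visit_weight n.+1 w)%:E =
    \int[P]_w F ((visit_weight n w, X n w), B n w))%E.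
  by apply: eq_integral => w _; rewrite /F/= ger0_norm.
rewrite (adapted_increment_integral iid aZ mF F0).
have mw : measurable_fun setT (fun w => (visit_weight n w)%:E).
  by apply/measurable_EFinP; exact: (adapted_measurable (@adapted_visit_weight n)).
apply: ge0_le_integral => //.
- by move=> w _; apply: integral_ge0 => b _; exact: F0.
- have := measurable_fun_fubini_tonelli_F (m2 := mu) F mF F0.
  move=> /measurableT_comp; apply; exact: (adapted_measurable aZ).
- move=> w _; rewrite /F/= (ger0_norm (weight_ge0 n w)).
  under eq_integral do rewrite EFinM.
  rewrite ge0_integralZl//; last 2 first.
  + by move=> b _; rewrite lee_fin.
  + by rewrite lee_fin.
  + by rewrite -[leRHS]mule1; apply: lee_wpmul2l; rewrite ?lee_fin.
  + apply/measurable_EFinP.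
    have mp : measurable_fun setT (fun b : R => (X n w, b)).
      by apply: measurable_fun_pair => //; exact: measurable_cst.
    exact: (measurableT_comp (measurable_factor n) mp).
Qed.

(** Without success each visit after time [m] multiplies the weight by [1 + mu A] and nothing lowers
    it; by Bernoulli's inequality it grows at least linearly in the number of visits. *)
Lemma visit_weight_unbounded w :
  infinitely_often (fun n => V (X n w)) ->
  (forall n, (m <= n)%N -> V (X n w) -> ~ A (B n w)) ->
  {homo visit_weight ^~ w : i j / (i <= j)%N >-> i <= j} /\
  forall a, exists n, a <= visit_weight n w.
Proof.
move=> Vio noA.
have fE k : factor k (X k w) (B k w) = if (m <= k)%N && (X k w \in V) then t else 1.
  rewrite /factor; case: ifPn => // /andP[mk /set_mem Vk].
  by rewrite memNset//; exact: noA.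
have f1 k : 1 <= factor k (X k w) (B k w).
  by rewrite fE; case: ifP => // _; exact: ltW.
have mono : {homo visit_weight ^~ w : i j / (i <= j)%N >-> i <= j}.
  apply: homo_leq => // [i j k|i]; first exact: le_trans.
  by rewrite /= ler_peMr.
split => // a.
have ge1 n : 1 <= visit_weight n w by exact: (mono 0%N n).
have grow k : exists n, 1 + k%:R * fine (mu A) <= visit_weight n w.
  elim: k => [|k [n hn]]; first by exists 0%N; rewrite mul0r addr0.
  have [i ni Vi] := Vio (maxn m n).
  have [mi {}ni] : (m <= i)%N /\ (n <= i)%N by apply/andP; rewrite -geq_max.
  exists i.+1; rewrite /= fE mi/= mem_set//.
  have H := le_trans hn (mono _ _ ni).
  have : fine (mu A) <= visit_weight i w * fine (mu A) by rewrite ler_peMl// ltW.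
  rewrite mulrDr mulr1 -natr1 mulrDl mul1r; lra.
have [n hn] := grow (Num.truncn (a / fine (mu A))).+1.
exists n; apply: le_trans hn; rewrite ler_wpDl// -ler_pdivrMr//.
exact/ltW/truncnS_gt.
Qed.

Definition no_success : set T := [set w |
  infinitely_often (fun n => V (X n w)) /\
  forall n, (m <= n)%N -> V (X n w) -> ~ A (B n w)].

Lemma measurable_no_success : measurable no_success.
Proof.
have mX n : measurable_fun setT (X n).
  exact: (adapted_measurable (@adapted_reflected_walk _ _ _ _ B x n)).
have mXV n : measurable (X n @^-1` V) by rewrite -[Y in measurable Y]setTI; exact: mX.
have mBA n : measurable (B n @^-1` A).
  by rewrite -[Y in measurable Y]setTI; exact: (measurable_funPT (B n)).
have -> : no_success = (\bigcap_k \bigcup_(n in [set n | (k <= n)%N]) (X n @^-1` V)) `&`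
    \bigcap_(n in [set n | (m <= n)%N]) ~` (X n @^-1` V `&` B n @^-1` A).
  apply/seteqP; split => w /= [H1 H2]; split.
  - by move=> k _; have [n kn Vn] := H1 k; exists n.
  - by move=> n mn [Vn]; exact: H2.
  - by move=> k; have [n kn Vn] := H1 k I; exists n.
  - by move=> n mn Vn An; exact: (H2 n mn).
apply: measurableI.
  by apply: bigcap_measurableType => k _; exact: bigcup_measurable.
apply: bigcap_measurableType => n _; apply: measurableC.
exact: measurableI.
Qed.

(** Markov's inequality: on this event the weight increases past every [a], while its mean is at
    most 1, so [a * P N <= 1] for all [a > 0]. *)
Lemma no_success_null : P no_success = 0%E.
Proof.
have mN := measurable_no_success; set N := no_success in mN *.
have mw n : measurable_fun setT (visit_weight n).
  exact: (adapted_measurable (@adapted_visit_weight n)).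
have bound (a : R) : 0 < a -> (a%:E * P N <= 1)%E.
  move=> a0.
  pose G n := N `&` [set w | a <= visit_weight n w].
  have mG n : measurable (G n).
    apply: measurableI => //.
    have mf : measurable_fun setT (fun w => a <= visit_weight n w) by exact: measurable_fun_ler.
    by rewrite -[Y in measurable Y]setTI; exact: (mf measurableT [set true]).
  have GN : \bigcup_n G n = N.
    apply/seteqP; split => w; first by move=> [n _ []].
    move=> Nw; have [_ /(_ a)[n hn]] := visit_weight_unbounded Nw.1 Nw.2.
    by exists n.
  have Gc : P \o G @ \oo --> P N.
    rewrite -GN; apply: nondecreasing_cvg_mu => //; first exact: bigcupT_measurable.
    move=> i j ij; apply/subsetPset => w [Nw /= h]; split => //=.
    have [mono _] := visit_weight_unbounded Nw.1 Nw.2.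
    exact: le_trans h (mono _ _ ij).
  rewrite -(cvg_lim _ Gc)//.
  rewrite -limeMl//; last exact/cvgP/Gc.
  apply: lime_le; first by apply: is_cvgeZl => //; exact/cvgP/Gc.
  apply: nearW => n /=.
  apply: le_trans (expectation_visit_weight n).
  rewrite -integral_cst// integral_mkcond; apply: ge0_le_integral => //.
  - by move=> w _; rewrite /patch; case: ifP => // _; rewrite lee_fin ltW.
  - by apply/(measurable_restrictT _ _).1 => //; exact: measurable_cst.
  - exact/measurable_EFinP.
  - move=> w _; rewrite /patch; case: ifPn => [/set_mem[_ /= h]|_]; rewrite lee_fin//.
apply/eqP; rewrite eq_le measure_ge0 andbT leNgt; apply/negP => N0.
have Nfin := fin_num_measure P N mN.
have f0 : 0 < fine (P N) by rewrite -lte_fin fineK.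
have := bound (2 / fine (P N)); rewrite divr_gt0// => /(_ isT).
rewrite -(fineK Nfin) -EFinM lee_fin mulfVK ?gt_eqF//.
by lra.
Qed.

End supermartingale.

Lemma ae_visit_step (V A : set R) : measurable V -> measurable A -> (0 < mu A)%E ->
  {ae P, forall w, infinitely_often (fun n => V (X n w)) ->
    infinitely_often (fun n => V (X n w) /\ A (B n w))}.
Proof.
move=> mV mA A0.
have : {ae P, forall w, forall m, ~ (infinitely_often (fun n => V (X n w)) /\
    forall n, (m <= n)%N -> V (X n w) -> ~ A (B n w))}.
  apply: ae_foralln => m; exists (no_success V A m); split.
  - exact: measurable_no_success.
  - exact: no_success_null.
  - by move=> w /= /contrapT.
apply: filterS => w H Vio m; apply: contrapT => no.
apply: (H m); split => // n mn Vn An; apply: no.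
by exists n.
Qed.

(** Increments near [b] follow infinitely many of the visits, and [z -> |z - b|] is 1-Lipschitz, so
    the errors add up. Each step spends half of the remaining slack [e - e0]. *)
Lemma ae_visit_path (bs : seq R) (y e0 e : R) :
  {in bs, forall b, measure_support mu b} -> e0 < e ->
  {ae P, forall w, infinitely_often (fun n => `|X n w - y| < e0) ->
    infinitely_often (fun n => `|X n w - foldl (fun z b => `|z - b|) y bs| < e)}.
Proof.
elim: bs y e0 => [|b bs IH] y e0 supp ee /=.
  apply: aeW => w H m; have [n mn h] := H m; exists n => //.
  exact: lt_trans h ee.
have sb : measure_support mu b by apply: supp; rewrite mem_head.
pose e1 := (e0 + e) / 2.
have e1e : e1 < e by rewrite /e1; lra.
have e10 : 0 < e1 - e0 by rewrite /e1; lra.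
have supp' : {in bs, forall c, measure_support mu c}.
  by move=> c cb; apply: supp; rewrite in_cons cb orbT.
have {}IH := IH `|y - b| e1 supp' e1e.
pose V := [set z : R | `|z - y| < e0]; pose A := [set c : R | `|c - b| < e1 - e0].
have ballE (c r : R) : [set z : R | `|z - c| < r] = ball c r.
  by apply/seteqP; split => z; rewrite /ball/= distrC.
have mV : measurable V by rewrite /V ballE; exact: measurable_ball.
have mA : measurable A by rewrite /A ballE; exact: measurable_ball.
have A0 : (0 < mu A)%E.
  apply: sb; first by rewrite /A ballE; exact: ball_open.
  by rewrite /A/= subrr normr0.
have step := ae_visit_step mV mA A0.
apply: filterS2 step IH => w H1 H2 H; apply: H2 => m.
have [n mn [Vn An]] := H1 H m.
exists n.+1; first by rewrite ltnW.
rewrite /=; apply: (@le_lt_trans _ _ (`|X n w - y| + `|B n w - b|)).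
  apply: le_trans (ler_dist_dist _ _) _.
  rewrite (_ : X n w - B n w - (y - b) = (X n w - y) - (B n w - b)); last by ring.
  exact: ler_normB.
by move: Vn An; rewrite /V /A/= => Vn An; lra.
Qed.

End visits.

(** * Density of the attainable positions *)

Section closed_semigroups.
Variable R : realType.
Implicit Types D : set R.

Definition approximable D (t : R) :=
  forall e, 0 < e -> exists2 s, D s & `|s - t| < e.

Definition closed_semigroup D :=
  (forall s t, D s -> D t -> D (s + t)) /\ approximable D `<=` D.

Lemma closed_semigroupN D : closed_semigroup D ->
  closed_semigroup [set x | D (- x)].
Proof.
move=> [addD clD]; split => [s t /= Ds Dt|t appt /=].
  by rewrite opprD; exact: addD.
apply: clD => e /appt[s /= Ds st]; exists (- s) => //.
by rewrite -normrN opprD !opprK.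
Qed.

Lemma closed_semigroup_addMn D s t j : closed_semigroup D ->
  D s -> D t -> D (s + t *+ j).
Proof.
move=> [addD _] Ds Dt; elim: j => [|j IH]; first by rewrite mulr0n addr0.
by rewrite mulrSr addrA; exact: addD.
Qed.

(** Multiples of [r] lead below [t], then steps smaller than [e] climb to within [e] of it. *)
Lemma small_positive_dense D r : closed_semigroup D -> r < 0 -> D r ->
  (forall e, 0 < e -> exists2 s, D s & 0 < s < e) -> forall t, D t.
Proof.
move=> sgD r0 Dr small t; apply: sgD.2 => e /small[s Ds /andP[s0 se]].
have r0' : 0 < - r by rewrite oppr_gt0.
pose k := Num.truncn (`|t| / - r).
(* One copy of [r] is kept apart because 0 need not belong to [D]. *)
have kt : r + r *+ k <= t.
  have := truncnS_gt (`|t| / - r); rewrite -/k ltr_pdivrMr// mulrN => h.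
  have : - `|t| <= t by rewrite lerNl -normrN ler_norm.
  move: h; rewrite -[r *+ k]mulr_natl -natr1 mulrDl mul1r; lra.
pose j := Num.truncn ((t - (r + r *+ k)) / s).
have js : s *+ j <= t - (r + r *+ k).
  rewrite -mulr_natl -ler_pdivlMr// -truncn_ge_nat//.
  by rewrite divr_ge0 ?subr_ge0// ltW.
have jS : t - (r + r *+ k) < s *+ j + s.
  by have := truncnS_gt ((t - (r + r *+ k)) / s); rewrite -/j ltr_pdivrMr// mulr_natl mulrSr.
exists (r + r *+ k + s *+ j).
  by apply: closed_semigroup_addMn => //; exact: closed_semigroup_addMn.
by rewrite ler0_norm; lra.
Qed.

(** A gap above 0 keeps the positive elements away from 0, and closedness puts their infimum in
    [D]. *)
Lemma least_positive D s : closed_semigroup D -> 0 < s -> D s ->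
  ~ (forall e, 0 < e -> exists2 s, D s & 0 < s < e) ->
  exists k, [/\ 0 < k, D k & forall s, D s -> 0 < s -> k <= s].
Proof.
move=> sgD s0 Ds /existsNP[e /not_implyP[e0 /forall2NP noe]].
have lbe u : D u -> 0 < u -> e <= u.
  move=> Du u0; have [//|] := noe u.
  by move=> /negP; rewrite u0/= -leNgt.
pose E := [set u | D u /\ 0 < u].
have hE : has_inf E.
  by split; [exists s|exists e => u [Du u0]; exact: lbe].
have einf : e <= inf E.
  by apply: lb_le_inf; [exists s|move=> u [Du u0]; exact: lbe].
exists (inf E); split; first exact: lt_le_trans einf.
  apply: sgD.2 => e' e'0; have [u [Du u0] ue] := inf_adherent e'0 hE.
  exists u => //; have : inf E <= u by apply: (ge_inf hE.2).
  by move=> infu; rewrite ger0_norm; lra.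
by move=> u Du u0; apply: (ge_inf hE.2).
Qed.

(* If the least positive element [k] and the least absolute value [l] of a
   negative one exist, then [k - l] contradicts minimality unless [k = l]. *)
Lemma closed_semigroup_dichotomy D p r : closed_semigroup D ->
  0 < p -> D p -> r < 0 -> D r ->
  (forall t, D t) \/
  exists kappa, 0 < kappa /\ D `<=` [set kappa * k%:~R | k in [set: int]].
Proof.
move=> sgD p0 Dp r0 Dr; have sgN := closed_semigroupN sgD.
have [small|] := pselect (forall e, 0 < e -> exists2 s, D s & 0 < s < e).
  by left; exact: (small_positive_dense sgD r0 Dr small).
move=> /(least_positive sgD p0 Dp)[k [k0 Dk mink]].
have r0' : 0 < - r by rewrite oppr_gt0.
have DNr : [set x | D (- x)] (- r) by rewrite /= opprK.
have p0' : - p < 0 by rewrite oppr_lt0.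
have DNp : [set x | D (- x)] (- p) by rewrite /= opprK.
have [small|] := pselect (forall e, 0 < e -> exists2 s, D (- s) & 0 < s < e).
  left => t; rewrite -[t]opprK.
  exact: (small_positive_dense sgN p0' DNp small).
move=> /(least_positive sgN r0' DNr)[l [l0 Dl minl]].
have kl : k = l.
  apply/eqP; rewrite eq_le; apply/andP; split; rewrite leNgt; apply/negP => kl.
    have := mink (k - l) (sgD.1 _ _ Dk Dl); rewrite subr_gt0 => /(_ kl).
    by move: l0; lra.
  have := minl (l - k); rewrite /= opprB subr_gt0.
  move=> /(_ (sgD.1 _ _ Dk Dl) kl).
  by move: k0; lra.
right; exists k; split=> // t Dt; subst l.
pose j := Num.floor (t / k).
have kj : k * j%:~R <= t by rewrite mulrC -ler_pdivlMr//; exact: floor_le.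
have kj1 : t < k * j%:~R + k.
  by have := floorD1_gt (t / k); rewrite -/j ltr_pdivrMr// intrD mulrDl mul1r [_ * k]mulrC.
(* Both [k] and [- k] belong to [D], so multiples of [k] of either sign may be subtracted; the
   remainder in [[0, k[] is 0 by minimality. *)
have Dj : D (t - k * j%:~R).
  case: (j) => n.
    by rewrite -mulNr mulr_natr; exact: closed_semigroup_addMn.
  rewrite NegzE mulrNz mulrN opprK mulr_natr.
  exact: closed_semigroup_addMn.
exists j => //; apply/eqP; rewrite eq_le kj leNgt; apply/negP => lt.
have := mink _ Dj; rewrite subr_gt0 => /(_ lt); lra.
Qed.

Variable S : set R.

Definition sums := [set s : R | exists2 bs, {in bs, forall b, S b} & s = \sum_(b <- bs) b].

Lemma closed_semigroup_sums : closed_semigroup (approximable sums).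
Proof.
split => [s t As At e e0|t AAt e e0].
  have e2 : 0 < e / 2 by rewrite divr_gt0.
  have [_ [bs Sb ->] h1] := As _ e2; have [_ [cs Sc ->] h2] := At _ e2.
  exists (\sum_(b <- bs ++ cs) b).
    by exists (bs ++ cs) => // b; rewrite mem_cat => /orP[/Sb|/Sc].
  rewrite big_cat/= opprD addrACA; apply: le_lt_trans (ler_normD _ _) _; lra.
have e2 : 0 < e / 2 by rewrite divr_gt0.
have [s As h1] := AAt _ e2; have [u Du h2] := As _ e2.
exists u => //; rewrite -[u](subrK s) -addrA.
apply: le_lt_trans (ler_normD _ _) _; lra.
Qed.

Lemma sub_approximable_sums : S `<=` approximable sums.
Proof.
move=> b Sb e e0; exists b; last by rewrite subrr normr0.
by exists [:: b]; [move=> c; rewrite inE => /eqP ->|rewrite big_seq1].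
Qed.

Lemma foldl_reflect_le0 (y : R) bs : 0 <= y -> {in bs, forall b, b <= 0} ->
  foldl (fun z b => `|z - b|) y bs = y - \sum_(b <- bs) b.
Proof.
elim: bs y => [|b bs IH] y y0 H /=; first by rewrite big_nil subr0.
have b0 : b <= 0 by apply: H; rewrite mem_head.
rewrite IH//; last by move=> c cb; apply: H; rewrite in_cons cb orbT.
by rewrite big_cons ger0_norm ?opprD ?addrA//; lra.
Qed.

Lemma foldl_reflect_ge0 (y : R) bs : {in bs, forall b, 0 <= b} ->
  0 <= y - \sum_(b <- bs) b ->
  foldl (fun z b => `|z - b|) y bs = y - \sum_(b <- bs) b.
Proof.
elim: bs y => [|b bs IH] y H /=; first by rewrite big_nil subr0.
rewrite big_cons opprD addrA => y0.
have H' : {in bs, forall c, 0 <= c}.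
  by move=> c cb; apply: H; rewrite in_cons cb orbT.
have s0 : 0 <= \sum_(c <- bs) c.
  by rewrite big_seq; apply: sumr_ge0 => c; exact: H'.
have yb : `|y - b| = y - b by rewrite ger0_norm; lra.
by rewrite yb IH.
Qed.

(* Negative increments are used first, and the target is approached from
   above, so that no step is reflected. *)
Lemma reflected_path (p r : R) : S p -> 0 < p -> S r -> r < 0 ->
  ~ (exists kappa, 0 < kappa /\ S `<=` [set kappa * k%:~R | k in [set: int]]) ->
  forall y z e, 0 <= y -> 0 <= z -> 0 < e -> exists2 bs,
  {in bs, forall b, S b} & `|foldl (fun z b => `|z - b|) y bs - z| < e.
Proof.
move=> Sp p0 Sr r0 nlat y z e y0 z0 e0.
have [all|[k [k0 latk]]] := closed_semigroup_dichotomy closed_semigroup_sums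
  p0 (sub_approximable_sums Sp) r0 (sub_approximable_sums Sr); last first.
  by exfalso; apply: nlat; exists k; split => // b /sub_approximable_sums/latk.
have e2 : 0 < e / 2 by rewrite divr_gt0.
(* The path aims at [z + e / 2] with error below [e / 2], so its endpoint lies above [z >= 0], as
   [foldl_reflect_ge0] requires. *)
have [_ [bs Sb ->]] := all (y - z - e / 2) _ e2.
pose neg := [seq b <- bs | b < 0]; pose pos := [seq b <- bs | ~~ (b < 0)].
have -> : \sum_(b <- bs) b = \sum_(b <- neg) b + \sum_(b <- pos) b.
  by rewrite !big_filter -(bigID (fun b => b < 0) predT).
move=> close.
have negP : {in neg, forall b, b <= 0}.
  by move=> b; rewrite mem_filter => /andP[/ltW].
have posP : {in pos, forall b, 0 <= b}.
  by move=> b; rewrite mem_filter -leNgt => /andP[].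
exists (neg ++ pos).
  by move=> b; rewrite mem_cat !mem_filter => /orP[|] /andP[_ /Sb].
move: close; rewrite ltr_norml => /andP[c1 c2].
rewrite foldl_cat (foldl_reflect_le0 y0 negP) foldl_reflect_ge0//; last by lra.
by rewrite ltr_norml; apply/andP; split; lra.
Qed.

End closed_semigroups.

(** If [A] missed the support, countably many null intervals with rational endpoints would cover
    it. *)
Lemma open_meets_support (R : realType) (mu : probability R R) (A : set R) :
  open A -> (0 < mu A)%E -> A `&` measure_support mu !=set0.
Proof.
move=> oA muA; apply: contrapT => /set0P/negP; rewrite negbK => /eqP A0.
pose J (pq : rat * rat) : set R := `]ratr pq.1, ratr pq.2[%classic.
pose F n : set R := if choice.unpickle n is Some pq then
  if mu (J pq) == 0%E then J pq else set0 else set0.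
have FN n : mu.-negligible (F n).
  rewrite /F; case: choice.unpickle => [pq|]; last exact: negligible_set0.
  case: ifPn => [/eqP J0|_]; last exact: negligible_set0.
  by apply/negligibleP => //; exact: measurable_itv.
have AF : A `<=` \bigcup_n F n.
  move=> x Ax.
  have : ~ measure_support mu x by move=> Sx; rewrite -[False]/(set0 x) -A0.
  move=> /existsNP[V /not_implyP[oV /not_implyP[Vx /negP]]].
  rewrite -leNgt measure_le0 => /eqP V0.
  have /nbhs_ballP[e /= e0 xV] := open_nbhs_nbhs (conj oV Vx).
  have xe : x - e < x by rewrite ltrBlDr ltrDl.
  have ex : x < x + e by rewrite ltrDl.
  have [p] := rat_in_itvoo xe; rewrite in_itv/= => /andP[p1 p2].
  have [q] := rat_in_itvoo ex; rewrite in_itv/= => /andP[q1 q2].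
  have JV : J (p, q) `<=` V.
    move=> u; rewrite /J/= in_itv/= => /andP[u1 u2]; apply: xV.
    by rewrite /ball/= ltr_norml; apply/andP; split; lra.
  have J0 : mu (J (p, q)) = 0%E.
    apply/eqP; rewrite eq_le measure_ge0 andbT -V0; apply: le_measure => //.
      by rewrite inE; exact: measurable_itv.
    by rewrite inE; exact: open_measurable.
  have Jx : J (p, q) x by rewrite /J/= in_itv/= p2.
  move: (p, q) J0 Jx => pq J0 Jx.
  by exists (choice.pickle pq); [exact: I|rewrite /F choice.pickleK J0 eqxx].
have := negligibleS AF (negligible_bigcup FN).
move=> /(negligibleP _ (open_measurable oA)) mu0.
by rewrite mu0 ltxx in muA.
Qed.

(** * Recurrence *)

Lemma infinitely_often_finite_or (Q : nat -> nat -> Prop) (N : nat) :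
  infinitely_often (fun n => exists2 i, (i < N)%N & Q i n) ->
  exists2 i, (i < N)%N & infinitely_often (Q i).
Proof.
elim: N => [|N IH] io; first by have [n _ [i]] := io 0%N.
have [?|noN] := pselect (infinitely_often (Q N)); first by exists N.
have [m hm] : exists m, forall n, (m <= n)%N -> ~ Q N n.
  apply: contrapT => /forallNP H; apply: noN => m.
  have /existsNP[n /not_implyP[mn /contrapT Qn]] := H m.
  by exists n.
have [k|i iN ioi] := IH.
  have [n kn [i iN Qi]] := io (maxn k m).
  move: kn; rewrite geq_max => /andP[kn mn].
  exists n => //; exists i => //; move: iN; rewrite ltnS leq_eqVlt => /orP[/eqP iN|//].
  by exfalso; apply: (hm n mn); rewrite -iN.
by exists i => //; exact: ltnW.
Qed.

Section recurrence.
Context d (T : measurableType d) (R : realType) (P : probability T R).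
Context (B : nat -> {RV P >-> R}) (mu : probability R R).
Hypothesis iid : iid_with_law B mu.
Local Notation X := (reflected_walk (fun n w => B n w)).

Lemma integral_increment_law n (f : R -> \bar R) : nonneg_measurable f ->
  (\int[P]_w f (B n w) = \int[mu]_b f b)%E.
Proof.
move=> [mf f0]; rewrite -(eq_measure_integral mu (fun A mA _ => iid.2 n A mA)).
by rewrite ge0_integral_distribution.
Qed.

Variables p r : R.
Hypotheses (p0 : 0 < p) (Sp : measure_support mu p).
Hypotheses (r0 : r < 0) (Sr : measure_support mu r).

Lemma measure_gt_half_support : (0 < mu `](p / 2)%R, +oo[%classic)%E.
Proof.
apply: Sp; first exact: interval_open.
by rewrite /= in_itv/= andbT ltr_pdivrMr// ltr_pMr// ltr1n.
Qed.

Lemma measure_lt_half_support : (0 < mu `]-oo, (- (- r / 2))%R[%classic)%E.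
Proof.
apply: Sr; first exact: interval_open.
by rewrite /= in_itv/=; move: r0; lra.
Qed.

Lemma transient_set_null_of_green (kappa : R -> R) :
  measurable_fun setT kappa -> (forall t, 0 <= kappa t) ->
  (forall s t, s <= t -> kappa s <= kappa t) ->
  (forall t, 0 < t ->
    (green mu (fun y => if (y < t)%R then 1 else 0) <= (kappa t)%:E)%E) ->
  (\int[mu]_b (kappa b * Num.sqrt b)%:E < +oo)%E ->
  (forall L e : R, 0 <= L -> 0 < e ->
    exists N, (iter N (stay_op mu) (cst 1%E) L <= e%:E)%E) ->
  P (transient_set B) = 0%E.
Proof.
move=> mk k0 kmono gk kint stay0.
have [eta [eta1 etaE]] := overshoot_measure iid.
have rho1 := rho1_finite iid etaE mk k0 kmono gk kint.
have p20 : 0 < p / 2 by rewrite divr_gt0.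
exact: (transient_set_null iid eta1 etaE rho1 stay0 p20 measure_gt_half_support).
Qed.

Hypothesis null : P (transient_set B) = 0%E.
Hypothesis nonlattice : ~ exists kappa : R, 0 < kappa /\
  measure_support mu `<=` [set kappa * k%:~R | k in [set: int]].

(** Off the transient event a bounded set is visited infinitely often, but its bound depends on the
    path. The pigeonhole principle gives one point of a grid of mesh [e1] approached infinitely
    often, from which [reflected_path] leads to [z]; the grid being countable, all its points are
    treated almost surely at once. *)
Lemma ae_visits (x z e : R) : 0 <= x -> 0 <= z -> 0 < e ->
  {ae P, forall w, infinitely_often (fun n => `|X x n w - z| < e)}.
Proof.
(* The deterministic path ends within [e1] of [z] and the walk comes within [2 * e1] of that
   endpoint, in all less than [e]. *)
move=> x0 z0 e0; pose e1 := e / 4.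
have e10 : 0 < e1 by rewrite divr_gt0.
have hop : {ae P, forall w, forall i : nat,
    infinitely_often (fun n => `|X x n w - i%:R * e1| < e1) ->
    infinitely_often (fun n => `|X x n w - z| < e)}.
  apply: ae_foralln => i.
  have y0 : 0 <= i%:R * e1 by rewrite mulr_ge0// ltW.
  have [bs Sbs close] := reflected_path Sp p0 Sr r0 nonlattice y0 z0 e10.
  have e12 : e1 < 2 * e1 by lra.
  have := ae_visit_path iid x (i%:R * e1) Sbs e12.
  apply: filterS => w H /H io m; have [n mn h] := io m; exists n => //.
  move: h close; set v := foldl _ _ _ => h close.
  rewrite -[X x n w](subrK v) -addrA.
  by apply: le_lt_trans (ler_normD _ _) _; move: h close; rewrite /e1; lra.
have notE : {ae P, forall w, ~ transient_set B w}.
  exists (transient_set B); split => //; first exact: measurable_transient_set.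
  by move=> w /= /contrapT.
apply: filterS2 hop notE => w hop /existsNP[M /not_implyP[_ nE]].
suff [i _ io] : exists2 i, (i < (Num.truncn ((M%:R + x) / e1)).+1)%N &
    infinitely_often (fun n => `|X x n w - i%:R * e1| < e1) by exact: hop io.
apply: infinitely_often_finite_or => k.
have [n kn Xn] : exists2 n, (k <= n)%N & X 0 n w <= M%:R.
  apply: contrapT => no; apply: nE; exists k => // j /= kj.
  by rewrite ltNge; apply/negP => h; apply: no; exists j.
have X0 : 0 <= X x n w by exact: reflected_walk_ge0.
have XM : X x n w <= M%:R + x.
  have := reflected_walk_contraction (fun n w => B n w) x 0 n w.
  by rewrite subr0 (ger0_norm x0) => /(le_trans (ler_norm _)); lra.
exists n => //; exists (Num.truncn (X x n w / e1)).
  by rewrite ltnS; apply: le_truncn; rewrite ler_pM2r ?invr_gt0.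
have lo : (Num.truncn (X x n w / e1))%:R * e1 <= X x n w.
  by rewrite -ler_pdivlMr// -truncn_ge_nat// divr_ge0// ltW.
have hi : X x n w < (Num.truncn (X x n w / e1))%:R * e1 + e1.
  by have := truncnS_gt (X x n w / e1); rewrite -natr1 ltr_pdivrMr// mulrDl mul1r.
by rewrite ger0_norm; lra.
Qed.

Lemma recurrent_of_transient_set_null :
  topologically_recurrent P X (nonneg_reals R).
Proof.
move=> V oV U [z [[Vz z0] _]] x x0.
have /nbhs_ballP[e /= e0 zV] := open_nbhs_nbhs (conj oV Vz).
have mU : measurable U.
  apply: measurableI; first exact: open_measurable.
  rewrite (_ : nonneg_reals R = `[0, +oo[%classic); first exact: measurable_itv.
  by apply/seteqP; split => t; rewrite /nonneg_reals/= in_itv/= andbT.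
have mXU n : measurable (X x n @^-1` U).
  rewrite -[Y in measurable Y]setTI.
  exact: (adapted_measurable (@adapted_reflected_walk _ _ _ _ B x n)).
set L := lim_sup_set _.
have mL : measurable L.
  by apply: bigcap_measurableType => k _; exact: bigcup_measurable.
have LC : P (~` L) = 0%E.
  apply/negligibleP; first exact: measurableC.
  have : {ae P, forall w, L w}.
    apply: filterS (ae_visits x0 z0 e0) => w io m _.
    have [n mn h] := io m; exists n => //; split.
      by apply: zV; rewrite /ball/= distrC.
    exact: reflected_walk_ge0.
  by [].
by rewrite -[L]setCK probability_setC ?LC ?sube0//; exact: measurableC.
Qed.

End recurrence.

Lemma measurable_sqrtr (R : realType) : measurable_fun setT (@Num.sqrt R).
Proof. by apply: continuous_measurable_fun; exact: sqrt_continuous. Qed.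

Lemma sqrt_max0 (R : realType) (b : R) : Num.sqrt (Num.max b 0) = Num.sqrt b.
Proof. by case: leP => // b0; rewrite sqrtr0 ler0_sqrtr. Qed.

Theorem theorem5p10 (R : realType) (d : measure_display) (T : measurableType d)
  (P : probability T R) (B : nat -> {RV P >-> R}) (mu : probability R R)
  (Biid : iid_with_law B mu)
  (mu_pos : measure_support mu `&` [set x : R | 0 < x] !=set0)
  (mu_nonlattice : ~ exists kappa : R, 0 < kappa /\
     measure_support mu `<=` [set kappa * k%:~R | k in [set: int]])
  (B_neg : (0 < P [set w | (B 0%N w < 0)%R])%E)
  (moments :
     (('E_P[((B 0%N)^\-)%R] < 'E_P[((B 0%N)^\+)%R])%E /\
      ('E_P[fun w => (Num.sqrt ((B 0%N)^\+ w))%R] < +oo)%E)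
     \/
     ((0 < 'E_P[((B 0%N)^\-)%R])%E /\ ('E_P[((B 0%N)^\-)%R] = 'E_P[((B 0%N)^\+)%R])%E /\
      ('E_P[fun w => (Num.sqrt ((B 0%N)^\+ w) ^+ 3)%R] < +oo)%E)) :
  topologically_recurrent P (reflected_walk (fun n w => B n w)) (nonneg_reals R).
Proof.
have [p [Sp /= p0]] := mu_pos.
have [r [r0 Sr]] : `]-oo, 0[%classic `&` measure_support mu !=set0.
  apply: open_meets_support; first exact: interval_open.
  rewrite -(Biid.2 0%N)//.
rewrite /= in_itv/= in r0.
apply: (recurrent_of_transient_set_null Biid p0 Sp r0 Sr _ mu_nonlattice).
have law (f : R -> R) : measurable_fun setT f -> (forall b, 0 <= f b) ->
    ('E_P[fun w => f (B 0%N w)] = \int[mu]_b (f b)%:E)%E.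
  move=> mf f0; rewrite unlock.
  apply: (integral_increment_law Biid 0%N (f := EFin \o f)).
  by split; [exact/measurable_EFinP|move=> b; rewrite lee_fin].
have mneg : measurable_fun setT (fun b : R => Num.max (- b) 0).
  by apply: measurable_maxr => //; exact: measurableT_comp.
have mpos : measurable_fun setT (fun b : R => Num.max b 0).
  exact: measurable_maxr.
have lawneg : ('E_P[((B 0%N)^\-)%R] = \int[mu]_b (Num.max (- b) 0)%:E)%E.
  by rewrite -law// => b; rewrite le_max lexx orbT.
have lawpos : ('E_P[((B 0%N)^\+)%R] = \int[mu]_b (Num.max b 0)%:E)%E.
  by rewrite -law// => b; rewrite le_max lexx orbT.
have ms := @measurable_sqrtr R.
case: moments => [[drift fin]|[pos [zero fin]]].
  rewrite lawneg lawpos in drift.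
  have [C C0 gC] := drift_green drift.
  apply: (transient_set_null_of_green Biid p0 Sp (kappa := cst C)) => //.
  - move=> t t0; apply: le_trans gC; apply: le_green => [||z _].
    + apply: nonneg_measurable_if => //; first exact: measurable_fun_ltr.
    + by apply: nonneg_measurable_cst; rewrite lee01.
    + by case: ifP => // _; rewrite lee01.
  - have sfin : (\int[mu]_b (Num.sqrt b)%:E < +oo)%E.
      rewrite -(law _ ms (@sqrtr_ge0 R)); move: fin.
      rewrite (_ : (fun w => Num.sqrt _) = fun w => Num.sqrt (B 0%N w))//.
      by apply/funext => w; exact: sqrt_max0.
    have sge0 b : (0 <= (Num.sqrt b)%:E)%E by rewrite lee_fin sqrtr_ge0.
    have -> : (\int[mu]_b (cst C b * Num.sqrt b)%:E = C%:E * \int[mu]_b (Num.sqrt b)%:E)%E.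
      by rewrite -ge0_integralZl//; exact/measurable_EFinP.
    by rewrite lte_mul_pinfty// lee_fin.
  - exact: drift_stay0.
rewrite lawneg in pos; rewrite lawneg lawpos in zero.
pose s3 (b : R) := Num.sqrt b ^+ 3.
have s3_ge0 b : 0 <= s3 b by rewrite exprn_ge0// sqrtr_ge0.
have ms3 : measurable_fun setT s3 by exact: measurable_funX.
have fin3 : (\int[mu]_b (1 + s3 b)%:E < +oo)%E.
  under eq_integral do rewrite EFinD.
  rewrite ge0_integralD//; last 2 first.
  + by move=> b _; rewrite lee_fin.
  + exact/measurable_EFinP.
  have -> := integral_cst mu measurableT 1%E.
  rewrite mul1e; apply: lte_add_pinfty; first by rewrite ltey_eq fin_num_measure.
  rewrite -(law s3)//; move: fin.
  rewrite (_ : (fun w => _ ^+ 3) = fun w => s3 (B 0%N w))//.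
  by apply/funext => w; rewrite /s3 -(sqrt_max0 (B 0%N w)).
have sqle b : Num.max b 0 = Num.sqrt b ^+ 2.
  by have [b0|b0] := leP b 0; [rewrite ler0_sqrtr ?expr0n|rewrite sqr_sqrtr// ltW].
(* With [s] the square root of [b], this controls by [1 + s ^+ 3] both [b^+ = s ^+ 2] and
   [kappa b * s], a combination of [s ^+ 3] and [s]. *)
have sle (s : R) : 0 <= s -> s ^+ 2 + s <= 1 + s ^+ 3.
  move=> s0; have : 0 <= (s - 1) ^+ 2 * (s + 1) by rewrite mulr_ge0 ?sqr_ge0 ?addr_ge0.
  have -> : (s - 1) ^+ 2 * (s + 1) = s ^+ 3 - s ^+ 2 - s + 1 by ring.
  lra.
set beta := (\int[mu]_b (Num.max b 0)%:E)%E in zero.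
have beta_fin : (beta < +oo)%E.
  apply: le_lt_trans fin3; apply: ge0_le_integral => //.
  - by move=> b _; rewrite lee_fin le_max lexx orbT.
  - exact/measurable_EFinP.
  - by apply/measurable_EFinP; exact: measurable_funD.
  - move=> b _; rewrite lee_fin sqle; apply: le_trans (sle _ (sqrtr_ge0 b)).
    by rewrite lerDl sqrtr_ge0.
have beta_gt0 : (0 < beta)%E by rewrite -zero.
(* Half of [- r], so that the support point [r] is interior to []-oo, - e[], which then has positive
   mass. *)
pose e := - r / 2; have e0 : 0 < e by rewrite /e; lra.
have mue := measure_lt_half_support r0 Sr.
set q := fine (mu `]-oo, (- e)%R[%classic).
have q0 : 0 < q by rewrite -lte_fin fineK// fin_num_measure.
(* The bound of [green_linear]; [Num.max t 0] makes it nonnegative and nondecreasing on all of R. *)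
pose kappa t := (Num.max t 0 / e + 1) / q.
have kappa_ge0 t : 0 <= kappa t.
  apply: divr_ge0; last exact: ltW.
  apply: addr_ge0 => //; apply: divr_ge0; last exact: ltW.
  by rewrite le_max lexx orbT.
have c_ge0 : 0 <= (e^-1 + 1) / q.
  apply: divr_ge0; last exact: ltW.
  by apply: addr_ge0 => //; rewrite invr_ge0 ltW.
apply: (transient_set_null_of_green Biid p0 Sp (kappa := kappa)) => //.
- apply: measurable_funM => //; apply: measurable_funD => //.
  exact: measurable_funM.
- move=> s t st; rewrite ler_pM2r ?invr_gt0// lerD2r ler_pM2r ?invr_gt0//.
  by rewrite ge_max !le_max st lexx orbT.
- move=> t t0; rewrite /kappa (max_l (ltW t0)).
  exact: (green_linear Biid e0 mue t0).
- apply: (@le_lt_trans _ _ (\int[mu]_b (((e^-1 + 1) / q)%:E * (1 + s3 b)%:E))%E).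
    apply: ge0_le_integral => //.
    + by move=> b _; rewrite lee_fin mulr_ge0 ?sqrtr_ge0.
    + apply/measurable_EFinP; apply: measurable_funM => //.
      apply: measurable_funM => //; apply: measurable_funD => //.
      exact: measurable_funM.
    + apply/measurable_EFinP; apply: measurable_funM => //.
      exact: measurable_funD.
    + move=> b _; rewrite lee_fin /kappa sqle.
      rewrite mulrAC [leRHS]mulrAC ler_pM2r ?invr_gt0// /s3.
      have := sle _ (sqrtr_ge0 b); move: (Num.sqrt b) => s hs.
      have s2 : 0 <= s ^+ 2 by exact: sqr_ge0.
      have i0 : 0 < e^-1 by rewrite invr_gt0.
      rewrite mulrDl mul1r mulrAC -exprSr mulrDl mulrDr mulr1 mul1r [_ / e]mulrC; lra.
  rewrite ge0_integralZl//; last 2 first.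
  + by apply/measurable_EFinP; exact: measurable_funD.
  + by move=> b _; rewrite lee_fin addr_ge0.
  by rewrite lte_mul_pinfty// lee_fin.
- exact: (zero_drift_stay0 beta_gt0 beta_fin zero e0 mue).
Qed.
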